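(* Let $\mathbf{A}\in\mathbb{C}^{I_1\times\dots\times I_N\times I_1\times\dots\times I_N}$ be a random Hermitian tensor with i.i.d. entries (up to the Hermitian symmetry) having zero mean and unit variance. Then, as $\prod_{k=1}^N I_k\to\infty$, the (empirical) distribution of the tensor eigenvalues of $$\frac{1}{\sqrt{\prod_{k=1}^N I_k}}\,\mathbf{A}$$ converges almost surely, in the sense of weak convergence, to the semi-circle distribution of parameter $\beta=2$, i.e. to the probability distribution supported on $[-2,2]$ with density $$f(x)=\frac{1}{2\pi}\sqrt{4-x^2}.$$
   Context: Write a multi-index as $\mathbf{i}=(i_1,\dots,i_N)$ with $1\le i_k\le I_k$; the entries of a tensor $\mathscr{A}\in\mathbb{C}^{I_1\times\dots\times I_N\times I_1\times\dots\times I_N}$ are $\mathscr{A}_{\mathbf{i},\mathbf{i}'}$. Hermitian: $\mathscr{A}^H$ is defined by $(\mathscr{A}^H)_{\mathbf{i},\mathbf{i}'}=\overline{\mathscr{A}_{\mathbf{i}',\mathbf{i}}}$, and $\mathscr{A}$ is Hermitian if $\mathscr{A}=\mathscr{A}^H$. Einstein product: $(\mathscr{A}*_N\mathscr{B})_{\mathbf{i},\mathbf{i}''}=\sum_{\mathbf{i}'}\mathscr{A}_{\mathbf{i},\mathbf{i}'}\mathscr{B}_{\mathbf{i}',\mathbf{i}''}$. A tensor $\mathscr{D}$ of this shape is pseudo-diagonal if $\mathscr{D}_{\mathbf{i},\mathbf{i}'}=0$ whenever $\mathbf{i}\ne\mathbf{i}'$; the identity tensor $\mathscr{I}_N$ is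 the pseudo-diagonal tensor with all pseudo-diagonal entries equal to $1$; $\mathscr{U}$ is unitary if $\mathscr{U}*_N\mathscr{U}^H=\mathscr{U}^H*_N\mathscr{U}=\mathscr{I}_N$. Tensor eigenvalues: a Hermitian tensor admits a decomposition $\mathscr{A}=\mathscr{U}*_N\mathscr{D}*_N\mathscr{U}^H$ with $\mathscr{U}$ unitary and $\mathscr{D}$ real pseudo-diagonal; the tensor eigenvalues of $\mathscr{A}$ are the $\prod_k I_k$ pseudo-diagonal entries $\mathscr{D}_{\mathbf{i},\mathbf{i}}$, counted with multiplicity. The empirical distribution of $d$ real numbers $\lambda_1,\dots,\lambda_d$ is the probability measure $\frac1d\sum_{i=1}^d\delta_{\lambda_i}$. *)

(* Defs.v *)
From HB Require Import structures.
From mathcomp Require Import all_boot all_order all_algebra.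
From mathcomp Require Import all_classical all_reals all_analysis measurable_realfun.
From mathcomp Require Import ring lra.
From mathcomp Require Export complex.

Set Implicit Arguments.
Unset Strict Implicit.
Unset Printing Implicit Defensive.

Import Order.TTheory GRing.Theory Num.Theory numFieldNormedType.Exports.

Local Open Scope classical_set_scope.
Local Open Scope ring_scope.

Section tensors.
Variables (R : realType) (N : nat).

(* Dimensions are numbered from 0: [I k] is I_{k+1}. *)
Definition tshape := {ffun 'I_N -> nat}.

Definition vol (I : tshape) : nat := (\prod_(k < N) I k)%N.

(* Multi-indices: dependent tuples (i_k)_k with i_k in {0, ..., I_k - 1}. *)
Definition midx (I : tshape) : finType := {dffun forall k : 'I_N, 'I_(I k)}.

Definition tensor (I : tshape) := midx I -> midx I -> R[i].

Variable I : tshape.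
Implicit Types A B D U : tensor I.

Definition tscale (c : R) A : tensor I := fun i j => real_complex R c * A i j.

Definition hconj A : tensor I := fun i j => Num.conj (A j i).

Definition hermitian_tensor A := A = hconj A.

Definition einstein A B : tensor I := fun i j => \sum_(k : midx I) A i k * B k j.

Definition pseudodiagonal D := forall i j, i != j -> D i j = 0.

Definition real_pseudodiagonal D :=
  pseudodiagonal D /\ forall i, complex.Im (D i i) = 0.

Definition tensor_id : tensor I := fun i j => (i == j)%:R.

Definition unitary_tensor U :=
  einstein U (hconj U) = tensor_id /\ einstein (hconj U) U = tensor_id.

Definition spectral_decomposition A U D :=
  [/\ unitary_tensor U, real_pseudodiagonal D &
      A = einstein (einstein U D) (hconj U)].

Lemma hermitian_spectral A :
  hermitian_tensor A -> exists U D, spectral_decomposition A U D.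
Proof.
move=> hA; pose T := midx I; pose n := #|{: T}|.
pose M : 'M[R[i]]_n := \matrix_(i, j) A (enum_val i) (enum_val j).
pose tens (X : 'M[R[i]]_n) : tensor I := fun i j => X (enum_rank i) (enum_rank j).
have tensM (X Y : 'M[R[i]]_n) : einstein (tens X) (tens Y) = tens (X *m Y).
  apply/funext => i; apply/funext => j.
  rewrite /einstein /tens mxE (reindex (@enum_rank T)) /=; first by [].
  exact/onW_bij/enum_rank_bij.
have tensH (X : 'M[R[i]]_n) : hconj (tens X) = tens (map_mx Num.conj X^T).
  by apply/funext => i; apply/funext => j; rewrite /hconj /tens !mxE.
have tens1 : tens 1%:M = @tensor_id.
  apply/funext => i; apply/funext => j.
  by rewrite /tens /tensor_id mxE (inj_eq enum_rank_inj).
have tensK : tens M = A.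
  by apply/funext => i; apply/funext => j; rewrite /tens mxE !enum_rankK.
have hM : M \is hermsymmx.
  apply/is_hermitianmxP; rewrite expr0 scale1r; apply/matrixP => i j.
  by rewrite !mxE {1}hA.
have Mreal := hermitian_spectral_diag_real hM.
have /orthomx_spectralP ME := hermitian_normalmx hM.
have Pu := spectral_unitarymx M.
set P := spectralmx M in ME Pu; set sp := spectral.spectral_diag M in ME Mreal.
exists (tens (map_mx Num.conj P^T)), (tens (diag_mx sp)); split.
- have PP : map_mx Num.conj P^T *m P = 1%:M.
    by rewrite -(invmx_unitary Pu) mulVmx ?unitarymx_unit.
  have PP' : P *m map_mx Num.conj P^T = 1%:M by apply/unitarymxP.
  by rewrite /unitary_tensor tensH trmxCK !tensM PP PP' tens1.
- split=> [i j ij|i]; first by rewrite /tens mxE (inj_eq enum_rank_inj) (negbTE ij).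
  rewrite /tens mxE eqxx mulr1n.
  by move/mxOverP: Mreal => /(_ ord0 (enum_rank i)); case/complex_realP=> k ->.
- by rewrite tensH trmxCK !tensM -(invmx_unitary Pu) -ME tensK.
Qed.

(* The pseudo-diagonal factor of a chosen spectral decomposition. It exists for
   every Hermitian tensor by [hermitian_spectral], and its pseudo-diagonal
   entries do not depend on the choice, up to permutation. *)
Definition spectral_part A : tensor I :=
  xget (fun _ _ => 0) [set D | exists U, spectral_decomposition A U D].

Definition tensor_eigenvalues A : seq R :=
  [seq complex.Re (spectral_part A i i) | i <- enum (midx I)].

End tensors.

(* "\prod_k I_k -> +oo", as a filter on shapes: no other constraint is put on
   the way the individual dimensions vary. *)
Definition vol_infty (N : nat) : set_system (tshape N) :=
  filter_from [set: nat] (fun M => [set I : tshape N | (M <= vol I)%N]).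

Global Instance vol_infty_filter (N : nat) : Filter (@vol_infty N).
Proof.
apply: filter_from_filter; first by exists 0%N.
move=> M M' _ _; exists (maxn M M') => // I /=.
by rewrite geq_max => /andP[].
Qed.

(* The substitution x = 2 sin t gives the total mass of the semi-circle. *)
Section semicircle_mass.
Variable R : realType.

Let G (x : R) := Num.sqrt (4 - x ^+ 2).
Let F (x : R) := 2 * sin x.
Let H (x : R) := 2 * x + 2 * (sin x * cos x).
Let a : R := - (pi / 2).
Let b : R := pi / 2.

Lemma continuous_semicircle : continuous (fun x : R => Num.sqrt (4 - x ^+ 2)).
Proof.
move=> x.
apply: (@continuous_comp _ _ _ (fun x : R => (4 - x ^+ 2)%R) (@Num.sqrt R)).
  by apply: cvgB; [exact: cvg_cst | exact: exprn_continuous].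
exact: sqrt_continuous.
Qed.

Let dF (x : R) : is_derive x 1 F (2 * cos x).
Proof. by apply: is_deriveZ. Qed.

Let FE : (derive1 F) = (fun x => 2 * cos x).
Proof. by apply/funext => x; rewrite derive1E; apply: (@derive_val _ _ _ _ _ _ _ (dF x)). Qed.

Let cF : continuous F.
Proof. by move=> x; apply: cvgM; [ exact: cvg_cst | exact: continuous_sin]. Qed.

Let cF' : continuous (derive1 F).
Proof. by rewrite FE => x; apply: cvgM; [ exact: cvg_cst | exact: continuous_cos]. Qed.

Let dH (x : R) : is_derive x 1 H (4 * cos x ^+ 2).
Proof.
rewrite /H.
apply: is_derive_eq.
have := sin2cos2 x => E. rewrite /GRing.scale /=.
rewrite /GRing.scale /=.
ring: E.
Qed.

Let ab : a < b. Proof. by rewrite /a /b; have := pi_gt0 R; lra. Qed.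

Let incF : {in `[a, b] &, {homo F : x y / (x < y)%R}}.
Proof.
move=> x y; rewrite !in_itv => /andP[x1 x2] /andP[y1 y2] xy; rewrite /F.
rewrite (@ltr_pM2l R 2) //; move: x1 x2 y1 y2 => /= x1 x2 y1 y2.
have ds z : z \in `]x, y[%R -> is_derive z 1 (@sin R) (cos z).
  by move=> _; exact: is_derive_sin.
have cs : {within `[x, y], continuous (@sin R)}.
  by apply: continuous_subspaceT; exact: continuous_sin.
have [z] := MVT xy ds cs; rewrite in_itv /= => /andP[z1 z2] E.
rewrite -subr_gt0 E mulr_gt0 ?subr_gt0 // cos_gt0_pihalf //.
by apply/andP; split; [exact: le_lt_trans z1 | exact: lt_le_trans y2].
Qed.

Let diffc (K : R -> R) : (forall x, derivable K x 1) -> continuous K ->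
  derivable_oo_LRcontinuous K a b.
Proof.
move=> dK cK; split; first by move=> x _; exact: dK.
- exact/cvg_at_right_filter/cK.
- exact/cvg_at_left_filter/cK.
Qed.

Lemma integral_semicircle : (\int[@lebesgue_measure R]_(x in `[(-2)%R, 2%R])
    (Num.sqrt (4 - x ^+ 2))%:E = (2 * pi)%:E)%E.
Proof.
have Fa : F a = -2 by rewrite /F /a sinN sin_pihalf mulrN1.
have Fb : F b = 2 by rewrite /F /b sin_pihalf mulr1.
rewrite -[in `[_, _]]Fa -[in X in `[_, X]]Fb.
rewrite (@integration_by_substitution_increasing _ F G).
- under eq_integral => x.
    rewrite inE /= in_itv /= => xab.
    rewrite [(_ * _) x](_ : _ = 4 * cos x ^+ 2); last first.
      have e4 : 4 - (2 * sin x) ^+ 2 = (2 * cos x) ^+ 2.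
        by have := sin2cos2 x => E; ring: E.
      rewrite FE.
      change (Num.sqrt (4 - (2 * sin x) ^+ 2) * (2 * cos x) = 4 * cos x ^+ 2).
      rewrite e4 sqrtr_sqr ger0_norm ?mulr_ge0 ?cos_ge0_pihalf //.
      by ring.
    over.
  rewrite (@continuous_FTC2 R _ H a b ab).
  + rewrite /H /a /b cosN cos_pihalf !mulr0 -EFinB; congr EFin; lra.
  + apply: continuous_subspaceT => x.
    apply: cvgM; first exact: cvg_cst.
    apply: (@continuous_comp _ _ _ (@cos R) (fun x => x ^+ 2)).
      exact: continuous_cos.
    exact: exprn_continuous.
  + apply: diffc => x; first by case: (dH x).
    by apply/differentiable_continuous/derivable1_diffP; case: (dH x).
  + by move=> x _; rewrite derive1E (@derive_val _ _ _ _ _ _ _ (dH x)).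
- exact: ltW ab.
- exact: incF.
- by move=> x _; exact: cF'.
- by apply/cvg_ex; eexists; exact/cvg_at_right_filter/cF'.
- by apply/cvg_ex; eexists; exact/cvg_at_left_filter/cF'.
- apply: diffc; last exact: cF.
  by move=> x; case: (dF x).
- by apply: continuous_subspaceT; exact: continuous_semicircle.
Qed.

End semicircle_mass.

Section measures.
Variable R : realType.
Local Open Scope ereal_scope.

Definition empirical_distribution (s : seq R) : {measure set R -> \bar R} :=
  mscale ((size s)%:R^-1)%:nng%R (msum (fun k => \d_(nth 0%R s k)) (size s)).

Definition semicircle_pdf (x : R) : R :=
  ((2 * pi)^-1 * Num.sqrt (4 - x ^+ 2) * \1_`[(-2)%R, 2%R] x)%R.

Lemma semicircle_pdf_ge0 x : (0 <= semicircle_pdf x)%R.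
Proof. by rewrite !mulr_ge0 ?invr_ge0 ?mulr_ge0 ?pi_ge0 ?sqrtr_ge0. Qed.

Lemma measurable_semicircle_pdf : measurable_fun [set: R] semicircle_pdf.
Proof.
apply: measurable_funM; last exact: measurable_indic.
apply: measurable_funM => //.
by apply: continuous_measurable_fun; exact: continuous_semicircle.
Qed.

Definition semicircle (V : set R) : \bar R :=
  \int[lebesgue_measure]_(x in V) (semicircle_pdf x)%:E.

Let semicircle0 : semicircle set0 = 0.
Proof. exact: integral_set0. Qed.

Let semicircle_ge0 V : 0 <= semicircle V.
Proof. by apply: integral_ge0 => x _; rewrite lee_fin semicircle_pdf_ge0. Qed.

Let semicircle_sigma_additive : semi_sigma_additive semicircle.
Proof.
move=> F mF tF mUF; rewrite /semicircle ge0_integral_bigcup//; last 2 first.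
- apply/measurable_EFinP.
  exact: measurable_funTS measurable_semicircle_pdf.
- by move=> x _; rewrite lee_fin semicircle_pdf_ge0.
apply: is_cvg_ereal_nneg_natsum_cond => n _ _; exact: semicircle_ge0.
Qed.

HB.instance Definition _ := isMeasure.Build _ _ _ semicircle
  semicircle0 semicircle_ge0 semicircle_sigma_additive.

Let semicircle_setT : semicircle setT = 1.
Proof.
rewrite /semicircle (_ : \int[_]_(x in _) _ =
    \int[lebesgue_measure]_(x in setT `&` `[(-2)%R, 2%R])
      (((2 * pi)^-1)%:E * (Num.sqrt (4 - x ^+ 2))%:E)); last first.
  rewrite integral_mkcondr; apply: eq_integral => x _.
  rewrite patchE /semicircle_pdf indicE.
  by case: ifP => _; rewrite ?mulr1 ?mulr0 ?EFinM.
rewrite setTI ge0_integralZl_EFin//.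
- by rewrite integral_semicircle -EFinM mulVf// mulf_neq0// gt_eqF ?pi_gt0.
- apply/measurable_EFinP; apply: measurable_funTS.
  by apply: continuous_measurable_fun; exact: continuous_semicircle.
- by rewrite invr_ge0 mulr_ge0 ?pi_ge0.
Qed.

HB.instance Definition _ :=
  @Measure_isProbability.Build _ _ R semicircle semicircle_setT.

(* Weak convergence of the family of measures [mu] along the filter [F]. *)
Definition weak_cvg (J : Type) (F : set_system J)
    (mu : J -> {measure set R -> \bar R}) (nu : {measure set R -> \bar R}) :=
  forall f : R -> R, continuous f -> bounded_fun f ->
    (fun j => \int[mu j]_x (f x)%:E) @ F --> \int[nu]_x (f x)%:E.

End measures.

Section random_tensors.
Context (R : realType) (N : nat) (d : measure_display) (T : measurableType d).
Variable P : probability T R.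

(* Complex random variables are handled through R * R and its Borel
   sigma-algebra. *)
Definition complex_pair (z : R[i]) : R * R := (complex.Re z, complex.Im z).

(* Mutual independence of the random variables X_p, p in S: product rule over
   every subfamily. *)
Definition mutually_independent (J : finType) (S : {set J})
    (X : J -> T -> R * R) :=
  forall (K : {set J}) (B : J -> set (R * R)),
    K \subset S -> (forall p, measurable (B p)) ->
    P (\bigcap_(p in [set` K]) (X p @^-1` B p)) =
    (\prod_(p in K) fine (P (X p @^-1` B p)))%:E.

Definition identically_distributed (X Y : T -> R * R) :=
  forall B : set (R * R), measurable B -> P (X @^-1` B) = P (Y @^-1` B).

Definition entry (I : tshape N) (A : T -> tensor R I) (i j : midx I) :
  T -> R * R := fun w => complex_pair (A w i j).

(* [S] contains the pseudo-diagonal and exactly one position out of each pair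
   of mirror positions (i, j), (j, i): the entries in such a set determine
   a Hermitian tensor. *)
Definition half_positions (I : tshape N) (S : {set midx I * midx I}) :=
  (forall i, (i, i) \in S) /\
  (forall i j, i != j -> ((i, j) \in S) != ((j, i) \in S)).

(* A complex entry z has variance E|z - E z|^2 = V(Re z) + V(Im z). *)
Definition standardized (X : T -> R * R) :=
  [/\ ('E_P[fst \o X] = 0)%E, ('E_P[snd \o X] = 0)%E &
      ('V_P[fst \o X] + 'V_P[snd \o X] = 1)%E].

(* Random Hermitian tensors [A I], one for each shape, on a common probability
   space, each with i.i.d. standardized entries up to the Hermitian symmetry.
   The pseudo-diagonal entries being real, "identically distributed" is required
   separately on and off the pseudo-diagonal; the laws do not depend on the
   shape. Nothing is assumed on the joint law of tensors of different shapes. *)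
Record iid_hermitian_tensors (A : forall I : tshape N, T -> tensor R I)
    (S : forall I : tshape N, {set midx I * midx I}) : Prop := {
  half_S : forall I, half_positions (S I);
  entry_measurable : forall I (i j : midx I),
    measurable_fun setT (entry (A I) i j);
  tensor_hermitian : forall I w, hermitian_tensor (A I w);
  entry_independent : forall I,
    mutually_independent (S I) (fun p => entry (A I) p.1 p.2);
  entry_offdiag_law : forall I I' (p : midx I * midx I) (q : midx I' * midx I'),
    p \in S I -> q \in S I' -> p.1 != p.2 -> q.1 != q.2 ->
    identically_distributed (entry (A I) p.1 p.2) (entry (A I') q.1 q.2);
  entry_diag_law : forall I I' (i : midx I) (j : midx I'),
    identically_distributed (entry (A I) i i) (entry (A I') j j);
  entry_standardized : forall I (i j : midx I),
    standardized (entry (A I) i j) }.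

End random_tensors.

(* Main.v *)
(* Unfolding a tensor of shape I turns the Einstein product into the product of
   matrices of size n = vol I, so the claim is Wigner's theorem for an array of
   Hermitian matrices H = A / sqrt n which may be coupled arbitrarily across
   shapes. Let s(z) = tr (H - z)^-1 / n. For fixed z in the upper half-plane,

   - E [1 + z s + s^2] -> 0, by expanding the resolvent in a single entry and its
     mirror image; two moments suffice thanks to a Lindeberg condition;
   - resampling one row of the half-array is a perturbation of rank at most 2 and
     moves s by O(1/n), so s has fourth central moment O(n^-2).

   Both steps are carried out after rounding the entries to a finite grid, where
   expectations are finite sums. Hence 1 + z s + s^2 exceeds a given e with
   probability O(n^-2). The sum of (vol I)^(-3/2) over all shapes factors into a
   product of N convergent series, so Borel-Cantelli applies along the filter
   vol I -> oo, simultaneously for a countable family of points z.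

   At z = t + i eta, 1 + z s + s^2 ~ 0 forces Im s to be close to
   sqrt (4 - t^2) / 2, and Im s is the Poisson smoothing of the empirical
   distribution at scale eta: integrating against a test function over [-2, 2]
   gives weak convergence, and the missing mass outside [-2, 2] is small because
   the semi-circle already has mass 1. *)
Require Import Defs.
From HB Require Import structures.
From mathcomp Require Import all_boot all_order all_algebra.
From mathcomp Require Import all_classical all_reals all_analysis.
From mathcomp Require Import measurable_realfun ring lra.

Set Implicit Arguments.
Unset Strict Implicit.
Unset Printing Implicit Defensive.

Import Order.TTheory GRing.Theory Num.Theory numFieldNormedType.Exports.
Import Normc.

Local Open Scope classical_set_scope.
Local Open Scope ring_scope.
Local Open Scope sesquilinear_scope.

(** * Resolvents of Hermitian matrices *)

(** With finite-valued entries, mutual independence says that the law of the half-array is a product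
    weight on a finite function space, and conditional expectation becomes a finite average over a
    block of coordinates. The rounding depends on n: step 1 / n, cut at n^2. Chebyshev over the n^2
    positions makes a cut happen with probability at most n^-2, the order of the concentration
    bound, and rounding towards 0 keeps all moments dominated by the original ones. It spoils the
    exact mean and variance, which enter as defects tending to 0; as the laws do not depend on the
    shape, the threshold on n is common to all shapes.

    The fourth moment is forced by Borel-Cantelli: a variance bound would give probability O(1/n),
    not summable even for N = 1.

    Smallness of 1 + z s + s^2 is exploited directly, at finitely many points close to the real
    axis: there the polynomial factors explicitly up to an error O(eta), and the factorization
    remains usable at the spectral edges, where its two roots merge. *)

Section complex_modulus.
Variable R : rcfType.
Implicit Types z w : R[i].

Lemma normcE2 z : normc z ^+ 2 = complex.Re z ^+ 2 + complex.Im z ^+ 2.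
Proof. by case: z => a b /=; rewrite sqr_sqrtr // addr_ge0 // sqr_ge0. Qed.

Lemma normc_ge0 z : 0 <= normc z.
Proof. by case: z => a b; exact: sqrtr_ge0. Qed.

Lemma normc_normr z : (normc z)%:C%C = `|z|.
Proof. by case: z. Qed.

Lemma normcB_le z w : normc (z - w) <= normc z + normc w.
Proof. by rewrite -(normcN w); exact: le_normcD. Qed.

Lemma normc_conj z : normc (Num.conj z) = normc z.
Proof. by apply: (@complexI R); rewrite !normc_normr; exact: normcJ. Qed.

Lemma normc_real (x : R) : normc x%:C%C = `|x|.
Proof. by rewrite /= expr0n /= addr0 sqrtr_sqr. Qed.

Lemma normcX z k : normc (z ^+ k) = normc z ^+ k.
Proof. by elim: k => [|k IH]; rewrite ?expr0 ?normc1// !exprS normcM IH. Qed.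

Lemma normc_sum (I : Type) (r : seq I) (Q : pred I) (F : I -> R[i]) :
  normc (\sum_(i <- r | Q i) F i) <= \sum_(i <- r | Q i) normc (F i).
Proof.
elim/big_rec2: _ => [|i x y _ h]; first by rewrite normc0.
by apply: le_trans (le_normcD _ _) _; rewrite lerD2l.
Qed.

Lemma mulcJE z : z * Num.conj z = (normc z ^+ 2)%:C%C.
Proof. by rewrite rmorphXn /= normc_normr sqr_normc. Qed.

Lemma normr_Re_le z : `|complex.Re z| <= normc z.
Proof. by rewrite -lecR normc_normr normc_ge_Re. Qed.

Lemma normr_Im_le z : `|complex.Im z| <= normc z.
Proof.
rewrite -(@ler_pXn2r _ 2) ?nnegrE ?normc_ge0 //.
by rewrite normcE2 real_normK ?num_real// lerDr sqr_ge0.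
Qed.

Lemma normc_le_ReIm z : normc z <= `|complex.Re z| + `|complex.Im z|.
Proof.
rewrite -(@ler_pXn2r _ 2) ?nnegrE ?normc_ge0 ?addr_ge0 //.
rewrite normcE2 sqrrD !real_normK ?num_real//.
have := mulr_ge0 (normr_ge0 (complex.Re z)) (normr_ge0 (complex.Im z)).
rewrite mulr2n; lra.
Qed.

Lemma Re_sum (I : Type) (r : seq I) (Q : pred I) (F : I -> R[i]) :
  complex.Re (\sum_(i <- r | Q i) F i) = \sum_(i <- r | Q i) complex.Re (F i).
Proof. by elim/big_rec2: _ => // i x y _ <-; case: (F i) y => ? ? []. Qed.

Lemma Im_sum (I : Type) (r : seq I) (Q : pred I) (F : I -> R[i]) :
  complex.Im (\sum_(i <- r | Q i) F i) = \sum_(i <- r | Q i) complex.Im (F i).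
Proof. by elim/big_rec2: _ => // i x y _ <-; case: (F i) y => ? ? []. Qed.

End complex_modulus.

Section diagonalization.
Variable C : numClosedFieldType.

(** [invmx] leaves a singular matrix unchanged, so this is the resolvent only off the spectrum;
    [resolvent_diag] and [sub_scalar_unitmx] supply the invertibility. *)
Definition resolvent n (H : 'M[C]_n) (z : C) : 'M[C]_n := invmx (H - z%:M).

Lemma adjmxM m n p (A : 'M[C]_(m, n)) (B : 'M[C]_(n, p)) :
  (A *m B)^t* = B^t* *m A^t*.
Proof. by rewrite trmx_mul map_mxM. Qed.

Lemma hermitian_diagonalizable n (H : 'M[C]_n) : H^t* = H ->
  exists (Q : 'M[C]_n) (lam : 'rV[C]_n),
  [/\ Q *m Q^t* = 1%:M, Q^t* *m Q = 1%:M, H = Q^t* *m diag_mx lam *m Q &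
      lam \is a mxOver Num.real].
Proof.
move=> hH.
have hM : H \is hermsymmx.
  by apply/is_hermitianmxP; rewrite expr0 scale1r hH.
have /orthomx_spectralP ME := hermitian_normalmx hM.
have Pu := spectral_unitarymx H.
exists (spectralmx H), (spectral.spectral_diag H); split.
- exact/unitarymxP.
- by rewrite -(invmx_unitary Pu) mulVmx ?unitarymx_unit.
- by apply: etrans ME _; rewrite (invmx_unitary Pu).
- exact: hermitian_spectral_diag_real.
Qed.

(** The diagonalization is arbitrary because the lemma serves twice: for the one given by the
    spectral theorem, and for the unitary factor that comes with the tensor eigenvalues. *)
Lemma resolvent_diag n (H Q : 'M[C]_n) (lam : 'rV[C]_n) (z : C) :
  Q *m Q^t* = 1%:M -> Q^t* *m Q = 1%:M -> H = Q^t* *m diag_mx lam *m Q ->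
  (forall k, lam 0 k - z != 0) ->
  (H - z%:M) \in unitmx /\
  resolvent H z = Q^t* *m diag_mx (\row_k (lam 0 k - z)^-1) *m Q.
Proof.
move=> QQ' Q'Q HE zlam; set G := Q^t* *m _ *m Q.
suff h : (H - z%:M) *m G = 1%:M.
  have [u _] := mulmx1_unit h; split=> //.
  by apply: (can_inj (mulKmx u)); rewrite h /resolvent mulmxV.
have -> : H - z%:M = Q^t* *m diag_mx (\row_k (lam 0 k - z)) *m Q.
  have -> : diag_mx (\row_k (lam 0 k - z)) = diag_mx lam - z%:M.
    by apply/matrixP => i j; rewrite !mxE mulrnBl.
  by rewrite mulmxBr mulmxBl -HE mul_mx_scalar -scalemxAl Q'Q scalemx1.
rewrite /G !mulmxA -(mulmxA _ Q (Q ^t*)) QQ' mulmx1 -(mulmxA (Q ^t*)).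
rewrite mulmx_diag (_ : diag_mx _ = 1%:M) ?mulmx1 //.
by apply/matrixP => i j; rewrite !mxE mulfV.
Qed.

End diagonalization.

Section resolvent.
Variable R : rcfType.
Local Notation C := R[i].

Section fixed_parameter.
Variables (z : C) (eta : R).
Hypotheses (eta_gt0 : 0 < eta) (Imz : complex.Im z = eta).

(** Eigenvalues are real, so [Im z] bounds from below their distance to [z]; the resolvent estimates
    below all rest on this. *)
Lemma eta_le_normc_subr (x : R) : eta <= normc (x%:C%C - z).
Proof.
apply: le_trans (normr_Im_le _); case: z Imz => a b /= ->.
by rewrite sub0r normrN ger0_norm // ltW.
Qed.

Lemma normc_inv_subr (x : R) : normc (x%:C%C - z)^-1 <= eta^-1.
Proof.
rewrite normcV lef_pV2 ?posrE //; first exact: eta_le_normc_subr.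
exact: lt_le_trans eta_gt0 (eta_le_normc_subr _).
Qed.

Lemma subr_neq0 (x : R) : x%:C%C - z != 0.
Proof.
apply: contraTneq eta_gt0 => e; rewrite -leNgt.
by have := eta_le_normc_subr x; rewrite e normc0.
Qed.

Lemma hermitian_resolvent_diag n (H : 'M[C]_n) : H^t* = H ->
  exists (Q : 'M[C]_n) (lam : 'I_n -> R),
  [/\ Q *m Q^t* = 1%:M, Q^t* *m Q = 1%:M, H - z%:M \in unitmx &
   resolvent H z = Q^t* *m diag_mx (\row_k ((lam k)%:C%C - z)^-1) *m Q].
Proof.
move=> /hermitian_diagonalizable[Q [lam [h1 h2 h3 /mxOverP lamR]]].
have lamE k : lam 0 k = (complex.Re (lam 0 k))%:C%C by rewrite RRe_real.
have [|u ->] := resolvent_diag h1 h2 h3 (z := z).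
  by move=> k; rewrite lamE subr_neq0.
exists Q, (fun k => complex.Re (lam 0 k)); split; [exact: h1|exact: h2|exact: u|].
by congr (_ *m diag_mx _ *m _); apply/rowP => k; rewrite !mxE -lamE.
Qed.

Section hermitian.
Variables (n : nat) (H : 'M[C]_n).
Hypothesis hH : H^t* = H.

Lemma sub_scalar_unitmx : H - z%:M \in unitmx.
Proof.
by have [Q [lam []]] := hermitian_resolvent_diag hH.
Qed.

Lemma mulmx_resolvent : (H - z%:M) *m resolvent H z = 1%:M.
Proof. exact/mulmxV/sub_scalar_unitmx. Qed.

Lemma resolvent_mulmx : resolvent H z *m (H - z%:M) = 1%:M.
Proof. exact/mulVmx/sub_scalar_unitmx. Qed.

(** In an eigenbasis the form is a sum of [|r_k|^2 / (lam_k - z)], and passing from [q] to [r]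
    preserves the Euclidean norm. *)
Lemma normc_resolvent_form (q : 'rV[C]_n) :
  normc ((q *m resolvent H z *m q^t*) 0 0) <= (\sum_k normc (q 0 k) ^+ 2) / eta.
Proof.
have [Q [lam [h1 h2 _ ->]]] := hermitian_resolvent_diag hH.
set D := diag_mx _; pose r := q *m Q^t*.
have -> : q *m (Q^t* *m D *m Q) *m q^t* = r *m D *m r^t*.
  by rewrite /r adjmxM trmxCK !mulmxA.
have rr : \sum_k normc (r 0 k) ^+ 2 = \sum_k normc (q 0 k) ^+ 2.
  have e (v : 'rV[C]_n) :
      (v *m v^t*) 0 0 = (\sum_k normc (v 0 k) ^+ 2)%:C%C.
    by rewrite mxE rmorph_sum; apply: eq_bigr => k _; rewrite !mxE mulcJE.
  apply: (@complexI R); rewrite -!e /r adjmxM trmxCK.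
  by rewrite mulmxA -(mulmxA q) h2 mulmx1.
rewrite -rr mxE; apply: le_trans (normc_sum _ _ _) _.
rewrite mulr_suml; apply: ler_sum => k _.
rewrite mul_mx_diag !mxE !normcM normc_conj mulrAC -expr2.
by apply: ler_wpM2l; [exact: sqr_ge0 | exact: normc_inv_subr].
Qed.

(** The sum is a diagonal entry of [G G^*], that is, a mean of the numbers [|lam_k - z|^-2] with
    weights [|Q_ki|^2] of total mass 1. *)
Lemma resolvent_row_sqr (i : 'I_n) :
  \sum_k normc (resolvent H z i k) ^+ 2 <= (eta ^+ 2)^-1.
Proof.
have [Q [lam [h1 h2 _ GE]]] := hermitian_resolvent_diag hH.
set G := resolvent H z in GE *.
have e : (G *m G^t*) i i = (\sum_k normc (G i k) ^+ 2)%:C%C.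
  by rewrite mxE rmorph_sum; apply: eq_bigr => k _; rewrite !mxE mulcJE.
have e' : (G *m G^t*) i i =
    (\sum_k normc (Q k i) ^+ 2 * normc ((lam k)%:C%C - z)^-1 ^+ 2)%:C%C.
  rewrite GE !adjmxM trmxCK !mulmxA -(mulmxA _ Q (Q ^t*)) h1 mulmx1.
  rewrite tr_diag_mx map_diag_mx -(mulmxA (Q ^t*)) mulmx_diag mxE rmorph_sum.
  apply: eq_bigr => k _; rewrite mul_mx_diag !mxE mulcJE.
  by rewrite mulrAC [X in X * _]mulrC mulcJE -(rmorphM (real_complex R)).
have qq : \sum_k normc (Q k i) ^+ 2 = 1.
  apply: (@complexI R); transitivity ((Q^t* *m Q) i i); last by rewrite h2 mxE eqxx.
  by rewrite mxE rmorph_sum; apply: eq_bigr => k _; rewrite !mxE mulrC mulcJE.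
move: e'; rewrite e => /(@complexI R) ->.
rewrite -[leRHS]mul1r -qq mulr_suml; apply: ler_sum => k _.
apply: ler_wpM2l; first exact: sqr_ge0.
rewrite -exprVn ler_pXn2r ?nnegrE ?normc_ge0 ?invr_ge0 ?(ltW eta_gt0) //.
exact: normc_inv_subr.
Qed.

Lemma normc_resolvent (i j : 'I_n) : normc (resolvent H z i j) <= eta^-1.
Proof.
rewrite -(@ler_pXn2r _ 2) ?nnegrE ?normc_ge0 ?invr_ge0 ?(ltW eta_gt0) //.
rewrite exprVn; apply: le_trans (resolvent_row_sqr i).
by rewrite (bigD1 j) //= lerDl sumr_ge0 // => k _; exact: sqr_ge0.
Qed.

End hermitian.

(** Columns of the resolvent are rows of the resolvent of the transpose, which is Hermitian too. *)
Lemma resolvent_col_sqr n (H : 'M[C]_n) (hH : H^t* = H) (j : 'I_n) :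
  \sum_k normc (resolvent H z k j) ^+ 2 <= (eta ^+ 2)^-1.
Proof.
have hHT : (H^T)^t* = H^T by rewrite -[in RHS]hH; apply/matrixP => k l; rewrite !mxE.
have := resolvent_row_sqr hHT j.
rewrite /resolvent (_ : H^T - z%:M = (H - z%:M)^T) -?trmx_inv; last first.
  by rewrite linearB /= tr_scalar_mx.
by under eq_bigr do rewrite mxE.
Qed.

Section two_matrices.
Variables (n : nat) (H H' : 'M[C]_n).
Hypotheses (hH : H^t* = H) (hH' : H'^t* = H').
Local Notation G := (resolvent H z).
Local Notation G' := (resolvent H' z).

Lemma resolvent_identity : G' - G = G *m (H - H') *m G'.
Proof.
have -> : H - H' = (H - z%:M) - (H' - z%:M) by rewrite opprB addrA subrK.
rewrite mulmxBr mulmxBl resolvent_mulmx // mul1mx.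
by rewrite -mulmxA mulmx_resolvent // mulmx1.
Qed.

Lemma resolvent_sum_mul (i j : 'I_n) :
  normc (\sum_k G' i k * G k j) <= (eta ^+ 2)^-1.
Proof.
apply: le_trans (normc_sum _ _ _) _.
apply: (@le_trans _ _
  (\sum_k (normc (G' i k) ^+ 2 / 2 + normc (G k j) ^+ 2 / 2))).
  apply: ler_sum => k _; rewrite normcM.
  have := sqr_ge0 (normc (G' i k) - normc (G k j)); rewrite sqrrB; lra.
rewrite big_split /= -!mulr_suml.
have := resolvent_row_sqr hH' i; have := resolvent_col_sqr hH j; lra.
Qed.

(** By cyclicity the trace pairs [H - H'] with [G' G], whose entries are bounded by Cauchy-Schwarz.
    This suits perturbations with small entries but large rank, such as rounding; the rank bound
    below suits the opposite case. *)
Lemma mxtrace_resolvent_lip :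
  normc (\tr G' - \tr G) <= (\sum_i \sum_j normc (H i j - H' i j)) / eta ^+ 2.
Proof.
rewrite -raddfB /= resolvent_identity -mulmxA mxtrace_mulC -mulmxA.
rewrite /mxtrace mulr_suml; apply: le_trans (normc_sum _ _ _) _.
apply: ler_sum => i _; rewrite mxE mulr_suml.
apply: le_trans (normc_sum _ _ _) _; apply: ler_sum => j _.
rewrite normcM !mxE; apply: ler_wpM2l; first exact: normc_ge0.
exact: resolvent_sum_mul.
Qed.

(* The trace of [M := G' - G] only sees the compression of [M] to its row
   space, where each diagonal entry is at most [2 / eta]. *)
Lemma mxtrace_resolvent_rank :
  normc (\tr G' - \tr G) <= 2 * (\rank (H - H'))%:R / eta.
Proof.
rewrite -raddfB /=; set M := G' - G.
have rM : (\rank M <= \rank (H - H')%R)%N.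
  rewrite /M resolvent_identity.
  exact: leq_trans (mxrankM_maxl _ _) (mxrankM_maxr _ _).
pose B := row_base M; pose Q := schmidt B.
have Qu : Q *m Q^t* = 1%:M.
  by apply/unitarymxP; apply: schmidt_unitarymx; exact: rank_leq_col.
have /submxP[X MX] : (M <= Q)%MS.
  by rewrite -(eq_row_base M); exact: schmidt_sub.
have -> : \tr M = \tr (Q *m M *m Q^t*).
  have MQ : M *m (Q^t* *m Q) = M.
    by apply: (etrans (congr1 (fun Y => Y *m _) MX)); rewrite -mulmxA (mulmxA Q) Qu mul1mx -MX.
  by rewrite -mulmxA mxtrace_mulC -mulmxA MQ.
apply: le_trans (normc_sum _ _ _) _.
apply: (@le_trans _ _ (\sum_(a < \rank M) (2 / eta))); last first.
  rewrite sumr_const card_ord -[leLHS]mulr_natr [leLHS]mulrAC.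
  by rewrite ler_wpM2r ?invr_ge0 ?(ltW eta_gt0)// ler_wpM2l // ler_nat.
apply: ler_sum => a _; pose q := row a Q.
have q1 : \sum_k normc (q 0 k) ^+ 2 = 1.
  apply: (@complexI R); transitivity ((Q *m Q^t*) a a); last first.
    by rewrite Qu mxE eqxx.
  by rewrite mxE rmorph_sum; apply: eq_bigr => k _; rewrite !mxE mulcJE.
have -> : (Q *m M *m Q^t*) a a = (q *m G' *m q^t*) 0 0 - (q *m G *m q^t*) 0 0.
  transitivity ((q *m M *m q^t*) 0 0).
    rewrite !mxE; apply: eq_bigr => k _; rewrite !mxE; congr (_ * _).
    by apply: eq_bigr => l _; rewrite !mxE.
  by rewrite /M mulmxBr mulmxBl !mxE.
apply: le_trans (normcB_le _ _) _.
apply: le_trans (lerD (normc_resolvent_form hH' q) (normc_resolvent_form hH q)) _.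
by rewrite q1 -mulrDl.
Qed.

End two_matrices.
End fixed_parameter.
End resolvent.

(** * Bounded differences on finite product spaces *)

Section product_weights.
Variables (K : comNzRingType) (J V : finType) (p : J -> V -> K).
Hypothesis p_sum1 : forall j, \sum_v p j v = 1.
Local Notation Om := {ffun J -> V}.

(** The values lie in a commutative ring so that one set of lemmas covers real expectations and,
    with coerced weights, complex ones. *)
Definition pweight (x : Om) : K := \prod_j p j (x j).

Definition pexp (f : Om -> K) : K := \sum_x pweight x * f x.

Definition mix (B : {set J}) (y x : Om) : Om :=
  [ffun j => if j \in B then y j else x j].

(** Conditional expectation given the coordinates outside [B]: a whole fresh point is drawn and only
    its block [B] is used, which avoids splitting the product space. *)
Definition pavg (B : {set J}) (f : Om -> K) (x : Om) : K :=
  pexp (fun y => f (mix B y x)).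

Lemma pweight_sum1 : \sum_x pweight x = 1.
Proof. by rewrite -(bigA_distr_bigA p) big1. Qed.

Lemma eq_pexp f g : f =1 g -> pexp f = pexp g.
Proof. by move=> fg; apply: eq_bigr => x _; rewrite fg. Qed.

Lemma pexpD f g : pexp (fun x => f x + g x) = pexp f + pexp g.
Proof. by rewrite -big_split; apply: eq_bigr => x _; rewrite mulrDr. Qed.

Lemma pexpZ c f : pexp (fun x => c * f x) = c * pexp f.
Proof. by rewrite mulr_sumr; apply: eq_bigr => x _; rewrite mulrCA. Qed.

Lemma pexpB f g : pexp (fun x => f x - g x) = pexp f - pexp g.
Proof.
by rewrite -sumrB; apply: eq_bigr => x _; rewrite mulrBr.
Qed.

Lemma pexp_cst c : pexp (fun=> c) = c.
Proof. by rewrite /pexp -mulr_suml pweight_sum1 mul1r. Qed.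

Lemma pexp_sum (I : Type) (r : seq I) (Q : pred I) (F : I -> Om -> K) :
  pexp (fun x => \sum_(i <- r | Q i) F i x) = \sum_(i <- r | Q i) pexp (F i).
Proof.
rewrite /pexp exchange_big /=.
by apply: eq_bigr => x _; rewrite mulr_sumr.
Qed.

Lemma mix_mix B y z x : mix B z (mix B y x) = mix B z x.
Proof. by apply/ffunP => j; rewrite !ffunE; case: ifP => // ->. Qed.

Lemma mixC B B' y z x :
  mix B z (mix B' y x) = mix B' (mix B z y) (mix B z x).
Proof. by apply/ffunP => j; rewrite !ffunE; do 2 case: ifP => //. Qed.

(** Exchanging the block [B] between two independent copies is an involution that preserves the
    product of their weights. Applied to an [F] that ignores its second argument, it gives the tower
    property [pexp_avg]. *)
Lemma pexp_swap B (F : Om -> Om -> K) :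
  pexp (fun x => pexp (fun y => F (mix B y x) (mix B x y))) =
  pexp (fun x => pexp (F x)).
Proof.
rewrite /pexp; under eq_bigr do rewrite mulr_sumr.
under [RHS]eq_bigr do rewrite mulr_sumr.
rewrite [LHS]pair_bigA [RHS]pair_bigA /=.
pose h (u : Om * Om) := (mix B u.2 u.1, mix B u.1 u.2).
have hK : involutive h.
  by case=> x y; congr pair; apply/ffunP => j /=; rewrite !ffunE; case: (j \in B).
rewrite [RHS](reindex_inj (inv_inj hK)) /=.
apply: eq_bigr => -[x y] _ /=; rewrite !mulrA; congr (_ * _).
rewrite /pweight -!big_split /=; apply: eq_bigr => j _; rewrite !ffunE.
by case: ifP => // _; rewrite mulrC.
Qed.

Lemma pexp_avg B f : pexp (pavg B f) = pexp f.
Proof.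
rewrite (pexp_swap B (fun x _ => f x)).
by apply: eq_pexp => x; rewrite pexp_cst.
Qed.

Lemma pexp_indep B (f h : Om -> K) : (forall x y, h (mix B y x) = h x) ->
  pexp (fun x => h x * f x) = pexp (fun x => h x * pavg B f x).
Proof.
move=> hB; rewrite -[LHS](pexp_avg B); apply: eq_pexp => x.
by rewrite /pavg -pexpZ; apply: eq_pexp => y; rewrite hB.
Qed.

Lemma pexp_coord j (u : V -> K) : pexp (fun x => u (x j)) = \sum_v p j v * u v.
Proof.
pose F i v := p i v * (if i == j then u v else 1).
transitivity (\sum_(x : Om) \prod_i F i (x i)).
  apply: eq_bigr => x _; rewrite /F big_split /=; congr (_ * _).
  by rewrite -big_mkcond big_pred1_eq.
rewrite -(bigA_distr_bigA F) (bigD1 j) //= [X in _ * X]big1 ?mulr1.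
  by rewrite /F eqxx.
move=> i /negbTE ij; rewrite /F ij -[RHS](p_sum1 i).
by apply: eq_bigr => v _; rewrite mulr1.
Qed.

Lemma pexp_coord_indep j (u : V -> K) (h : Om -> K) :
  (forall x y, h (mix [set j]%SET y x) = h x) ->
  pexp (fun x => u (x j) * h x) = (\sum_v p j v * u v) * pexp h.
Proof.
move=> hj; rewrite -pexp_coord -pexpZ.
under eq_pexp do rewrite mulrC.
rewrite (pexp_indep _ hj); apply: eq_pexp => x; rewrite mulrC.
congr (_ * _); apply: eq_pexp => y.
by rewrite ffunE finset.in_set1 eqxx.
Qed.

End product_weights.

Section concentration.
Variables (K : realFieldType) (J V : finType) (p : J -> V -> K).
Hypothesis p_ge0 : forall j v, 0 <= p j v.
Hypothesis p_sum1 : forall j, \sum_v p j v = 1.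
Local Notation Om := {ffun J -> V}.
Local Notation E := (pexp p).
Local Notation avg := (pavg p).

Lemma pweight_ge0 (x : Om) : 0 <= pweight p x.
Proof. exact: prodr_ge0. Qed.

Lemma le_pexp (f g : Om -> K) : (forall x, f x <= g x) -> E f <= E g.
Proof. by move=> fg; apply: ler_sum => x _; rewrite ler_wpM2l ?pweight_ge0. Qed.

Lemma pexp_ge0 (f : Om -> K) : (forall x, 0 <= f x) -> 0 <= E f.
Proof. by move=> f0; apply: sumr_ge0 => x _; rewrite mulr_ge0 ?pweight_ge0. Qed.

Lemma normr_pexp (f : Om -> K) : `|E f| <= E (fun x => `|f x|).
Proof.
apply: le_trans (ler_norm_sum _ _ _) _; apply: ler_sum => x _.
by rewrite normrM ger0_norm ?pweight_ge0.
Qed.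

Lemma pexp_sqr (f : Om -> K) : E f ^+ 2 <= E (fun x => f x ^+ 2).
Proof.
rewrite -subr_ge0.
have -> : E (fun x => f x ^+ 2) - E f ^+ 2 = E (fun x => (f x - E f) ^+ 2).
  transitivity (E (fun x => f x ^+ 2 - 2 * E f * f x + E f ^+ 2)).
    by rewrite pexpD // pexpB // pexpZ pexp_cst //; ring.
  by apply: eq_pexp => x; ring.
by apply: pexp_ge0 => x; exact: sqr_ge0.
Qed.

Definition bounded_diff (B : {set J}) (c : K) (f : Om -> K) :=
  forall x y, `|f (mix B y x) - f x| <= c.

Lemma bounded_diff_avg B B' c f :
  bounded_diff B' c f -> bounded_diff B' c (avg B f).
Proof.
move=> fc x y; rewrite /pavg -pexpB.
apply: le_trans (normr_pexp _) _; rewrite -[leRHS](pexp_cst p_sum1).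
by apply: le_pexp => z; rewrite mixC; exact: fc.
Qed.

Lemma bounded_diff_avg0 B f : bounded_diff B 0 (avg B f).
Proof.
move=> x y; rewrite (_ : avg B f (mix B y x) = avg B f x) ?subrr ?normr0 //.
by apply: eq_pexp => z; rewrite mix_mix.
Qed.

Definition pavgs (Bs : seq {set J}) (f : Om -> K) : Om -> K :=
  foldl (fun g B => avg B g) f Bs.

Lemma bounded_diff_avgs Bs B f :
  bounded_diff B 0 f \/ B \in Bs -> bounded_diff B 0 (pavgs Bs f).
Proof.
elim: Bs f => [|B' Bs IH] f /=; first by case.
case=> [fB|]; first by apply: IH; left; exact: bounded_diff_avg.
rewrite inE => /orP[/eqP BB'|BBs]; apply: IH; [left; rewrite BB'|by right].
exact: bounded_diff_avg0.
Qed.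

Lemma pexp_avgs Bs f : E (pavgs Bs f) = E f.
Proof. by elim: Bs f => //= B Bs IH f; rewrite IH pexp_avg. Qed.

(** The iterated average is insensitive to each block of [Bs]. Since the blocks cover [J],
    resampling them one after the other leads from any point to any other, so the function is
    constant, hence equal to its mean. *)
Lemma pavgs_cst Bs f : (forall j, has (fun B : {set J} => j \in B) Bs) ->
  forall x, pavgs Bs f x = E f.
Proof.
move=> cov; set g := pavgs Bs f.
have gB B : B \in Bs -> forall x y, g (mix B y x) = g x.
  move=> BBs x y; apply/eqP; rewrite -subr_eq0 -normr_le0.
  by apply: bounded_diff_avgs; right.
have mixE Cs x y j : foldl (fun x B => mix B y x) x Cs j =
    if has (fun B : {set J} => j \in B) Cs then y j else x j.
  elim: Cs x => //= C Cs IH x; rewrite IH ffunE.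
  by case: (j \in C) => //=; case: ifP.
have gE x y : g x = g y.
  have <- : foldl (fun x B => mix B y x) x Bs = y.
    by apply/ffunP => j; rewrite mixE cov.
  have : {subset Bs <= Bs} by [].
  elim: {1 3}Bs x => //= B Cs IH x BCs.
  rewrite -(gB B _ x y) ?BCs ?mem_head //; apply: IH => B' B'B.
  by apply: BCs; rewrite inE B'B orbT.
move=> x; rewrite -(pexp_avgs Bs f) -/g -[LHS](pexp_cst p_sum1).
exact: eq_pexp.
Qed.

Lemma normr_sub_pavg B c f x : bounded_diff B c f -> `|f x - avg B f x| <= c.
Proof.
move=> fc; rewrite distrC -[X in _ - X](pexp_cst p_sum1) -pexpB.
apply: le_trans (normr_pexp _) _; rewrite -[leRHS](pexp_cst p_sum1).
by apply: le_pexp => y; exact: fc.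
Qed.

(** Orthogonality of martingale differences: the power does not see the block, and [f - avg B f] has
    conditional mean 0. It removes the term linear in the increment from both moment expansions
    below. *)
Lemma pexp_mul_sub_pavg B f c0 k :
  E (fun x => (avg B f x - c0) ^+ k * (f x - avg B f x)) = 0.
Proof.
have avgB x y : avg B f (mix B y x) = avg B f x.
  by apply/eqP; rewrite -subr_eq0 -normr_le0; exact: bounded_diff_avg0.
rewrite (pexp_indep p_sum1 (B := B)); last by move=> x y; rewrite avgB.
rewrite -[RHS](pexp_cst p_sum1 0); apply: eq_pexp => x.
have -> : avg B (fun x => f x - avg B f x) x =
  avg B f x - E (fun y => avg B f (mix B y x)) by exact: pexpB.
by rewrite (eq_pexp p (fun y => avgB x y)) (pexp_cst p_sum1) subrr mulr0.
Qed.

Lemma pexp_sqr_step B c f c0 : bounded_diff B c f ->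
  E (fun x => (f x - c0) ^+ 2) <= E (fun x => (avg B f x - c0) ^+ 2) + c ^+ 2.
Proof.
move=> fc; have D0 := pexp_mul_sub_pavg B f c0 1.
have D0' : E (fun x => 2 * ((avg B f x - c0) ^+ 1 * (f x - avg B f x))) = 0.
  by rewrite pexpZ D0 mulr0.
rewrite -[X in _ + X](pexp_cst p_sum1) -[leRHS]addr0 -D0' -!pexpD.
apply: le_pexp => x.
have : (f x - avg B f x) ^+ 2 <= c ^+ 2.
  by rewrite -[leLHS]real_normK ?num_real // lerXn2r ?nnegrE ?normr_sub_pavg //
    (le_trans _ (normr_sub_pavg x fc)).
set h := avg B f x - c0; set D := f x - avg B f x => Dc.
have -> : f x - c0 = h + D by rewrite /h /D; ring.
rewrite expr1; have -> : (h + D) ^+ 2 = h ^+ 2 + D ^+ 2 + 2 * (h * D) by ring.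
by rewrite lerD2r lerD2l.
Qed.

(** Expand [(h + D)^4] with [|D| <= c]. The term [4 h^3 D] has mean 0 and
    [4 h D^3 <= 2 h^2 D^2 + 2 D^4], whence [8 = 6 + 2] and [3 = 1 + 2]. *)
Lemma pexp_pow4_step B c f c0 : bounded_diff B c f ->
  E (fun x => (f x - c0) ^+ 4) <= E (fun x => (avg B f x - c0) ^+ 4) +
    8 * c ^+ 2 * E (fun x => (avg B f x - c0) ^+ 2) + 3 * c ^+ 4.
Proof.
move=> fc; have D0 := pexp_mul_sub_pavg B f c0 3.
have D0' : E (fun x => 4 * ((avg B f x - c0) ^+ 3 * (f x - avg B f x))) = 0.
  by rewrite pexpZ D0 mulr0.
rewrite -[X in _ + X](pexp_cst p_sum1) -[leRHS]addr0 -D0' -pexpZ -!pexpD.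
apply: le_pexp => x.
have : (f x - avg B f x) ^+ 2 <= c ^+ 2.
  by rewrite -[leLHS]real_normK ?num_real // lerXn2r ?nnegrE ?normr_sub_pavg //
    (le_trans _ (normr_sub_pavg x fc)).
set h := avg B f x - c0; set D := f x - avg B f x => Dc.
have -> : f x - c0 = h + D by rewrite /h /D; ring.
have -> : (h + D) ^+ 4 = h ^+ 4 + 6 * (h ^+ 2 * D ^+ 2) + 4 * (h * D ^+ 3) +
  D ^+ 4 + 4 * (h ^+ 3 * D) by ring.
rewrite lerD2r.
have D4 : D ^+ 4 <= c ^+ 4.
  by rewrite -[4%N]/(2 * 2)%N !exprM lerXn2r ?nnegrE ?sqr_ge0.
have hD : h ^+ 2 * D ^+ 2 <= h ^+ 2 * c ^+ 2 by rewrite ler_wpM2l ?sqr_ge0.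
have hD3 : 4 * (h * D ^+ 3) <= 2 * (h ^+ 2 * D ^+ 2) + 2 * D ^+ 4.
  rewrite -subr_ge0.
  have -> : 2 * (h ^+ 2 * D ^+ 2) + 2 * D ^+ 4 - 4 * (h * D ^+ 3) =
    2 * (h * D - D ^+ 2) ^+ 2 by ring.
  by rewrite mulr_ge0 ?sqr_ge0.
have -> : 8 * c ^+ 2 * h ^+ 2 = 8 * (h ^+ 2 * c ^+ 2) by ring.
lra.
Qed.

(* The blocks are averaged out one at a time; [bounded_diff] survives the
   averaging, and each step costs at most [c ^+ 2] in the second moment. *)
Lemma bounded_diff_moments Bs c f :
  (forall B, B \in Bs -> bounded_diff B c f) ->
  (forall j, has (fun B : {set J} => j \in B) Bs) ->
  E (fun x => (f x - E f) ^+ 2) <= (size Bs)%:R * c ^+ 2 /\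
  E (fun x => (f x - E f) ^+ 4) <= 8 * (size Bs)%:R ^+ 2 * c ^+ 4.
Proof.
(* The mean becomes a constant [c0], known only as the value of the final average, so that the
   centre stays put when the induction replaces [f] by [avg B f]. *)
move=> fBs cov; have := pavgs_cst f cov; move: (E f) => c0 {cov}.
elim: Bs f fBs => [|B Bs IH] f fBs /= gc.
  have f0 k : E (fun x => (f x - c0) ^+ k.+1) = 0.
    rewrite -[RHS](pexp_cst p_sum1); apply: eq_pexp => x.
    by rewrite [f x]gc subrr expr0n.
  by rewrite !f0 expr0n /= mulr0 !mul0r.
have fB : bounded_diff B c f by apply: fBs; rewrite mem_head.
have [|h2 h4] := IH (avg B f) _ gc.
  by move=> B' B'B; apply: bounded_diff_avg; apply: fBs; rewrite inE B'B orbT.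
split; first by apply: le_trans (pexp_sqr_step c0 fB) _; rewrite -natr1; lra.
apply: le_trans (pexp_pow4_step c0 fB) _.
(* The second-moment bound feeds the fourth: with [k] blocks left, the increment [(8 k + 3) c^4] is
   at most [8 ((k + 1)^2 - k^2) c^4]. *)
have h24 : 8 * c ^+ 2 * E (fun x => (avg B f x - c0) ^+ 2) <=
    8 * c ^+ 2 * ((size Bs)%:R * c ^+ 2).
  by rewrite ler_wpM2l // mulr_ge0 ?sqr_ge0.
rewrite -[(size Bs).+1%:R]natr1.
have -> : 8 * ((size Bs)%:R + 1) ^+ 2 * c ^+ 4 = 8 * (size Bs)%:R ^+ 2 * c ^+ 4
  + 8 * c ^+ 2 * ((size Bs)%:R * c ^+ 2) + 8 * ((size Bs)%:R * c ^+ 4)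
  + 8 * c ^+ 4 by ring.
have c4 : 0 <= c ^+ 4 by rewrite -[4%N]/(2 * 2)%N exprM sqr_ge0.
have := mulr_ge0 (ler0n K (size Bs)) c4; lra.
Qed.

Lemma pexp_markov (Q : pred Om) (f : Om -> K) (e : K) :
  (forall x, 0 <= f x) -> (forall x, Q x -> e <= f x) ->
  e * (\sum_(x | Q x) pweight p x) <= E f.
Proof.
move=> f0 Qf; rewrite /pexp mulr_sumr [leRHS](bigID Q) /= -[leLHS]addr0 lerD //.
  by apply: ler_sum => x Qx; rewrite mulrC ler_wpM2l ?pweight_ge0 // Qf.
by apply: sumr_ge0 => x _; rewrite mulr_ge0 ?pweight_ge0.
Qed.

End concentration.

(** * The self-consistent equation in mean and in probability *)

Lemma conj_real_complex (R : rcfType) (x : R) : Num.conj (x%:C%C : R[i]) = x%:C%C.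
Proof. exact: conjc_real. Qed.

Lemma natr_invC (R : rcfType) (k : nat) : k%:R^-1 = (k%:R^-1)%:C%C :> R[i].
Proof. by rewrite fmorphV /= rmorph_nat. Qed.

Lemma normc_natV (R : rcfType) (k : nat) : normc (k%:R^-1 : R[i]) = k%:R^-1.
Proof. by rewrite natr_invC normc_real ger0_norm ?invr_ge0 ?ler0n. Qed.

Lemma mulmx_delta_sym (K : comNzRingType) n (A B : 'M[K]_n) u w i j a b :
  (A *m - (u *: delta_mx i j + w *: delta_mx j i) *m B) a b =
  - (u * A a i * B j b) - w * A a j * B i b.
Proof.
have dE k l : (A *m delta_mx k l *m B) a b = A a k * B l b.
  by rewrite -(mul_delta_mx (0 : 'I_1)) mulmxA -colE -mulmxA -rowE mxE big_ord1 !mxE.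
rewrite mulmxN mulmxDr -!scalemxAr mulNmx mulmxDl -!scalemxAl opprD.
rewrite [LHS]mxE; congr (_ + _); rewrite [LHS]mxE; congr (- _).
  by rewrite mxE dE mulrA.
by rewrite mxE dE mulrA.
Qed.

(* The hypothesis is the expansion of the resolvent entry [g] around its value
   [g0] once the matrix entries [u] and [u'] are set to 0. Both sides are grouped
   so that every term but the remainder has [u] independent of its cofactor. *)
Lemma off_diagonal_split (K : comNzRingType) (u u' g g0 gii g0ii gjj g0jj N : K) :
  g = g0 - u * g0 * g - u' * g0jj * gii ->
  u * g + N * (gii * gjj) =
  u * g0 - u ^+ 2 * g0 ^+ 2 - (u * u' - N) * (g0jj * g0ii) +
  (N * (gii * gjj - g0ii * g0jj) - u ^+ 2 * g0 * (g - g0) -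
   u * u' * g0jj * (gii - g0ii)).
Proof.
move=> e; apply/eqP; rewrite -subr_eq0; apply/eqP.
have {}e : g - (g0 - u * g0 * g - u' * g0jj * gii) = 0 by rewrite -e subrr.
rewrite -[RHS](mulr0 u) -e; ring.
Qed.

(** Here [k] bounds the resolvent entries, [t] is the modulus of the matrix entry and [2 k^2 d]
    bounds the effect of zeroing it. With [d = min(1, t)], the terms in [t^2 d] are those of the
    Lindeberg condition. *)
Lemma off_diagonal_remainder (R : rcfType) (u u' g g0 gii g0ii gjj g0jj N : R[i])
    (k d N' t : R) :
  0 <= k -> 0 <= d -> normc u = t -> normc u' = t -> normc N = N' ->
  normc g0 <= k -> normc g0jj <= k -> normc gii <= k ->
  normc (g - g0) <= 2 * k ^+ 2 * d -> normc (gii - g0ii) <= 2 * k ^+ 2 * d ->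
  normc (gjj - g0jj) <= 2 * k ^+ 2 * d ->
  normc (N * (gii * gjj - g0ii * g0jj) - u ^+ 2 * g0 * (g - g0) -
   u * u' * g0jj * (gii - g0ii)) <= 4 * k ^+ 3 * (t ^+ 2 * d) + N' * (4 * k ^+ 3 * d).
Proof.
move=> k0 d0 ut u't NN h1 h2 h3 h4 h5 h6.
have t0 : 0 <= t by rewrite -ut normc_ge0.
have N0 : 0 <= N' by rewrite -NN normc_ge0.
have b1 : normc (N * (gii * gjj - g0ii * g0jj)) <= N' * (4 * k ^+ 3 * d).
  rewrite normcM NN ler_wpM2l //.
  have -> : gii * gjj - g0ii * g0jj = gii * (gjj - g0jj) + g0jj * (gii - g0ii) by ring.
  apply: le_trans (le_normcD _ _) _; rewrite !normcM.
  have -> : 4 * k ^+ 3 * d = k * (2 * k ^+ 2 * d) + k * (2 * k ^+ 2 * d) by ring.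
  by rewrite lerD // ler_pM ?normc_ge0.
have b2 : normc (u ^+ 2 * g0 * (g - g0)) <= 2 * k ^+ 3 * (t ^+ 2 * d).
  rewrite normcM (normcM _ g0) normcX ut.
  have -> : 2 * k ^+ 3 * (t ^+ 2 * d) = t ^+ 2 * k * (2 * k ^+ 2 * d) by ring.
  by rewrite ler_pM ?mulr_ge0 ?normc_ge0 // ?sqr_ge0 // ler_wpM2l ?sqr_ge0.
have b3 : normc (u * u' * g0jj * (gii - g0ii)) <= 2 * k ^+ 3 * (t ^+ 2 * d).
  rewrite !normcM ut u't.
  have -> : 2 * k ^+ 3 * (t ^+ 2 * d) = t * t * k * (2 * k ^+ 2 * d) by ring.
  by rewrite ler_pM ?mulr_ge0 ?normc_ge0 // ?sqr_ge0 // ler_wpM2l ?mulr_ge0.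
apply: le_trans (normcB_le _ _) _; apply: le_trans (lerD (normcB_le _ _) b3) _.
apply: le_trans (lerD (lerD b1 b2) (lexx _)) _.
have -> : 4 * k ^+ 3 * (t ^+ 2 * d) =
  2 * k ^+ 3 * (t ^+ 2 * d) + 2 * k ^+ 3 * (t ^+ 2 * d) by ring.
lra.
Qed.

Lemma sum_affine_diag (K : comNzRingType) n (b k d : K) (Y : 'I_n -> 'I_n -> K) :
  \sum_i \sum_j (b + k * Y i j + (if i == j then d else 0)) =
  n%:R ^+ 2 * b + k * (\sum_i \sum_j Y i j) + n%:R * d.
Proof.
transitivity (\sum_(i < n) (n%:R * b + k * (\sum_j Y i j) + d)).
  apply: eq_bigr => i _; rewrite !big_split /= sumr_const card_ord.
  rewrite -[b *+ n]mulr_natl mulr_sumr -big_mkcond /=; congr (_ + _).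
  by rewrite (big_pred1 i) // => j; rewrite eq_sym.
rewrite !big_split /= !sumr_const !card_ord -mulr_sumr.
by rewrite -[d *+ n]mulr_natl -[_ *+ n in LHS]mulr_natl mulrA -expr2.
Qed.

Section complex_expectation.
Variables (R : rcfType) (J V : finType) (p : J -> V -> R).
Hypothesis p_ge0 : forall j v, 0 <= p j v.
Local Notation Om := {ffun J -> V}.

Definition cexp (f : Om -> R[i]) : R[i] := pexp (fun j v => (p j v)%:C%C) f.

Lemma cweightE (x : Om) : pweight (fun j v => (p j v)%:C%C) x = (pweight p x)%:C%C.
Proof. by rewrite /pweight rmorph_prod. Qed.

Lemma Re_cexp f : complex.Re (cexp f) = pexp p (fun x => complex.Re (f x)).
Proof.
rewrite /cexp /pexp Re_sum; apply: eq_bigr => x _; rewrite cweightE.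
by case: (f x) => a b /=; rewrite mul0r subr0.
Qed.

Lemma Im_cexp f : complex.Im (cexp f) = pexp p (fun x => complex.Im (f x)).
Proof.
rewrite /cexp /pexp Im_sum; apply: eq_bigr => x _; rewrite cweightE.
by case: (f x) => a b /=; rewrite mul0r addr0.
Qed.

Lemma normc_cexp f : normc (cexp f) <= pexp p (fun x => normc (f x)).
Proof.
apply: le_trans (normc_sum _ _ _) _; apply: ler_sum => x _.
by rewrite normcM cweightE normc_real ger0_norm ?pweight_ge0.
Qed.

End complex_expectation.

Section half_symmetric.
Variables (n : nat) (S : {set 'I_n * 'I_n}).
Hypothesis S_diag : forall i, (i, i) \in S.
Hypothesis S_off : forall i j, i != j -> ((i, j) \in S) != ((j, i) \in S).

(** Mirror entries read the same coordinate, so Hermitian symmetry is compatible with a plain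
    product of independent coordinates. *)
Definition pos (i j : 'I_n) := if (i, j) \in S then (i, j) else (j, i).

Lemma posC i j : pos i j = pos j i.
Proof.
rewrite /pos; have [->//|/S_off] := eqVneq i j.
by do 2 case: ifP.
Qed.

Lemma pos_in i j : pos i j \in S.
Proof.
rewrite /pos; have [->|/S_off] := eqVneq i j; first by rewrite !S_diag.
by case ij: ((i, j) \in S) => //=; case: ((j, i) \in S).
Qed.

Lemma pos_eq i j k l : pos i j = pos k l -> (i = k /\ j = l) \/ (i = l /\ j = k).
Proof. by rewrite /pos; do 2 case: ifP => _; case=> -> ->; auto. Qed.

Lemma pos_off i j : i != j -> (pos i j).1 != (pos i j).2.
Proof. by rewrite /pos; case: ifP => //= _; rewrite eq_sym. Qed.

End half_symmetric.

Section wigner.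
Variables (R : rcfType) (n : nat) (V : finType).
Local Notation C := R[i].
Local Notation J := ('I_n * 'I_n)%type.
Local Notation Om := {ffun J -> V}.
Variables (p : J -> V -> R) (val : V -> C) (v0 : V) (S : {set J}).
Hypothesis n_gt0 : (0 < n)%N.
Hypothesis p_ge0 : forall j v, 0 <= p j v.
Hypothesis p_sum1 : forall j, \sum_v p j v = 1.
Hypothesis val0 : val v0 = 0.
Hypothesis S_diag : forall i, (i, i) \in S.
Hypothesis S_off : forall i j, i != j -> ((i, j) \in S) != ((j, i) \in S).

Local Notation E := (pexp p).
Local Notation EC := (cexp p).
Local Notation q := (pos S).

Definition rn : R := (Num.sqrt n%:R)^-1.

Lemma rn_ge0 : 0 <= rn. Proof. by rewrite invr_ge0 sqrtr_ge0. Qed.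

Lemma rn2 : rn ^+ 2 = n%:R^-1.
Proof. by rewrite exprVn sqr_sqrtr. Qed.

Lemma invn_le_rn : n%:R^-1 <= rn.
Proof.
rewrite -rn2 expr2 ler_piMl ?rn_ge0 // invf_le1 ?sqrtr_gt0 ?ltr0n //.
by rewrite -[leLHS]sqrtr1 ler_wsqrtr // ler1n.
Qed.

(* The entry at [(i, j)] of a Hermitian matrix, given the value [w] at the one of
   [(i, j)] and [(j, i)] which lies in [S]. Taking the real part on the diagonal
   makes [hmat] Hermitian on the whole product space. *)
Definition cnv (i j : 'I_n) (w : C) : C :=
  if i == j then (complex.Re w)%:C%C
  else if (i, j) \in S then w else Num.conj w.

Lemma cnvJ i j w : cnv j i w = Num.conj (cnv i j w).
Proof.
rewrite /cnv [j == i]eq_sym; have [_|/S_off] := eqVneq i j.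
  by rewrite conj_real_complex.
by case: ((i, j) \in S); case: ((j, i) \in S) => //= _; rewrite conjCK.
Qed.

Lemma normc_cnv_le i j w : normc (cnv i j w) <= normc w.
Proof.
rewrite /cnv; case: eqP => _; first by rewrite normc_real normr_Re_le.
by case: ifP => //; rewrite normc_conj.
Qed.

Lemma normc_cnv i j w : i != j -> normc (cnv i j w) = normc w.
Proof. by rewrite /cnv => /negbTE ->; case: ifP => //; rewrite normc_conj. Qed.

Lemma cnv0 i j : cnv i j 0 = 0.
Proof. by rewrite /cnv; case: ifP => // _; case: ifP => // _; rewrite rmorph0. Qed.

Lemma cnvB i j a b : cnv i j (a - b) = cnv i j a - cnv i j b.
Proof.
rewrite /cnv; case: ifP => _; first by rewrite -rmorphB; case: a b => [? ?] [? ?].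
by case: ifP => _ //; rewrite rmorphB.
Qed.

Definition uval i j (v : V) : C := rn%:C%C * cnv i j (val v).

Definition hmat (x : Om) : 'M[C]_n := \matrix_(i, j) uval i j (x (q i j)).

Lemma normc_uval i j v : i != j -> normc (uval i j v) = rn * normc (val v).
Proof.
by move=> ij; rewrite normcM normc_cnv // normc_real ger0_norm ?rn_ge0.
Qed.

Lemma normc_uval_le i j v : normc (uval i j v) <= rn * normc (val v).
Proof.
rewrite normcM normc_real ger0_norm ?rn_ge0 //.
by rewrite ler_wpM2l ?rn_ge0 ?normc_cnv_le.
Qed.

Lemma uvalJ i j v : uval j i v = Num.conj (uval i j v).
Proof. by rewrite /uval cnvJ rmorphM /= conj_real_complex. Qed.

Lemma hmat_hermitian x : (hmat x)^t* = hmat x.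
Proof.
by apply/matrixP => i j; rewrite !mxE -uvalJ (posC S_off).
Qed.

Variables (z : C) (eta : R).
Hypotheses (eta_gt0 : 0 < eta) (Imz : complex.Im z = eta).

Definition G x := resolvent (hmat x) z.
Definition stj x : C := n%:R^-1 * \tr (G x).

(** Adding 1 to the natural bound [eta^-1] makes this constant at least 1, so its powers are ordered
    and all errors can be absorbed into the fourth power. *)
Local Notation kap := (1 + eta^-1).

Lemma normc_G x i j : normc (G x i j) <= kap.
Proof.
apply: le_trans (normc_resolvent eta_gt0 Imz (hmat_hermitian x) i j) _.
by rewrite lerDr.
Qed.

Lemma normc_stj x : normc (stj x) <= kap.
Proof.
rewrite normcM normc_natV mulrC ler_pdivrMr ?ltr0n //.
apply: le_trans (normc_sum _ _ _) _.
apply: (@le_trans _ _ (\sum_(i < n) kap)); first by apply: ler_sum => i _; exact: normc_G.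
by rewrite sumr_const card_ord mulr_natr.
Qed.

(** Rows rather than single coordinates: the moment bounds grow with the number of blocks, and
    resampling a whole row obeys the same rank bound 2 as resampling one off-diagonal pair. *)
Definition block (k : 'I_n) : {set J} := [set j | j.1 == k]%SET.

(* Resampling the block [k] only affects row and column [k] of [hmat], a
   perturbation of rank at most 2. *)
Lemma stj_bounded_diff k x y :
  normc (stj (mix (block k) y x) - stj x) <= 4 * kap / n%:R.
Proof.
rewrite /stj -mulrBr normcM normc_natV mulrC ler_wpM2r ?invr_ge0 ?ler0n //.
apply: le_trans (mxtrace_resolvent_rank eta_gt0 Imz (hmat_hermitian _)
  (hmat_hermitian _)) _.
set D := _ - _.
have DE i j : i != k -> j != k -> D i j = 0.
  move=> ik jk; rewrite !mxE ffunE inE (_ : (q i j).1 == k = false) ?subrr //.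
  by rewrite /pos; case: ifP => _ /=; [rewrite (negbTE ik)|rewrite (negbTE jk)].
(* [A] carries row [k] of [D], and [B] carries column [k] without the corner entry; each factors
   through dimension 1. *)
clearbody D; pose A := delta_mx k ord0 *m row k D : 'M[C]_n.
pose B := (\col_i (if i == k then 0 else D i k)) *m delta_mx (ord0 : 'I_1) k : 'M[C]_n.
have DAB : D = A + B.
  apply/matrixP => i j; rewrite !mxE !big_ord1 !mxE eqxx /= ?andbT.
  have [->|ik] := eqVneq i k; first by rewrite mul1r mul0r addr0.
  have [->|jk] := eqVneq j k; first by rewrite mul0r mulr1 add0r.
  by rewrite DE // mul0r mulr0 addr0.
have rD : (\rank D <= 2)%N.
  rewrite DAB; apply: leq_trans (mxrank_add _ _) _.
  by rewrite -[2%N]/(1 + 1)%N leq_add // mulmx_max_rank.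
rewrite -mulrA (_ : 4 = 2 * 2) // -?mulrA; last by ring.
rewrite ler_wpM2l // ler_pM ?ler0n ?invr_ge0 ?(ltW eta_gt0) //.
  by rewrite ler_nat.
by rewrite lerDr.
Qed.

Definition zero_at (i j : 'I_n) (x : Om) : Om :=
  mix [set q i j]%SET [ffun=> v0] x.

Local Notation G0 i j x := (G (zero_at i j x)).
Local Notation u i j x := (uval i j (x (q i j))).

Lemma zero_at_mix i j x y : zero_at i j (mix [set q i j]%SET y x) = zero_at i j x.
Proof. exact: mix_mix. Qed.

(** Resolvent identity against the matrix whose two mirror entries are zeroed. Its resolvent [G0]
    ignores the coordinate [pos S i j], hence is independent of [u]. Off the diagonal the two delta
    matrices are distinct. *)
Lemma resolvent_expansion i j x a b : i != j ->
  G x a b = G0 i j x a b - u i j x * G0 i j x a i * G x j b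
            - Num.conj (u i j x) * G0 i j x a j * G x i b.
Proof.
move=> ij; have := resolvent_identity eta_gt0 Imz (hmat_hermitian (zero_at i j x))
  (hmat_hermitian x).
have -> : hmat (zero_at i j x) - hmat x =
    - (u i j x *: delta_mx i j + Num.conj (u i j x) *: delta_mx j i).
  apply/matrixP => k l; rewrite !mxE !ffunE finset.in_set1.
  have [kl|kl] := eqVneq (q k l) (q i j).
    have uv0 : uval k l v0 = 0 by rewrite /uval val0 cnv0 mulr0.
    rewrite uv0 sub0r kl; congr (- _).
    have [[-> ->]|[-> ->]] := pos_eq kl.
      by rewrite !eqxx (negbTE ij) /= ?mulr1n ?mulr0n mulr1 mulr0 addr0.
    by rewrite uvalJ !eqxx [j == i]eq_sym (negbTE ij) /= ?mulr1n ?mulr0n mulr1 mulr0 add0r.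
  rewrite subrr; case: eqP => [ki|_]; case: eqP => [lj|_] /=.
  all: rewrite ?mulr0n ?mulr0 ?addr0 ?oppr0 //.
  - by rewrite ki lj eqxx in kl.
  - by case: eqP => [kj|_]; case: eqP => [li|_] /=; rewrite ?mulr0n ?mulr0 ?addr0 ?oppr0 //;
      rewrite kj li (posC S_off) eqxx in kl.
  - by case: eqP => [kj|_]; case: eqP => [li|_] /=; rewrite ?mulr0n ?mulr0 ?addr0 ?oppr0 //;
      rewrite kj li (posC S_off) eqxx in kl.
  - by case: eqP => [kj|_]; case: eqP => [li|_] /=; rewrite ?mulr0n ?mulr0 ?addr0 ?oppr0 //;
      rewrite kj li (posC S_off) eqxx in kl.
move/matrixP => /(_ a b).
rewrite mulmx_delta_sym -!/(G _) ![in X in X = _]mxE.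
by move=> /(canRL (subrK _)) ->; rewrite addrC addrA.
Qed.

Lemma kap_ge1 : 1 <= kap.
Proof. by rewrite lerDl invr_ge0 ltW. Qed.

Lemma normc_u i j x : i != j -> normc (u i j x) = rn * normc (val (x (q i j))).
Proof. exact: normc_uval. Qed.

(** The minimum combines the trivial bound [2 kap] with the one given by the expansion; truncation
    at 1 is what lets a Lindeberg condition replace a third moment. *)
Lemma resolvent_zero_at i j x a b : i != j ->
  normc (G x a b - G0 i j x a b) <=
  2 * kap ^+ 2 * Num.min 1 (rn * normc (val (x (q i j)))).
Proof.
move=> ij; have k1 := kap_ge1; have k0 : 0 <= kap by apply: le_trans k1.
have hG x' c d : normc (G x' c d) <= kap by exact: normc_G.
rewrite minEle; case: ifP => _.
  rewrite mulr1; apply: le_trans (normcB_le _ _) _.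
  apply: le_trans (lerD (hG _ _ _) (hG _ _ _)) _.
  have : kap <= kap ^+ 2 by rewrite expr2 ler_peMl.
  lra.
rewrite -(normc_u x ij); set t := normc (u i j x).
rewrite (resolvent_expansion x a b ij).
have -> : 2 * kap ^+ 2 * t = t * (kap * kap) + t * (kap * kap) by ring.
have subKD (a1 a2 a3 : C) : a1 - a2 - a3 - a1 = - (a2 + a3) by ring.
rewrite subKD normcN.
apply: le_trans (le_normcD _ _) _.
have bnd (a1 a2 a3 : C) : normc a1 = t -> normc a2 <= kap -> normc a3 <= kap ->
    normc (a1 * a2 * a3) <= t * (kap * kap).
  move=> <- h2 h3; rewrite !normcM -mulrA ler_wpM2l ?normc_ge0 //.
  by rewrite ler_pM ?normc_ge0.
by rewrite lerD // bnd // normc_conj.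
Qed.

Section moments.
Variables m dv L : R.
Hypotheses (m_ge0 : 0 <= m) (dv_ge0 : 0 <= dv) (L_ge0 : 0 <= L).
Hypothesis p_mean : forall j, j \in S -> j.1 != j.2 ->
  normc (\sum_v (p j v)%:C%C * val v) <= m.
Hypothesis p_var_le1 : forall j, j \in S -> \sum_v p j v * normc (val v) ^+ 2 <= 1.
Hypothesis p_var : forall j, j \in S -> j.1 != j.2 ->
  1 - dv <= \sum_v p j v * normc (val v) ^+ 2.
Hypothesis p_lind : forall j, j \in S -> j.1 != j.2 ->
  \sum_v p j v * (normc (val v) ^+ 2 * Num.min 1 (rn * normc (val v))) <= L.

(** [m], [dv] and [L] are the defects left by rounding in the mean, the variance and the Lindeberg
    condition. In [off_diagonal_split], [u], [u^2] and [|u|^2 - 1/n] are independent of their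
    cofactors. The mean of [u^2] is only known to be at most [1/n] in modulus, so [E|G_ji|^2] is
    kept: a sum of it over a row is bounded, which gains a factor [n] in the double sum. *)
Lemma expectation_off i j : i != j ->
  normc (EC (fun x => u i j x * G x j i + n%:R^-1 * (G x i i * G x j j))) <=
  m / n%:R + (m + n%:R^-1) * (2 * E (fun x => normc (G x j i) ^+ 2) + 8 * kap ^+ 4 / n%:R)
  + 4 * kap ^+ 3 * L / n%:R + dv * kap ^+ 2 / n%:R + 4 * kap ^+ 3 * rn / n%:R.
Proof.
move=> ij; have k1 := kap_ge1; have k0 : 0 <= kap by apply: le_trans k1.
have hG x c d : normc (G x c d) <= kap by exact: normc_G.
set qq := q i j; have qS : qq \in S by exact: pos_in.
have qoff : qq.1 != qq.2 by exact: pos_off.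
have pC1 j' : \sum_v (p j' v)%:C%C = 1 :> C by rewrite -rmorph_sum p_sum1.
have r0 := rn_ge0; have NV : 0 <= n%:R^-1 :> R by rewrite invr_ge0.
pose w v := normc (val v); pose t x := rn * w (x qq).
have t0 x : 0 <= t x by rewrite mulr_ge0 ?normc_ge0.
pose d x := Num.min 1 (t x).
have d0 x : 0 <= d x by rewrite le_min ler01 t0.
have dt x : d x <= t x by rewrite ge_min lexx orbT.
have ut x : normc (u i j x) = t x by exact: normc_u.
have Ew2 : E (fun x => w (x qq) ^+ 2) <= 1.
  by rewrite (pexp_coord p_sum1 qq (fun v => w v ^+ 2)); exact: p_var_le1.
have Et2 : E (fun x => t x ^+ 2) <= n%:R^-1.
  under eq_pexp do rewrite /t exprMn rn2.
  by rewrite pexpZ ler_piMr.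
have Et : E t <= rn.
  rewrite pexpZ ler_piMr // -(@ler_pXn2r _ 2) ?nnegrE ?expr1n //.
    exact: le_trans (pexp_sqr p_ge0 p_sum1 _) Ew2.
  by apply: pexp_ge0 => // x; exact: normc_ge0.
pose X := E (fun x => normc (G0 i j x j i) ^+ 2).
have X0 : 0 <= X by apply: pexp_ge0 => // x; exact: sqr_ge0.
(* Back from [G0] to [G]: [G0] changes with [(i, j)], so row sums can only be controlled for [G]. *)
have XE : X <= 2 * E (fun x => normc (G x j i) ^+ 2) + 8 * kap ^+ 4 / n%:R.
  apply: (@le_trans _ _ (E (fun x => 2 * normc (G x j i) ^+ 2 +
      8 * kap ^+ 4 * t x ^+ 2))); last first.
    rewrite pexpD !pexpZ lerD2l ler_wpM2l // mulr_ge0 //.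
    by rewrite exprn_ge0.
  apply: le_pexp => // x.
  have := resolvent_zero_at x j i ij; rewrite -/(w _) -/(t x) -/(d x).
  move: (G x j i) (G0 i j x j i) => g g0 gg0.
  have gg : normc g0 <= normc g + 2 * kap ^+ 2 * t x.
    have -> : g0 = g - (g - g0) by rewrite opprB addrC subrK.
    apply: le_trans (normcB_le _ _) _; rewrite lerD2l.
    apply: le_trans gg0 _; rewrite ler_wpM2l // mulr_ge0 ?exprn_ge0 //.
  apply: (@le_trans _ _ ((normc g + 2 * kap ^+ 2 * t x) ^+ 2)).
    by rewrite lerXn2r ?nnegrE ?normc_ge0 ?addr_ge0 ?mulr_ge0 ?exprn_ge0 ?normc_ge0.
  rewrite -subr_ge0.
  have -> : 2 * normc g ^+ 2 + 8 * kap ^+ 4 * t x ^+ 2 -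
    (normc g + 2 * kap ^+ 2 * t x) ^+ 2 = (normc g - 2 * kap ^+ 2 * t x) ^+ 2 by ring.
  exact: sqr_ge0.
pose rest x := (n%:R^-1 * (G x i i * G x j j - G0 i j x i i * G0 i j x j j)
  - u i j x ^+ 2 * G0 i j x j i * (G x j i - G0 i j x j i)
  - u i j x * Num.conj (u i j x) * G0 i j x j j * (G x i i - G0 i j x i i)).
have TE (x : Om) : u i j x * G x j i + n%:R^-1 * (G x i i * G x j j) =
   u i j x * G0 i j x j i - u i j x ^+ 2 * G0 i j x j i ^+ 2 -
   (u i j x * Num.conj (u i j x) - n%:R^-1) * (G0 i j x j j * G0 i j x i i) + rest x.
  by apply: off_diagonal_split; exact: resolvent_expansion.
have -> : EC (fun x => u i j x * G x j i + n%:R^-1 * (G x i i * G x j j)) =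
    EC (fun x => u i j x * G0 i j x j i) -
    EC (fun x => u i j x ^+ 2 * G0 i j x j i ^+ 2) -
    EC (fun x => (u i j x * Num.conj (u i j x) - n%:R^-1) *
      (G0 i j x j j * G0 i j x i i)) + EC rest.
  by rewrite /cexp (eq_pexp _ TE) pexpD; congr (_ + _); rewrite !pexpB.
have indep (f : V -> C) (h : Om -> C) : (forall x y, h (mix [set qq]%SET y x) = h x) ->
    normc (EC (fun x => f (x qq) * h x)) <=
    normc (\sum_v (p qq v)%:C%C * f v) * E (fun x => normc (h x)).
  move=> hh; rewrite /cexp (pexp_coord_indep pC1 _ hh) normcM.
  by rewrite ler_wpM2l ?normc_ge0 //; exact: normc_cexp.
have cnvm : normc (\sum_v (p qq v)%:C%C * uval i j v) <= rn * m.
  have -> : \sum_v (p qq v)%:C%C * uval i j v =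
    rn%:C%C * cnv i j (\sum_v (p qq v)%:C%C * val v).
    rewrite /uval /cnv (negbTE ij); case: ifP => _.
      by rewrite mulr_sumr; apply: eq_bigr => v _; rewrite mulrCA.
    rewrite rmorph_sum mulr_sumr; apply: eq_bigr => v _.
    by rewrite mulrCA rmorphM /= conj_real_complex.
  rewrite normcM normc_cnv // normc_real ger0_norm //.
  by rewrite ler_wpM2l // p_mean.
have m0 : 0 <= m by apply: le_trans (p_mean qS qoff); exact: normc_ge0.
(* Arithmetic-geometric mean and Jensen turn [rn * E|G0_ji|] into [1/n + E|G0_ji|^2], again for the
   sake of row sums. *)
have b1 : normc (EC (fun x => u i j x * G0 i j x j i)) <= m * (n%:R^-1 + X).
  apply: le_trans (indep (uval i j) (fun x => G0 i j x j i) _) _.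
    by move=> x y; rewrite zero_at_mix.
  set Y := E _; have Y0 : 0 <= Y by apply: pexp_ge0 => // x; exact: normc_ge0.
  apply: (@le_trans _ _ (rn * m * Y)); first by rewrite ler_wpM2r.
  rewrite mulrAC mulrC ler_wpM2l // -rn2.
  apply: (@le_trans _ _ (rn ^+ 2 + Y ^+ 2)).
    have := sqr_ge0 (rn - Y); rewrite sqrrB => h.
    have := sqr_ge0 (rn); have := sqr_ge0 Y; lra.
  by rewrite lerD2l; exact: pexp_sqr.
have b2 : normc (EC (fun x => u i j x ^+ 2 * G0 i j x j i ^+ 2)) <= n%:R^-1 * X.
  apply: le_trans (indep (fun v => uval i j v ^+ 2) (fun x => G0 i j x j i ^+ 2) _) _.
    by move=> x y; rewrite zero_at_mix.
  rewrite (eq_pexp p (fun x => normcX (G0 i j x j i) 2)) ler_wpM2r //.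
  apply: le_trans (normc_sum _ _ _) _.
  apply: (@le_trans _ _ (n%:R^-1 * \sum_v p qq v * w v ^+ 2)).
    rewrite mulr_sumr; apply: ler_sum => v _.
    rewrite normcM normc_real ger0_norm // normcX normc_uval // exprMn rn2.
    by rewrite mulrCA.
  by rewrite ler_piMr // p_var_le1.
have b4 : normc (EC (fun x => (u i j x * Num.conj (u i j x) - n%:R^-1) *
    (G0 i j x j j * G0 i j x i i))) <= dv * kap ^+ 2 / n%:R.
  apply: le_trans (indep (fun v => uval i j v * Num.conj (uval i j v) - n%:R^-1)
    (fun x => G0 i j x j j * G0 i j x i i) _) _.
    by move=> x y; rewrite zero_at_mix.
  rewrite mulrAC; apply: ler_pM; rewrite ?normc_ge0 ?pexp_ge0 //.
  - by move=> x; exact: normc_ge0.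
  - have -> : \sum_v (p qq v)%:C%C * (uval i j v * Num.conj (uval i j v) - n%:R^-1) =
      (n%:R^-1 * (\sum_v p qq v * w v ^+ 2 - 1))%:C%C.
      have -> : \sum_v p qq v * w v ^+ 2 - 1 = \sum_v p qq v * (w v ^+ 2 - 1).
        rewrite -[X in _ - X](p_sum1 qq) -sumrB; apply: eq_bigr => v _.
        by rewrite mulrBr mulr1.
      rewrite mulr_sumr rmorph_sum; apply: eq_bigr => v _.
      rewrite mulcJE natr_invC -rmorphB -rmorphM normc_uval // exprMn rn2 -/(w v).
      by congr (_%:C%C); ring.
    rewrite normc_real normrM ger0_norm // mulrC ler_wpM2r //.
    have := p_var_le1 qS; have := p_var qS qoff; rewrite -/w => h1 h2.
    by rewrite ler0_norm ?subr_le0 // opprB lerBlDr -lerBlDl.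
  - rewrite -[leRHS](pexp_cst p_sum1); apply: le_pexp => // x.
    by rewrite normcM expr2 ler_pM ?normc_ge0.
have EL : E (fun x => w (x qq) ^+ 2 * Num.min 1 (rn * w (x qq))) <= L.
  rewrite (pexp_coord p_sum1 qq (fun v => w v ^+ 2 * Num.min 1 (rn * w v))).
  exact: p_lind.
have b5 : normc (EC rest) <= 4 * kap ^+ 3 * L / n%:R + 4 * kap ^+ 3 * rn / n%:R.
  apply: le_trans (normc_cexp p_ge0 _) _.
  apply: (@le_trans _ _ (E (fun x => 4 * kap ^+ 3 / n%:R *
      (w (x qq) ^+ 2 * Num.min 1 (rn * w (x qq))) + 4 * kap ^+ 3 / n%:R * t x))).
    apply: le_pexp => // x.
    apply: le_trans (off_diagonal_remainder (k := kap) (d := d x) (t := t x) (N' := n%:R^-1)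
      k0 (d0 x) (ut x) _ (normc_natV _ _) (hG _ _ _) (hG _ _ _) (hG _ _ _) _ _ _) _.
    - by rewrite normc_conj.
    - exact: resolvent_zero_at.
    - exact: resolvent_zero_at.
    - exact: resolvent_zero_at.
    apply: lerD; first by rewrite {1}/t exprMn rn2 -!mulrA.
    rewrite mulrA [n%:R^-1 * _]mulrC ler_wpM2l // divr_ge0 // mulr_ge0 //.
    exact: exprn_ge0.
  pose K := 4 * kap ^+ 3 / n%:R; rewrite -/K.
  have K0 : 0 <= K by rewrite divr_ge0 // mulr_ge0 // exprn_ge0.
  rewrite pexpD pexpZ (pexpZ p K t).
  have -> : 4 * kap ^+ 3 * L / n%:R = K * L by rewrite /K mulrAC.
  have -> : 4 * kap ^+ 3 * rn / n%:R = K * rn by rewrite /K mulrAC.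
  by rewrite lerD // ler_wpM2l.
have tri (a1 a2 a3 a4 : C) c1 c2 c3 c4 : normc a1 <= c1 -> normc a2 <= c2 ->
    normc a3 <= c3 -> normc a4 <= c4 ->
    normc (a1 - a2 - a3 + a4) <= c1 + c2 + c3 + c4.
  move=> h1 h2 h3 h4; apply: le_trans (le_normcD _ _) _; apply: lerD => //.
  apply: le_trans (normcB_le _ _) _; apply: lerD => //.
  by apply: le_trans (normcB_le _ _) _; apply: lerD.
apply: le_trans (tri _ _ _ _ _ _ _ _ b1 b2 b4 b5) _.
have : (m + n%:R^-1) * X <= (m + n%:R^-1) *
  (2 * E (fun x => normc (G x j i) ^+ 2) + 8 * kap ^+ 4 / n%:R).
  by rewrite ler_wpM2l // addr_ge0.
move: (_ * (2 * _ + _)) (dv * _ / _) (_ * L / _) (_ * rn / _) => a1 a2 a3 a4.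
rewrite mulrDr mulrDl; lra.
Qed.

(** Only [n] of the [n^2] pairs are diagonal, so a bound of order [rn], using nothing but the second
    moment of the entry, is enough after averaging. *)
Lemma expectation_diag i :
  normc (EC (fun x => u i i x * G x i i + n%:R^-1 * (G x i i * G x i i))) <=
  rn * kap + kap ^+ 2 / n%:R.
Proof.
have k0 : 0 <= kap by apply: le_trans kap_ge1.
have hG x c d : normc (G x c d) <= kap by exact: normc_G.
set qq := q i i; have qS : qq \in S by exact: pos_in.
pose w v := normc (val v).
have Ew : E (fun x => w (x qq)) <= 1.
  rewrite -(@ler_pXn2r _ 2) ?nnegrE ?expr1n //; last first.
    by apply: pexp_ge0 => // x; exact: normc_ge0.
  apply: le_trans (pexp_sqr p_ge0 p_sum1 _) _.
  by rewrite (pexp_coord p_sum1 qq (fun v => w v ^+ 2)); exact: p_var_le1.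
apply: le_trans (normc_cexp p_ge0 _) _.
apply: (@le_trans _ _ (E (fun x => rn * kap * w (x qq) + kap ^+ 2 / n%:R))).
  apply: le_pexp => // x; apply: le_trans (le_normcD _ _) _; apply: lerD.
    rewrite (normcM _ (G x i i)) mulrAC ler_pM ?normc_ge0 //.
    exact: normc_uval_le.
  rewrite normcM normc_natV mulrC normcM ler_wpM2r ?invr_ge0 ?ler0n //.
  by rewrite expr2 ler_pM ?normc_ge0.
rewrite pexpD pexpZ (pexp_cst p_sum1) lerD2r ler_piMr // mulr_ge0 //.
exact: rn_ge0.
Qed.

Definition sc_defect x := 1 + z * stj x + stj x ^+ 2.

Lemma expectation_defect :
  normc (EC sc_defect) <= 20 * kap ^+ 4 * (m + dv + L + rn).
Proof.
have k1 := kap_ge1; have k0 : 0 <= kap by apply: le_trans k1.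
have r0 := rn_ge0; have NV : 0 <= n%:R^-1 :> R by rewrite invr_ge0.
have nz : n%:R != 0 :> R by rewrite pnatr_eq0 -lt0n.
have nzC : n%:R != 0 :> C by rewrite pnatr_eq0 -lt0n.
(* [z G = H G - 1], so the defect is an average over [i, j] of the quantities
   [H_ij G_ji + G_ii G_jj / n]. *)
pose T i j (x : Om) := u i j x * G x j i + n%:R^-1 * (G x i i * G x j j).
have FE x : sc_defect x = n%:R^-1 * \sum_i \sum_j T i j x.
  have tr1 : \sum_i \sum_j u i j x * G x j i = n%:R + z * \tr (G x).
    have <- : \tr (hmat x *m G x) = \sum_i \sum_j u i j x * G x j i.
      by apply: eq_bigr => i _; rewrite mxE; apply: eq_bigr => j _; rewrite mxE.
    have -> : hmat x *m G x = 1%:M + z *: G x.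
      apply/(canRL (subrK _)); rewrite -mul_scalar_mx -mulmxBl.
      exact: (mulmx_resolvent eta_gt0 Imz (hmat_hermitian x)).
    by rewrite mxtraceD mxtrace1 mxtraceZ.
  have tr2 : \sum_i \sum_j n%:R^-1 * (G x i i * G x j j) =
      n%:R^-1 * \tr (G x) ^+ 2.
    rewrite expr2 /mxtrace mulr_suml mulr_sumr; apply: eq_bigr => i _.
    by rewrite !mulr_sumr.
  rewrite /T; under eq_bigr do rewrite big_split.
  rewrite big_split /= tr1 tr2 /sc_defect /stj.
  by field.
have -> : EC sc_defect = n%:R^-1 * \sum_i \sum_j EC (T i j).
  rewrite /cexp (eq_pexp _ FE) pexpZ pexp_sum; congr (_ * _).
  by apply: eq_bigr => i _; rewrite pexp_sum.
rewrite normcM normc_natV.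
pose B : R := m / n%:R + (m + n%:R^-1) * (8 * kap ^+ 4 / n%:R) +
  4 * kap ^+ 3 * L / n%:R + dv * kap ^+ 2 / n%:R + 4 * kap ^+ 3 * rn / n%:R.
pose K : R := 2 * (m + n%:R^-1).
pose Y i j := E (fun x => normc (G x j i) ^+ 2).
have B0 : 0 <= B.
  by rewrite /B; repeat first [assumption | exact: ler0n | apply: exprn_ge0 |
    apply: addr_ge0 | apply: mulr_ge0].
have K0 : 0 <= K by rewrite mulr_ge0 ?addr_ge0.
have Y0 i j : 0 <= Y i j by apply: pexp_ge0 => // x; exact: sqr_ge0.
pose dg : R := rn * kap + kap ^+ 2 / n%:R.
have dg0 : 0 <= dg by rewrite addr_ge0 ?divr_ge0 ?mulr_ge0 ?exprn_ge0.
have TB i j : normc (EC (T i j)) <= B + K * Y i j + (if i == j then dg else 0).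
  have [<-|ij] := eqVneq i j.
    apply: le_trans (expectation_diag i) _; rewrite lerDr addr_ge0 //.
    by rewrite mulr_ge0.
  rewrite addr0; apply: le_trans (expectation_off ij) _.
  by rewrite -/(Y i j) le_eqVlt; apply/orP; left; apply/eqP; rewrite /B /K; ring.
have sumB : \sum_i \sum_j (B + K * Y i j + (if i == j then dg else 0)) <=
    n%:R ^+ 2 * B + K * (n%:R * kap ^+ 2) + n%:R * dg.
  have -> : \sum_i \sum_j (B + K * Y i j + (if i == j then dg else 0)) =
      n%:R ^+ 2 * B + K * (\sum_i \sum_j Y i j) + n%:R * dg.
    exact: sum_affine_diag.
  rewrite lerD2r lerD2l ler_wpM2l // exchange_big /=.
  apply: (@le_trans _ _ (\sum_(i < n) kap ^+ 2)); last first.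
    by rewrite sumr_const card_ord -[leLHS]mulr_natl.
  apply: ler_sum => j _; rewrite /Y -pexp_sum -[leRHS](pexp_cst p_sum1).
  apply: le_pexp => // x.
  apply: le_trans (resolvent_row_sqr eta_gt0 Imz (hmat_hermitian x) j) _.
  rewrite -exprVn lerXn2r ?nnegrE ?invr_ge0 ?(ltW eta_gt0) //.
  by rewrite lerDr.
apply: (@le_trans _ _ (n%:R^-1 *
    (n%:R ^+ 2 * B + K * (n%:R * kap ^+ 2) + n%:R * dg))).
  rewrite ler_wpM2l //; apply: le_trans sumB.
  apply: le_trans (normc_sum _ _ _) _; apply: ler_sum => i _.
  by apply: le_trans (normc_sum _ _ _) _; apply: ler_sum => j _.
have -> : n%:R^-1 * (n%:R ^+ 2 * B + K * (n%:R * kap ^+ 2) + n%:R * dg) =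
  m + (m + n%:R^-1) * (8 * kap ^+ 4 + 2 * kap ^+ 2) + 4 * kap ^+ 3 * L +
  dv * kap ^+ 2 + 4 * kap ^+ 3 * rn + (rn * kap + kap ^+ 2 * n%:R^-1).
  by rewrite /B /K /dg; move: (kap) => k; field.
have nr := invn_le_rn.
(* From here on, arithmetic: powers of [k] are raised to [k^4], and [N <= r]. The coefficients are
   then at most 11 for [m], 1 for [dv], 4 for [L] and [8 + 3 + 4 + 1 = 16] for [r], all below 20. *)
move: (kap) (n%:R^-1) rn k1 k0 r0 NV nr => k N r k1 k0 r0 N0 Nr.
have e1 : 1 <= k ^+ 4 by rewrite exprn_ege1.
have e2 : k <= k ^+ 4 by rewrite -[leLHS]expr1 ler_weXn2l.
have e3 : k ^+ 2 <= k ^+ 4 by rewrite ler_weXn2l.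
have e4 : k ^+ 3 <= k ^+ 4 by rewrite ler_weXn2l.
have mm (a b c : R) : 0 <= a -> b <= c -> a * b <= a * c by move=> *; rewrite ler_wpM2l.
have := (mm _ _ _ m_ge0 e1, mm _ _ _ m_ge0 e3, mm _ _ _ L_ge0 e4).
move=> [[a1 a2] a3].
have a4 := mm _ _ _ dv_ge0 e3; have a5 := mm _ _ _ r0 e4.
have a6 := mm _ _ _ r0 e2; have a7 := mm _ _ _ N0 e3.
have k4 : 0 <= k ^+ 4 by exact: exprn_ge0.
have a8 := mm _ _ _ k4 Nr.
have a9 := mulr_ge0 dv_ge0 k4; have a10 := mulr_ge0 L_ge0 k4.
have a11 := mulr_ge0 m_ge0 k4; have a12 := mulr_ge0 r0 k4.
have -> : m + (m + N) * (8 * k ^+ 4 + 2 * k ^+ 2) + 4 * k ^+ 3 * L +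
   dv * k ^+ 2 + 4 * k ^+ 3 * r + (r * k + k ^+ 2 * N) =
   m * 1 + 8 * (m * k ^+ 4) + 2 * (m * k ^+ 2) + 8 * (k ^+ 4 * N) +
   3 * (N * k ^+ 2) + 4 * (L * k ^+ 3) + dv * k ^+ 2 + 4 * (r * k ^+ 3) + r * k.
  by ring.
have -> : 20 * k ^+ 4 * (m + dv + L + r) = 20 * (m * k ^+ 4) +
  20 * (dv * k ^+ 4) + 20 * (L * k ^+ 4) + 20 * (r * k ^+ 4) by ring.
rewrite [N * k ^+ 4]mulrC in a7; rewrite [k ^+ 4 * r]mulrC in a8.
clear -a1 a2 a3 a4 a5 a6 a7 a8 a9 a10 a11 a12.
move: (m * 1) (m * k ^+ 2) (m * k ^+ 4) (k ^+ 4 * N) (N * k ^+ 2) (L * k ^+ 3)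
  (L * k ^+ 4) (dv * k ^+ 2) (dv * k ^+ 4) (r * k ^+ 3) (r * k ^+ 4) (r * k)
  a1 a2 a3 a4 a5 a6 a7 a8 a9 a10 a11 a12 => *; lra.
Qed.

(** A deviation of [stj] from its mean by at most [e'] moves the defect by at most [e / 2]; the
    deterministic part takes the other half. A larger deviation has real or imaginary part at least
    [e' / 2], and Markov for fourth powers gives [2^16 = 2 * 8 * 4^4 * 2^4]: two parts, the factor
    of [bounded_diff_moments], the row oscillation [4 kap / n], and the halving of [e']. *)
Lemma defect_probability (e e' : R) : 0 < e ->
  e' = e / (2 * (normc z + 2 * kap)) ->
  20 * kap ^+ 4 * (m + dv + L + rn) + 32 * kap ^+ 2 / n%:R <= e / 2 ->
  \sum_(x | e < normc (sc_defect x)) pweight p x <=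
  2 ^+ 16 * kap ^+ 4 / e' ^+ 4 / n%:R ^+ 2.
Proof.
move=> e0 e'E he; have k1 := kap_ge1; have k0 : 0 <= kap by apply: le_trans k1.
have nz : n%:R != 0 :> R by rewrite pnatr_eq0 -lt0n.
have pC1 j' : \sum_v (p j' v)%:C%C = 1 :> C by rewrite -rmorph_sum p_sum1.
pose c := EC stj; pose D x := stj x - c.
pose fr x := complex.Re (stj x); pose fi x := complex.Im (stj x).
pose Bs := [seq block k | k <- enum 'I_n].
have sBs : size Bs = n by rewrite size_map size_enum_ord.
have cov j : has (fun B : {set J} => j \in B) Bs.
  by apply/hasP; exists (block j.1); rewrite ?inE // map_f // mem_enum.
pose cc := 4 * kap / n%:R.
have frB B : B \in Bs -> bounded_diff B cc fr.
  move=> /mapP[k _ ->] x y; apply: le_trans (stj_bounded_diff k x y).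
  by rewrite /fr -raddfB; exact: normr_Re_le.
have fiB B : B \in Bs -> bounded_diff B cc fi.
  move=> /mapP[k _ ->] x y; apply: le_trans (stj_bounded_diff k x y).
  by rewrite /fi -raddfB; exact: normr_Im_le.
have [r2 r4] := bounded_diff_moments p_ge0 p_sum1 frB cov.
have [i2 i4] := bounded_diff_moments p_ge0 p_sum1 fiB cov.
rewrite sBs in r2 r4 i2 i4.
have ReD x : complex.Re (D x) = fr x - E fr by rewrite /D raddfB /= /c Re_cexp.
have ImD x : complex.Im (D x) = fi x - E fi by rewrite /D raddfB /= /c Im_cexp.
have ED2 : normc (EC (fun x => D x ^+ 2)) <= 32 * kap ^+ 2 / n%:R.
  apply: le_trans (normc_cexp p_ge0 _) _.
  under eq_pexp do rewrite normcX normcE2 ReD ImD.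
  rewrite pexpD; apply: le_trans (lerD r2 i2) _.
  by rewrite le_eqVlt; apply/orP; left; apply/eqP; rewrite /cc;
    move: (kap) => k; field.
(* With [s = stj], [c = E s] and [D = s - c], this is the exact identity
   [s ^+ 2 - E (s ^+ 2) = D (s + c) - E (D ^+ 2)] plus the linear part. *)
have FE x : sc_defect x = EC sc_defect + D x * (z + stj x + c) - EC (fun x => D x ^+ 2).
  have -> : EC sc_defect = 1 + z * c + EC (fun x => stj x ^+ 2).
    by rewrite /sc_defect /cexp !pexpD pexpZ (pexp_cst pC1).
  have -> : EC (fun x => D x ^+ 2) = EC (fun x => stj x ^+ 2) - c ^+ 2.
    have DE (y : Om) : D y ^+ 2 = stj y ^+ 2 - (2 * c) * stj y + c ^+ 2.
      by rewrite /D; ring.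
    rewrite /cexp (eq_pexp _ DE) pexpD pexpB pexpZ (pexp_cst pC1) -/(cexp p stj) -/c.
    by ring.
  by rewrite /sc_defect /D; ring.
have nc : normc c <= kap.
  apply: le_trans (normc_cexp p_ge0 _) _; rewrite -[leRHS](pexp_cst p_sum1).
  by apply: le_pexp => // x; exact: normc_stj.
have zk : 0 < normc z + 2 * kap by have := normc_ge0 z; lra.
have e'0 : 0 < e' by rewrite e'E divr_gt0 // mulr_gt0.
have big x : e < normc (sc_defect x) ->
    (e' / 2) ^+ 4 <= (fr x - E fr) ^+ 4 + (fi x - E fi) ^+ 4.
  move=> ex; have Dx : e' < normc (D x).
    rewrite e'E ltr_pdivrMr ?mulr_gt0 //.
    have h1 : normc (D x * (z + stj x + c)) <= normc (D x) * (normc z + 2 * kap).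
      rewrite normcM ler_wpM2l ?normc_ge0 //.
      apply: le_trans (le_normcD _ _) _; have := le_normcD z (stj x).
      have := normc_stj x; lra.
    have h2 : normc (sc_defect x) <= normc (EC sc_defect) +
        normc (D x * (z + stj x + c)) + normc (EC (fun x => D x ^+ 2)).
      rewrite [in leLHS]FE; apply: le_trans (normcB_le _ _) _.
      by rewrite lerD2r; exact: le_normcD.
    have h3 := expectation_defect.
    have -> : normc (D x) * (2 * (normc z + 2 * kap)) =
      2 * (normc (D x) * (normc z + 2 * kap)) by ring.
    move: (normc (D x) * _) (normc (D x * _)) (20 * _) (32 * _ / _) he h1 h2 h3 ED2 ex.
    move=> *; lra.
  have := normc_le_ReIm (D x); rewrite ReD ImD.
  have p4 (a : R) : 0 <= a ^+ 4 by rewrite -[4%N]/(2 * 2)%N exprM sqr_ge0.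
  have q4 (a : R) : e' / 2 <= `|a| -> (e' / 2) ^+ 4 <= a ^+ 4.
    move=> ea; have -> : a ^+ 4 = `|a| ^+ 4.
      by rewrite -[4%N]/(2 * 2)%N !exprM real_normK ?num_real.
    have e'2 : 0 <= e' / 2 by rewrite divr_ge0 // ltW.
    by rewrite lerXn2r ?nnegrE.
  have [ha _|ha hb] := leP (e' / 2) `|fr x - E fr|.
    by apply: le_trans (q4 _ ha) _; rewrite lerDl.
  have ha' : e' / 2 <= `|fi x - E fi| by lra.
  by apply: le_trans (q4 _ ha') _; rewrite lerDr.
have e20 : 0 < (e' / 2) ^+ 4 by rewrite exprn_gt0 // divr_gt0.
have := pexp_markov p_ge0 (Q := fun x => e < normc (sc_defect x))
  (f := fun x => (fr x - E fr) ^+ 4 + (fi x - E fi) ^+ 4) (e := (e' / 2) ^+ 4) _ big.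
rewrite pexpD => H.
have {}H := le_trans (H _) (lerD r4 i4).
rewrite -ler_pdivlMl // in H; apply: le_trans (H _) _ => [x|].
  by rewrite addr_ge0 // -[4%N]/(2 * 2)%N exprM sqr_ge0.
rewrite le_eqVlt; apply/orP; left; apply/eqP; rewrite /cc.
have := lt0r_neq0 e'0; move: (kap) => k e'nz; field.
by rewrite e'nz nz.
Qed.

End moments.
End wigner.

(** * Stieltjes transforms and the semi-circle law *)

Section semicircle_integral.
Variable R : realType.
Local Notation mu := (@lebesgue_measure R).
Local Notation I := (`[(-2)%R, 2%R]%classic : set R).

(** Boundary value on the real axis of the imaginary part of the Stieltjes transform of the
    semi-circle law, that is, [pi] times the density. *)
Definition half_circle (t : R) : R := Num.sqrt (4 - t ^+ 2) / 2.

Lemma continuous_half_circle : continuous half_circle.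
Proof.
move=> t; apply: cvgM; last exact: cvg_cst.
exact: continuous_semicircle.
Qed.

Lemma continuous_integrable_itv (f : R -> R) : continuous f ->
  mu.-integrable I (EFin \o f).
Proof.
move=> cf; apply: continuous_compact_integrable; first exact: segment_compact.
exact: continuous_subspaceT.
Qed.

Import HBNNSimple.

(** Integration against a measure with density, first for simple functions, where it reduces to
    level sets; monotone convergence and positive parts then extend it. *)
Lemma integral_semicircle_nnsfun (h : {nnsfun R >-> R}) :
  (\int[@semicircle R]_x (h x)%:E =
   \int[mu]_x (h x * semicircle_pdf x)%:E)%E.
Proof.
have mpdf := @measurable_semicircle_pdf R.
have mh r : measurable_fun (setT : set (measurableTypeR R))
    (\1_(h @^-1` [set r]) : R -> R).
  apply: measurable_indic; exact: (measurable_sfunP h (measurable_set1 r)).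
rewrite integralT_nnsfun sintegralE.
transitivity (\int[mu]_x (\sum_(r \in range h)
    (r * \1_(h @^-1` [set r]) x * semicircle_pdf x)%:E))%E; last first.
  by apply: eq_integral => x _; rewrite [in RHS](fimfunE h) fsumEFin // mulr_fsuml.
rewrite ge0_integral_fsum //; last 2 first.
- move=> r; apply/measurable_EFinP; apply: measurable_funM => //.
  exact: measurable_funM.
- move=> r x _; rewrite lee_fin mulr_ge0 ?semicircle_pdf_ge0 //.
  by rewrite -lee_fin EFinM nnfun_muleindic_ge0.
apply: eq_fsbigr => r /[!inE] -[y _ <-].
under eq_integral do rewrite -mulrA EFinM.
rewrite ge0_integralZl //; last 3 first.
- apply/measurable_EFinP; exact: measurable_funM.
- by move=> x _; rewrite lee_fin mulr_ge0 ?semicircle_pdf_ge0.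
- by rewrite lee_fin.
congr (_ * _)%E; rewrite /semicircle /= [LHS]integral_mkcond.
apply: eq_integral => x _; rewrite patchE indicE.
by case: ifP => _; rewrite ?mul1r ?mul0r.
Qed.

Lemma ge0_integral_semicircle (f : R -> R) : measurable_fun setT f ->
  (forall x, 0 <= f x) ->
  (\int[@semicircle R]_x (f x)%:E = \int[mu]_x (f x * semicircle_pdf x)%:E)%E.
Proof.
move=> mf f0; have mpdf := @measurable_semicircle_pdf R.
have mfe : measurable_fun setT (EFin \o f) by exact/measurable_EFinP.
pose f_ := nnsfun_approx measurableT mfe.
have fcvg x : (f_ n x)%:E @[n --> \oo] --> (f x)%:E.
  exact: (cvg_nnsfun_approx measurableT mfe (fun x _ => f0 x)).
have fnd a b x : (a <= b)%N -> f_ a x <= f_ b x.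
  by move=> ab; exact/lefP/nd_nnsfun_approx.
transitivity (lim (\int[@semicircle R]_x (f_ n x)%:E @[n --> \oo])%E).
  rewrite -monotone_convergence//=.
  - by apply: eq_integral => x _; apply/esym/cvg_lim.
  - by move=> n; exact/measurable_EFinP/measurable_funTS.
  - by move=> n ? _; rewrite lee_fin.
  - by move=> ? _ ? ? ab; rewrite lee_fin fnd.
under eq_fun do rewrite integral_semicircle_nnsfun.
rewrite -monotone_convergence//=.
- apply: eq_integral => x _; apply/cvg_lim => //.
  apply: cvg_EFin; first exact: nearW.
  apply: cvgM; last exact: cvg_cst.
  exact: (fine_cvg (fcvg x)).
- move=> n; apply/measurable_EFinP; apply: measurable_funM => //.
  exact: (@measurable_funPT _ _ _ _ (f_ n)).
- by move=> n x _; rewrite lee_fin mulr_ge0 ?semicircle_pdf_ge0.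
- by move=> x _ a b ab; rewrite lee_fin ler_wpM2r ?semicircle_pdf_ge0 ?fnd.
Qed.

Lemma semicircle_mass : \int[mu]_(t in I) half_circle t = pi.
Proof.
have -> : \int[mu]_(t in I) half_circle t =
    \int[mu]_(t in I) (Num.sqrt (4 - t ^+ 2) * 2^-1) by [].
rewrite RintegralZr //; last exact/continuous_integrable_itv/continuous_semicircle.
by rewrite /Rintegral integral_semicircle /= mulrAC mulfV // mul1r.
Qed.

Lemma ge0_integral_semicircle_continuous (f : R -> R) : continuous f ->
  (forall x, 0 <= f x) ->
  (\int[@semicircle R]_x (f x)%:E)%E =
  (pi^-1 * \int[mu]_(t in I) (f t * half_circle t))%:E.
Proof.
move=> cf f0; rewrite ge0_integral_semicircle //; last first.
  exact: continuous_measurable_fun.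
have cg : continuous (fun t => f t * half_circle t).
  by move=> t; apply: cvgM; [exact: cf|exact: continuous_half_circle].
have ig := continuous_integrable_itv cg.
rewrite EFinM fineK; last exact: integrable_fin_num ig.
rewrite -integralZl //.
rewrite [RHS]integral_mkcond; apply: eq_integral => x _.
rewrite patchE /semicircle_pdf indicE; case: ifP => _; last by rewrite !mulr0.
rewrite mulr1 -EFinM; congr EFin; rewrite /half_circle invfM; ring.
Qed.

Lemma integral_semicircle_continuous (f : R -> R) : continuous f ->
  (\int[@semicircle R]_x (f x)%:E)%E =
  (pi^-1 * \int[mu]_(t in I) (f t * half_circle t))%:E.
Proof.
move=> cf; rewrite integralE.
have cmax (g : R -> R) : continuous g -> continuous (fun x => Num.max (g x) 0).
  by move=> cg x; apply: continuous_max; [exact: cg|exact: cvg_cst].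
have cN : continuous (fun x => - f x) by move=> x; apply: cvgN; exact: cf.
have -> : (\int[@semicircle R]_x (fun x => (f x)%:E)^\+ x =
    \int[@semicircle R]_x (Num.max (f x) 0)%:E)%E.
  by apply: eq_integral => x _; rewrite funeposE EFin_max.
have -> : (\int[@semicircle R]_x (fun x => (f x)%:E)^\- x =
    \int[@semicircle R]_x (Num.max (- f x) 0)%:E)%E.
  by apply: eq_integral => x _; rewrite funenegE EFin_max.
have cp := cmax _ cf; have cm := cmax _ cN.
have max0 (y : R) : 0 <= Num.max y 0 by rewrite le_max lexx orbT.
rewrite !ge0_integral_semicircle_continuous //.
rewrite -EFinB -mulrBr -RintegralB //; last 2 first.
- apply: continuous_integrable_itv => x; apply: cvgM; first exact: cp.
  exact: continuous_half_circle.
- apply: continuous_integrable_itv => x; apply: cvgM; first exact: cm.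
  exact: continuous_half_circle.
congr ((_ * _)%:E); apply: eq_Rintegral => x _; rewrite -mulrBl; congr (_ * _).
by have [] := leP (f x) 0; have [] := leP (- f x) 0; lra.
Qed.

Lemma ge0_integral_empirical (s : seq R) (g : R -> R) :
  measurable_fun setT g -> (forall x, 0 <= g x) ->
  (\int[empirical_distribution s]_x (g x)%:E)%E =
  ((size s)%:R^-1 * \sum_(x <- s) g x)%:E.
Proof.
move=> mg g0; have mge : measurable_fun setT (EFin \o g) by exact/measurable_EFinP.
rewrite /empirical_distribution ge0_integral_mscale //; last first.
  by move=> x _; rewrite lee_fin.
rewrite EFinM; congr (_ * _)%E.
rewrite ge0_integral_measure_sum //; last by move=> x _; rewrite lee_fin.
rewrite (big_nth 0) big_mkord -sumEFin; apply: eq_bigr => i _.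
by rewrite integral_dirac // diracT mul1e.
Qed.

Lemma integral_empirical (s : seq R) (f : R -> R) : measurable_fun setT f ->
  (\int[empirical_distribution s]_x (f x)%:E)%E =
  ((size s)%:R^-1 * \sum_(x <- s) f x)%:E.
Proof.
move=> mf; rewrite integralE.
have -> : (\int[empirical_distribution s]_x (fun x => (f x)%:E)^\+ x =
    \int[empirical_distribution s]_x (Num.max (f x) 0)%:E)%E.
  by apply: eq_integral => x _; rewrite funeposE EFin_max.
have -> : (\int[empirical_distribution s]_x (fun x => (f x)%:E)^\- x =
    \int[empirical_distribution s]_x (Num.max (- f x) 0)%:E)%E.
  by apply: eq_integral => x _; rewrite funenegE EFin_max.
rewrite !ge0_integral_empirical; last 4 first.
- by apply: measurable_maxr => //; exact: measurableT_comp.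
- by move=> x; rewrite le_max lexx orbT.
- exact: measurable_maxr.
- by move=> x; rewrite le_max lexx orbT.
rewrite -EFinB -mulrBr -sumrB; congr ((_ * _)%:E); apply: eq_bigr => x _.
by have [] := leP (f x) 0; have [] := leP (- f x) 0; lra.
Qed.

End semicircle_integral.

Section stieltjes.
Variable R : realType.
Implicit Types (s : seq R) (z : R[i]).

Definition stieltjes s z : R[i] :=
  (size s)%:R^-1 * \sum_(x <- s) (x%:C%C - z)^-1.

Definition cplx (t eta : R) : R[i] := Complex t eta.

(** The Poisson kernel without its factor [1 / pi]: its mass over the whole line is [pi], which
    matches the normalization of [half_circle]. *)
Definition poisson (eta x t : R) : R := eta / ((x - t) ^+ 2 + eta ^+ 2).

Lemma seq_mean_le s (F : R -> R) c : 0 <= c -> (forall x, F x <= c) ->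
  (size s)%:R^-1 * \sum_(x <- s) F x <= c.
Proof.
move=> c0 Fc; case: s => [|y s]; first by rewrite big_nil mulr0.
rewrite mulrC ler_pdivrMr ?ltr0n //.
apply: (@le_trans _ _ (\sum_(x <- y :: s) c)); first exact: ler_sum.
by rewrite big_const_seq count_predT iter_addr_0 mulr_natr.
Qed.

Lemma Im_inv_subr (eta x t : R) :
  complex.Im (x%:C%C - cplx t eta)^-1 = poisson eta x t.
Proof. by rewrite /= sub0r sqrrN mulNr opprK. Qed.

Lemma Im_stieltjes s (t eta : R) :
  complex.Im (stieltjes s (cplx t eta)) =
  (size s)%:R^-1 * \sum_(x <- s) poisson eta x t.
Proof.
rewrite /stieltjes.
have -> : (size s)%:R^-1 = ((size s)%:R^-1)%:C%C :> R[i].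
  by rewrite fmorphV /= rmorph_nat.
transitivity ((size s)%:R^-1 * complex.Im (\sum_(x <- s) (x%:C%C - cplx t eta)^-1)).
  by case: (\sum_(x <- s) _) => a b /=; rewrite mul0r addr0.
by rewrite Im_sum; under eq_bigr do rewrite Im_inv_subr.
Qed.

Lemma normc_stieltjes s (t eta : R) : 0 < eta ->
  normc (stieltjes s (cplx t eta)) <= eta^-1.
Proof.
move=> eta0; rewrite /stieltjes normcM.
have -> : (size s)%:R^-1 = ((size s)%:R^-1)%:C%C :> R[i].
  by rewrite fmorphV /= rmorph_nat.
rewrite normc_real ger0_norm ?invr_ge0 //.
apply: (@le_trans _ _ ((size s)%:R^-1 *
    \sum_(x <- s) normc (x%:C%C - cplx t eta)^-1)).
  by rewrite ler_wpM2l ?invr_ge0 // normc_sum.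
apply: seq_mean_le; first by rewrite invr_ge0 ltW.
by move=> x; exact: (@normc_inv_subr _ (cplx t eta) eta).
Qed.

Lemma stieltjes_lip s (t t' eta : R) : 0 < eta ->
  normc (stieltjes s (cplx t eta) - stieltjes s (cplx t' eta)) <=
  `|t - t'| / eta ^+ 2.
Proof.
move=> eta0; rewrite /stieltjes -mulrBr -sumrB normcM.
have -> : (size s)%:R^-1 = ((size s)%:R^-1)%:C%C :> R[i].
  by rewrite fmorphV /= rmorph_nat.
rewrite normc_real ger0_norm ?invr_ge0 //.
apply: (@le_trans _ _ ((size s)%:R^-1 * \sum_(x <- s)
    normc ((x%:C%C - cplx t eta)^-1 - (x%:C%C - cplx t' eta)^-1))).
  by rewrite ler_wpM2l ?invr_ge0 // normc_sum.
apply: seq_mean_le => [|x]; first by rewrite divr_ge0 ?sqr_ge0.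
have nz u : x%:C%C - cplx u eta != 0 by exact: (@subr_neq0 _ (cplx u eta) eta).
have -> : (x%:C%C - cplx t eta)^-1 - (x%:C%C - cplx t' eta)^-1 =
    (t - t')%:C%C * ((x%:C%C - cplx t eta)^-1 * (x%:C%C - cplx t' eta)^-1).
  have -> : (t - t')%:C%C = (x%:C%C - cplx t' eta) - (x%:C%C - cplx t eta).
    by rewrite /cplx; apply/eqP; rewrite eq_complex /=; apply/andP; split; apply/eqP; ring.
  by have := nz t; have := nz t'; move: (x%:C%C - _) (x%:C%C - _) => a b a0 b0;
    field; rewrite a0 b0.
rewrite normcM normc_real ler_wpM2l // normcM -exprVn expr2.
by rewrite ler_pM ?normc_ge0 //; exact: (@normc_inv_subr _ (cplx _ eta) eta).
Qed.

(** The Stieltjes transform of the semi-circle law is a root of this quadratic expression. *)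
Definition self_consistency s z : R[i] := 1 + z * stieltjes s z + stieltjes s z ^+ 2.

Lemma normc_cplx (t eta : R) : normc (cplx t eta) <= `|t| + `|eta|.
Proof. exact: normc_le_ReIm. Qed.

(** Extends control from a finite grid to all of [[-2, 2]]. Since [|z| <= 3] and both transforms are
    at most [1 / eta], the factor [z + w + w'] is at most [5 / eta]; the term [(z - z') w'] raises 5
    to 6. *)
Lemma self_consistency_lip s (t t' eta : R) : 0 < eta -> eta <= 1 -> `|t| <= 2 ->
  normc (self_consistency s (cplx t eta)) <=
  normc (self_consistency s (cplx t' eta)) + 6 * `|t - t'| / eta ^+ 3.
Proof.
move=> eta0 eta1 t2; set z := cplx t eta; set z' := cplx t' eta.
set w := stieltjes s z; set w' := stieltjes s z'.
have wb : normc w <= eta^-1 by exact: normc_stieltjes.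
have wb' : normc w' <= eta^-1 by exact: normc_stieltjes.
have wl : normc (w - w') <= `|t - t'| / eta ^+ 2 by exact: stieltjes_lip.
have -> : self_consistency s z = self_consistency s z' +
    ((z - z') * w' + (z + w + w') * (w - w')).
  by rewrite /self_consistency -/w -/w'; ring.
apply: le_trans (le_normcD _ _) _; rewrite lerD2l.
have zz : normc (z - z') = `|t - t'|.
  rewrite (_ : z - z' = (t - t')%:C%C) ?normc_real //.
  by apply/eqP; rewrite eq_complex /= subrr !eqxx.
have z3 : normc z <= 3.
  apply: le_trans (normc_cplx _ _) _; rewrite (ger0_norm (ltW eta0)); lra.
have e1 : 1 <= eta^-1 by rewrite invf_ge1.
have b1 : normc ((z - z') * w') <= `|t - t'| * eta^-1.
  by rewrite normcM zz ler_wpM2l.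
have b2 : normc ((z + w + w') * (w - w')) <= (5 * eta^-1) * (`|t - t'| / eta ^+ 2).
  rewrite normcM ler_pM ?normc_ge0 //.
  apply: le_trans (le_normcD _ _) _; have := le_normcD z w; lra.
apply: le_trans (le_normcD _ _) _; apply: le_trans (lerD b1 b2) _.
have -> : 6 * `|t - t'| / eta ^+ 3 = `|t - t'| * (eta^-1 * (eta^-1 * eta^-1)) +
    5 * eta^-1 * (`|t - t'| / eta ^+ 2) by field; rewrite gt_eqF.
rewrite lerD2r ler_wpM2l // ler_peMr ?invr_ge0 ?(ltW eta0) //.
by rewrite -[1](mulr1 1) ler_pM.
Qed.

(* [w0 := (- t + i sqrt (4 - t^2)) / 2] solves [w^2 + t w + 1 = 0], so that
   [w^2 + t w + 1 = (w - w0) (w - w0^* )], where [|w - w0| <= |w - w0^*|]. *)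
Lemma Im_near_half_circle (w : R[i]) (t eta e : R) :
  0 < eta -> eta <= 1 -> `|t| <= 2 -> e <= 1 -> 0 <= complex.Im w ->
  normc (1 + cplx t eta * w + w ^+ 2) <= e ->
  (complex.Im w - half_circle t) ^+ 2 <= e + 4 * eta.
Proof.
move=> eta0 eta1 t2 e1 Imw he.
(* A priori bound: beyond 4 the square dominates the linear term, as [|z| <= 3] and [e <= 1]. It
   makes the cost of replacing [z] by [t] equal to [4 * eta]. *)
have w4 : normc w <= 4.
  rewrite leNgt; apply/negP => w4.
  have h1 : normc w ^+ 2 <= 1 + 3 * normc w + e.
    have -> : normc w ^+ 2 = normc ((1 + cplx t eta * w + w ^+ 2) - (1 + cplx t eta * w)).
      by rewrite addrAC subrr add0r normcX.
    apply: le_trans (normcB_le _ _) _.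
    have := le_normcD 1 (cplx t eta * w); rewrite normc1 normcM.
    have z3 : normc (cplx t eta) <= 3.
      apply: le_trans (normc_cplx _ _) _; rewrite (ger0_norm (ltW eta0)); lra.
    have := ler_wpM2r (normc_ge0 w) z3; lra.
  have : 4 * normc w <= normc w ^+ 2 by rewrite expr2 ler_wpM2r ?normc_ge0 // ltW.
  lra.
set r := half_circle t.
have r0 : 0 <= r by rewrite divr_ge0 ?sqrtr_ge0.
have r2 : r ^+ 2 = 1 - t ^+ 2 / 4.
  rewrite /r /half_circle exprMn sqr_sqrtr; first by field.
  by rewrite subr_ge0 -[leLHS]real_normK ?num_real // (_ : 4 = 2 ^+ 2) ?lerXn2r ?nnegrE //; ring.
pose w0 : R[i] := Complex (- t / 2) r; pose w1 : R[i] := Complex (- t / 2) (- r).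
have fac : (w - w0) * (w - w1) = (1 + cplx t eta * w + w ^+ 2) - Complex 0 eta * w.
  have -> : (w - w0) * (w - w1) = w ^+ 2 - (w0 + w1) * w + w0 * w1 by ring.
  have -> : w0 + w1 = - t%:C%C.
    by apply/eqP; rewrite eq_complex /=; apply/andP; split; apply/eqP; [field|ring].
  have -> : w0 * w1 = 1.
    apply/eqP; rewrite eq_complex /=; apply/andP; split; apply/eqP; last by ring.
    have -> : - t / 2 * (- t / 2) - r * - r = t ^+ 2 / 4 + r ^+ 2 by field.
    by rewrite r2; ring.
  have -> : cplx t eta = t%:C%C + Complex 0 eta.
    by apply/eqP; rewrite eq_complex /= addr0 add0r !eqxx.
  by ring.
have n1 : normc (w - w0) * normc (w - w1) <= e + 4 * eta.
  rewrite -normcM fac; apply: le_trans (normcB_le _ _) _; rewrite lerD // normcM.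
  have -> : normc (Complex 0 eta) = eta.
    by rewrite /= expr0n /= add0r sqrtr_sqr ger0_norm // ltW.
  by rewrite mulrC ler_wpM2r // ltW.
apply: le_trans n1.
have E0 : normc (w - w0) ^+ 2 = (complex.Re w + t / 2) ^+ 2 + (complex.Im w - r) ^+ 2.
  by rewrite normcE2; case: (w) => a b /=; congr (_ ^+ 2 + _); lra.
have E1 : normc (w - w1) ^+ 2 = (complex.Re w + t / 2) ^+ 2 + (complex.Im w + r) ^+ 2.
  by rewrite normcE2; case: (w) => a b /=; congr (_ ^+ 2 + _ ^+ 2); lra.
have le01 : normc (w - w0) <= normc (w - w1).
  rewrite -(@ler_pXn2r _ 2) ?nnegrE ?normc_ge0 // E0 E1 lerD2l -subr_ge0.
  have -> : (complex.Im w + r) ^+ 2 - (complex.Im w - r) ^+ 2 = 4 * (complex.Im w * r) by ring.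
  by rewrite mulr_ge0 ?mulr_ge0.
(* The product is bounded below by a square instead of being divided by [|w - w1|]: the two roots
   coincide at [t = 2] and [t = -2], and the estimate must be uniform in [t]. *)
apply: (@le_trans _ _ (normc (w - w0) ^+ 2)); first by rewrite E0 lerDr sqr_ge0.
by rewrite expr2 ler_wpM2l ?normc_ge0.
Qed.

End stieltjes.

(** * Poisson smoothing of test functions over [-2, 2] *)

Section poisson_kernel.
Variable R : realType.
Local Notation mu := (@lebesgue_measure R).
Local Notation I := (`[(-2)%R, 2%R]%classic : set R).

Lemma poisson_den_gt0 (eta x t : R) : 0 < eta -> 0 < (x - t) ^+ 2 + eta ^+ 2.
Proof. by move=> eta0; rewrite ltr_wpDl ?sqr_ge0 ?exprn_gt0. Qed.

Lemma poisson_ge0 (eta x t : R) : 0 < eta -> 0 <= poisson eta x t.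
Proof. by move=> eta0; rewrite divr_ge0 ?(ltW eta0) ?ltW ?poisson_den_gt0. Qed.

Lemma continuous_poisson (eta x : R) : 0 < eta -> continuous (poisson eta x).
Proof.
move=> eta0 t; apply: cvgM; first exact: cvg_cst.
apply: cvgV; first by rewrite gt_eqF ?poisson_den_gt0.
apply: cvgD; last exact: cvg_cst.
apply: (@continuous_comp _ _ _ (fun t : R => x - t) (fun y => y ^+ 2)).
  by apply: cvgB; [exact: cvg_cst|exact: cvg_id].
exact: exprn_continuous.
Qed.

Lemma integral_poisson_le (eta x : R) : 0 < eta ->
  \int[mu]_(t in I) poisson eta x t <= pi.
Proof.
move=> eta0; pose F t : R := atan ((t - x) / eta).
have dF (t : R) : is_derive t 1 F (poisson eta x t).
  have dg : is_derive t 1 (fun t : R => (t - x) / eta) eta^-1.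
    apply: is_derive_eq; rewrite /GRing.scale /=; ring.
  have dF := @is_derive1_comp R (@atan R) (fun t : R => (t - x) / eta) t _ _
    (is_derive1_atan _) dg.
  apply: (is_derive_eq dF); rewrite /poisson.
  by field; rewrite !gt_eqF ?poisson_den_gt0.
have cF : continuous F.
  by move=> t; apply/differentiable_continuous/derivable1_diffP; case: (dF t).
rewrite /Rintegral (@continuous_FTC2 R _ F (-2) 2) //=.
- have := atan_ltpi2 ((2 - x) / eta); have := atan_gtNpi2 ((-2 - x) / eta).
  rewrite /F; lra.
- lra.
- by apply: continuous_subspaceT; exact: continuous_poisson.
- split; first by move=> t _; case: (dF t).
  + exact/cvg_at_right_filter/cF.
  + exact/cvg_at_left_filter/cF.
- by move=> t _; rewrite derive1E (@derive_val _ _ _ _ _ _ _ (dF t)).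
Qed.

Lemma mu_itv : fine (mu I) = 4.
Proof. by rewrite lebesgue_measure_itv /= lte_fin ifT /=; lra. Qed.

Lemma Rintegral_itv_cst (c : R) : \int[mu]_(t in I) c = c * 4.
Proof. by rewrite Rintegral_cst // mu_itv. Qed.

Lemma Rintegral_seq_mean (s : seq R) (F : R -> R -> R) :
  (forall x, continuous (F x)) ->
  \int[mu]_(t in I) ((size s)%:R^-1 * \sum_(x <- s) F x t) =
  (size s)%:R^-1 * \sum_(x <- s) \int[mu]_(t in I) F x t.
Proof.
move=> cF.
have csum (r : seq R) : continuous (fun t => \sum_(x <- r) F x t).
  elim: r => [|y r IH].
    by under eq_fun do rewrite big_nil; move=> t; exact: cvg_cst.
  under eq_fun do rewrite big_cons.
  by move=> t; apply: cvgD; [exact: cF|exact: IH].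
rewrite RintegralZl //; last exact/continuous_integrable_itv/csum.
congr (_ * _); elim: (s) => [|y r IH].
  under eq_Rintegral do rewrite big_nil.
  by rewrite big_nil Rintegral_itv_cst mul0r.
under eq_Rintegral do rewrite big_cons.
rewrite big_cons RintegralD ?IH //; first exact/continuous_integrable_itv/cF.
exact/continuous_integrable_itv/csum.
Qed.

(** Heine's theorem with only [t] confined to the compact interval, because [x] will be an
    eigenvalue, which may lie slightly outside. *)
Lemma unif_continuous_itv (f : R -> R) (e : R) : continuous f -> 0 < e ->
  exists2 dl : R, 0 < dl &
    forall t x, I t -> `|x - t| < dl -> `|f x - f t| <= e.
Proof.
move=> cf e0; pose P (dl t : R) := forall x, `|x - t| < dl -> `|f x - f t| <= e.
have Icpt : compact I by exact: segment_compact.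
have cov : \forall dl \near 0^'+, I `<=` P dl.
  apply: ((compact_near_coveringP I).1 Icpt) => t It.
  have e2 : 0 < e / 2 by rewrite divr_gt0.
  have /cvgrPdist_lt /(_ _ e2) := cf t.
  move=> /nbhs_ballP[r /= r0 hr].
  exists (ball t (r / 2), [set dl | dl < r / 2]) => /=.
    split; first by apply: nbhsx_ballx; rewrite divr_gt0.
    by apply: nbhs_right_lt; rewrite divr_gt0.
  move=> [t' dl] /= [tt' dlr] x xt'.
  have h1 : `|f t - f t'| < e / 2.
    by apply: hr; rewrite /ball /= in tt' *; apply: lt_trans tt' _; lra.
  have h2 : `|f t - f x| < e / 2.
    apply: hr; rewrite /ball /= in tt' *.
    have := ler_distD t' t x; rewrite [`|t' - x|]distrC; lra.
  have := ler_distD (f t) (f x) (f t'); rewrite [`|f x - f t|]distrC; lra.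
have [dl /= [dl0 hdl]] : exists dl, 0 < dl /\ I `<=` P dl.
  near (0 : R)^'+ => dl; exists dl; split; first by near: dl; exact: nbhs_right_gt.
  by near: dl.
by exists dl => // t x It; exact: hdl.
Unshelve. all: by end_near. Qed.

Variables (f : R -> R) (M om dl eta : R).
Hypotheses (cf : continuous f) (fM : forall x, `|f x| <= M).
Hypotheses (om0 : 0 <= om) (dl0 : 0 < dl) (eta0 : 0 < eta).
Hypothesis f_unif : forall t x, I t -> `|x - t| < dl -> `|f x - f t| <= om.

Lemma pi_inv_le1 : (pi : R)^-1 <= 1.
Proof. by rewrite invf_le1 ?pi_gt0 //; have := @pi_ge2 R; lra. Qed.

(** The difference is [f x] times the Poisson mass missing from [[-2, 2]], plus a mean of
    [f x - f t]. The latter is at most [om] near [x]; at distance [dl] or more the kernel is at most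
    [eta / dl^2], and [8 = 2 * 4] comes from [2 M] and the interval length. The missing mass is left
    explicit: for one far eigenvalue it is not small, only its average is. *)
Lemma poisson_approx x :
  `|f x - pi^-1 * \int[mu]_(t in I) (f t * poisson eta x t)| <=
  M * (1 - pi^-1 * \int[mu]_(t in I) poisson eta x t) + om +
  8 * M * eta / dl ^+ 2.
Proof.
have M0 : 0 <= M by apply: le_trans (fM 0).
have pi0 := @pi_gt0 R; have piV0 : 0 <= (pi : R)^-1 by rewrite invr_ge0 ltW.
have cp := @continuous_poisson eta x eta0; have ip := continuous_integrable_itv cp.
have cfp : continuous (fun t => f t * poisson eta x t).
  by move=> t; apply: cvgM; [exact: cf|exact: cp].
pose h t := (f x - f t) * poisson eta x t.
have ch : continuous h.
  move=> t; apply: cvgM; last exact: cp.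
  by apply: cvgB; [exact: cvg_cst|exact: cf].
set X := \int[mu]_(t in I) poisson eta x t.
have X_le : X <= pi by exact: integral_poisson_le.
have X_ge0 : 0 <= X by apply: Rintegral_ge0 => t _; exact: poisson_ge0.
have hE : \int[mu]_(t in I) h t = f x * X - \int[mu]_(t in I) (f t * poisson eta x t).
  rewrite -RintegralZl // -RintegralB //.
  - by apply: eq_Rintegral => t _; rewrite /h mulrBl.
  - apply: continuous_integrable_itv => t.
    by apply: cvgM; [exact: cvg_cst|exact: cp].
  - exact: continuous_integrable_itv.
have hb : `|\int[mu]_(t in I) h t| <= om * X + 2 * M * eta / dl ^+ 2 * 4.
  apply: (le_trans (le_normr_Rintegral _ _)) => //.
    exact: continuous_integrable_itv.
  have c1 : continuous (fun t => om * poisson eta x t).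
    by move=> t; apply: cvgM; [exact: cvg_cst|exact: cp].
  rewrite -RintegralZl // -Rintegral_itv_cst -RintegralD //; first last.
  - by apply: continuous_integrable_itv => t; exact: cvg_cst.
  - exact: continuous_integrable_itv.
  apply: le_Rintegral => //.
  - by apply: continuous_integrable_itv => t; apply: cvg_norm; exact: ch.
  - apply: continuous_integrable_itv => t; apply: cvgD; first exact: c1.
    exact: cvg_cst.
  move=> t It; rewrite /h normrM (ger0_norm (poisson_ge0 x t eta0)).
  have p0 := poisson_ge0 x t eta0.
  have [xt|xt] := ltP `|x - t| dl.
    apply: (@le_trans _ _ (om * poisson eta x t)).
      by rewrite ler_wpM2r // f_unif.
    by rewrite lerDl !mulr_ge0 ?invr_ge0 ?sqr_ge0 ?(ltW eta0).
  apply: (@le_trans _ _ (2 * M * (eta / dl ^+ 2))); last first.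
    by rewrite mulrA lerDr mulr_ge0.
  apply: ler_pM => //.
    by apply: le_trans (ler_normB _ _) _; have := fM x; have := fM t; lra.
  rewrite /poisson ler_wpM2l ?(ltW eta0) // lef_pV2 ?posrE ?poisson_den_gt0 ?exprn_gt0 //.
  apply: (@le_trans _ _ ((x - t) ^+ 2)); last by rewrite lerDl sqr_ge0.
  by rewrite -[leRHS]real_normK ?num_real // lerXn2r ?nnegrE ?(ltW dl0).
have -> : f x - pi^-1 * \int[mu]_(t in I) (f t * poisson eta x t) =
    f x * (1 - pi^-1 * X) + pi^-1 * \int[mu]_(t in I) h t by rewrite hE; ring.
have X1 : 0 <= 1 - pi^-1 * X by rewrite subr_ge0 mulrC ler_pdivrMr // mul1r.
apply: le_trans (ler_normD _ _) _; rewrite -addrA; apply: lerD.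
  by rewrite normrM (ger0_norm X1) ler_wpM2r.
rewrite normrM (ger0_norm piV0); apply: (le_trans (ler_wpM2l piV0 hb)).
rewrite mulrDr; apply: lerD.
  by rewrite mulrCA ler_piMr // mulrC ler_pdivrMr // mul1r.
have -> : 2 * M * eta / dl ^+ 2 * 4 = 8 * M * eta / dl ^+ 2 by ring.
by rewrite ler_piMl ?pi_inv_le1 // !mulr_ge0 ?invr_ge0 ?sqr_ge0 ?(ltW eta0).
Qed.

(** Averaged over [s], the missing masses add up to [1 - pi^-1 \int g], which is at most [4 kp]
    because [half_circle] integrates to exactly [pi]. This control of the eigenvalues outside
    [[-2, 2]] contributes [4 M kp]; replacing [g] by [half_circle] contributes another [4 M kp]. *)
Lemma empirical_near_semicircle (s : seq R) (kp : R) : (0 < size s)%N ->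
  (forall t, I t -> `|complex.Im (stieltjes s (cplx t eta)) - half_circle t| <= kp) ->
  `|(size s)%:R^-1 * (\sum_(x <- s) f x) -
    pi^-1 * \int[mu]_(t in I) (f t * half_circle t)| <=
  8 * M * kp + om + 8 * M * eta / dl ^+ 2.
Proof.
move=> s0 hk; have M0 : 0 <= M by apply: le_trans (fM 0).
have pi0 := @pi_gt0 R; have piV0 : 0 <= (pi : R)^-1 by rewrite invr_ge0 ltW.
set N := (size s)%:R^-1; have N0 : 0 <= N by rewrite invr_ge0.
have NC (c : R) : N * \sum_(x <- s) c = c.
  rewrite big_const_seq count_predT iter_addr_0 -[c *+ _]mulr_natl mulrA.
  by rewrite mulVf ?mul1r // pnatr_eq0 -lt0n.
pose g t := N * \sum_(x <- s) poisson eta x t.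
have gE t : complex.Im (stieltjes s (cplx t eta)) = g t by exact: Im_stieltjes.
have cp x := @continuous_poisson eta x eta0.
have csum (r : seq R) : continuous (fun t => \sum_(x <- r) poisson eta x t).
  elim: r => [|y r IH].
    by under eq_fun do rewrite big_nil; move=> t; exact: cvg_cst.
  under eq_fun do rewrite big_cons.
  by move=> t; apply: cvgD; [exact: cp|exact: IH].
have cg : continuous g.
  by move=> t; apply: cvgM; [exact: cvg_cst|exact: csum].
have cr := @continuous_half_circle R.
have cfg : continuous (fun t => f t * g t).
  by move=> t; apply: cvgM; [exact: cf|exact: cg].
have cfr : continuous (fun t => f t * half_circle t).
  by move=> t; apply: cvgM; [exact: cf|exact: cr].
have kp0 : 0 <= kp.
  by apply: le_trans (hk 0 _) => //=; rewrite in_itv /=; lra.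
have ig : \int[mu]_(t in I) g t = N * \sum_(x <- s) \int[mu]_(t in I) poisson eta x t.
  exact: Rintegral_seq_mean.
have ifg : \int[mu]_(t in I) (f t * g t) =
    N * \sum_(x <- s) \int[mu]_(t in I) (f t * poisson eta x t).
  rewrite -Rintegral_seq_mean; last first.
    by move=> x t; apply: cvgM; [exact: cf|exact: cp].
  by apply: eq_Rintegral => t _; rewrite /g mulrCA mulr_sumr.
have rg : 1 - pi^-1 * \int[mu]_(t in I) g t <= 4 * kp.
  have -> : 1 - pi^-1 * \int[mu]_(t in I) g t =
      pi^-1 * \int[mu]_(t in I) (half_circle t - g t).
    rewrite RintegralB ?semicircle_mass //; [|exact: continuous_integrable_itv..].
    by rewrite mulrBr mulVf // gt_eqF.
  apply: (@le_trans _ _ (pi^-1 * (kp * 4))); last first.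
    by rewrite [kp * 4]mulrC ler_piMl ?pi_inv_le1 ?mulr_ge0.
  rewrite ler_wpM2l // -Rintegral_itv_cst; apply: le_Rintegral => //.
  - apply: continuous_integrable_itv => t.
    by apply: cvgB; [exact: cr|exact: cg].
  - by apply: continuous_integrable_itv => t; exact: cvg_cst.
  by move=> t It; apply: le_trans (hk t It); rewrite gE distrC ler_norm.
have fgr : `|pi^-1 * \int[mu]_(t in I) (f t * g t) -
    pi^-1 * \int[mu]_(t in I) (f t * half_circle t)| <= 4 * M * kp.
  rewrite -mulrBr -RintegralB //; [|exact: continuous_integrable_itv..].
  rewrite normrM (ger0_norm piV0).
  apply: (@le_trans _ _ (pi^-1 * (M * kp * 4))); last first.
    have -> : 4 * M * kp = M * kp * 4 by ring.
    by rewrite ler_piMl ?pi_inv_le1 ?mulr_ge0.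
  rewrite ler_wpM2l //; apply: (le_trans (le_normr_Rintegral _ _)) => //.
    apply: continuous_integrable_itv => t.
    by apply: cvgB; [exact: cfg|exact: cfr].
  rewrite -Rintegral_itv_cst; apply: le_Rintegral => //.
  - apply: continuous_integrable_itv => t; apply: cvg_norm.
    by apply: cvgB; [exact: cfg|exact: cfr].
  - by apply: continuous_integrable_itv => t; exact: cvg_cst.
  by move=> t It; rewrite -mulrBr normrM ler_pM // -gE hk.
have main : `|N * (\sum_(x <- s) f x) - pi^-1 * \int[mu]_(t in I) (f t * g t)| <=
    M * (4 * kp) + om + 8 * M * eta / dl ^+ 2.
  pose Psi x := f x - pi^-1 * \int[mu]_(t in I) (f t * poisson eta x t).
  have -> : N * (\sum_(x <- s) f x) - pi^-1 * \int[mu]_(t in I) (f t * g t) =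
      N * \sum_(x <- s) Psi x.
    by rewrite sumrB mulrBr -mulr_sumr ifg mulrCA.
  rewrite normrM (ger0_norm N0).
  apply: (@le_trans _ _ (N * \sum_(x <- s)
     (M * (1 - pi^-1 * \int[mu]_(t in I) poisson eta x t) +
     (om + 8 * M * eta / dl ^+ 2)))).
    rewrite ler_wpM2l //; apply: le_trans (ler_norm_sum _ _ _) _.
    by apply: ler_sum => x _; rewrite addrA; exact: poisson_approx.
  rewrite big_split /= mulrDr NC -addrA lerD2r -mulr_sumr mulrCA ler_wpM2l //.
  rewrite sumrB mulrBr NC -mulr_sumr mulrCA -ig.
  exact: rg.
have := ler_distD (pi^-1 * \int[mu]_(t in I) (f t * g t)) (N * (\sum_(x <- s) f x))
  (pi^-1 * \int[mu]_(t in I) (f t * half_circle t)).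
move: main fgr; set c := 8 * M * eta / dl ^+ 2.
rewrite (_ : M * (4 * kp) = 4 * (M * kp)); last by ring.
rewrite (_ : 4 * M * kp = 4 * (M * kp)); last by ring.
rewrite (_ : 8 * M * kp = 8 * (M * kp)); last by ring.
move: (M * kp) => Mk; lra.
Qed.

End poisson_kernel.

Section weak_convergence.
Variable R : realType.
Local Notation I := (`[(-2)%R, 2%R]%classic : set R).

(* A subdivision of [-2, 2] when [a] ranges over [0, ..., b.+1]. *)
Definition grid (a b : nat) : R := - 2 + 4 * a%:R / b.+1%:R.

Lemma grid_approx (b : nat) (t : R) : I t ->
  exists2 a : 'I_b.+2, True & `|t - grid a b| <= 4 / b.+1%:R.
Proof.
rewrite /= in_itv /= => /andP[t1 t2].
have b0 : 0 < b.+1%:R :> R by rewrite ltr0n.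
set y := (t + 2) * b.+1%:R / 4.
have y0 : 0 <= y by rewrite divr_ge0 // mulr_ge0 //; lra.
have /andP[h1 h2] := truncn_itv y0.
have ab : (Num.truncn y < b.+2)%N.
  rewrite ltnS -(ler_nat R); apply: le_trans h1 _.
  rewrite ler_pdivrMr // mulrC ler_pM2l //; lra.
exists (Ordinal ab) => //; rewrite /grid /=.
have -> : t - (- 2 + 4 * (Num.truncn y)%:R / b.+1%:R) =
    (y - (Num.truncn y)%:R) * (4 / b.+1%:R) by rewrite /y; field; rewrite gt_eqF.
have c0 : 0 <= 4 / b.+1%:R :> R by rewrite divr_ge0.
rewrite ger0_norm; last by rewrite mulr_ge0 // subr_ge0.
by rewrite ler_piMl // lerBlDr addrC natr1 ltW.
Qed.

Lemma exists_small_invn (c e : R) : 0 <= c -> 0 < e ->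
  exists k : nat, c * k.+1%:R^-1 <= e.
Proof.
move=> c0 e0; exists (Num.truncn (c / e)).
rewrite ler_pdivrMr ?ltr0n // mulrC -ler_pdivrMr //.
exact/ltW/truncnS_gt.
Qed.

(** The hypothesis concerns countably many points, but a given test function and precision call for
    a single height [eta] and a single finite grid, so finitely many eventual statements are
    intersected. *)
Lemma weak_cvg_self_consistency (J : Type) (F : set_system J) {FF : Filter F}
    (lam : J -> seq R) :
  (\forall j \near F, (0 < size (lam j))%N) ->
  (forall (a b k : nat) (e : R), 0 < e -> \forall j \near F,
     normc (self_consistency (lam j) (cplx (grid a b) k.+1%:R^-1)) <= e) ->
  weak_cvg F (fun j => empirical_distribution (lam j)) (@semicircle R).
Proof.
move=> lam0 lamF f cf fb.
have [M M0 fM] : exists2 M : R, 0 <= M & forall x, `|f x| <= M.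
  have [M0 [_ hM]] := fb.
  exists (Num.max 0 (M0 + 1)); first by rewrite le_max lexx.
  by move=> x; apply: (hM (Num.max 0 (M0 + 1))) => //; rewrite lt_max ltrDl ltr01 orbT.
rewrite integral_semicircle_continuous //.
have mf : measurable_fun setT f by exact: continuous_measurable_fun.
rewrite (_ : (fun j => _) = fun j => ((size (lam j))%:R^-1 *
    \sum_(x <- lam j) f x)%:E); last first.
  by apply/funext => j; exact: integral_empirical.
apply: cvg_EFin; first exact: nearW.
apply/cvgrPdist_le => e e0.
have e4 : 0 < e / 4 by lra.
have [dl dl0 f_unif] := unif_continuous_itv cf e4.
(* Each of the three errors of [empirical_near_semicircle] is made at most [e / 4]; [M + 1] guards
   against [M = 0]. Below, [4 * eta] and [e'] each take half of [kp ^+ 2] in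
   [Im_near_half_circle]. *)
pose kp := e / (32 * (M + 1)).
have M1 : 0 < M + 1 by lra.
have kp0 : 0 < kp by rewrite divr_gt0 // mulr_gt0.
have [k hk] : exists k : nat, (8 * M / dl ^+ 2 + 8) * k.+1%:R^-1 <=
    Num.min (e / 4) (kp ^+ 2).
  apply: exists_small_invn; last by rewrite lt_min e4 exprn_gt0.
  by rewrite addr_ge0 // !mulr_ge0 ?invr_ge0 ?sqr_ge0.
set eta : R := k.+1%:R^-1 in hk.
have eta0 : 0 < eta by rewrite invr_gt0 ltr0n.
have eta1 : eta <= 1 by rewrite invf_le1 ?ltr0n // ler1n.
move: hk; rewrite le_min mulrDl => /andP[hk1 hk2].
have c0 : 0 <= 8 * M / dl ^+ 2 * eta.
  by rewrite !mulr_ge0 ?invr_ge0 ?sqr_ge0 ?(ltW eta0).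
have etak : 8 * M * eta / dl ^+ 2 <= e / 4.
  have -> : 8 * M * eta / dl ^+ 2 = 8 * M / dl ^+ 2 * eta by ring.
  have := ltW eta0; lra.
have eta8 : 4 * eta <= kp ^+ 2 / 2 by lra.
pose e' := Num.min 1 (kp ^+ 2 / 2).
have e'0 : 0 < e' by rewrite lt_min ltr01 divr_gt0 // exprn_gt0.
(* [24 = 6 * 4]: the constant of [self_consistency_lip] times the numerator of the grid step. *)
have [b hb] : exists b : nat, 24 / eta ^+ 3 * b.+1%:R^-1 <= e' / 2.
  apply: exists_small_invn; last by rewrite divr_gt0.
  by rewrite divr_ge0 // exprn_ge0 // ltW.
have near_grid : \forall j \near F, forall a : 'I_b.+2,
    normc (self_consistency (lam j) (cplx (grid a b) eta)) <= e' / 2.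
  by apply: filter_forall => a; apply: lamF; rewrite divr_gt0.
near=> j.
have j0 : (0 < size (lam j))%N by near: j.
have jg : forall a : 'I_b.+2,
    normc (self_consistency (lam j) (cplx (grid a b) eta)) <= e' / 2 by near: j.
rewrite distrC.
apply: le_trans (empirical_near_semicircle cf fM (ltW e4) dl0 eta0 f_unif j0
  (kp := kp) _) _; last first.
  have : 8 * M * kp <= e / 4.
    rewrite /kp mulrA ler_pdivrMr ?mulr_gt0 //.
    have -> : e / 4 * (32 * (M + 1)) = 8 * M * e + 8 * e by field.
    lra.
  lra.
move=> t It; have t2 : `|t| <= 2.
  by move: It; rewrite /= in_itv /= ler_norml => /andP[-> ->].
have [a _ ta] := grid_approx b It.
have sc : normc (self_consistency (lam j) (cplx t eta)) <= e'.
  apply: le_trans (self_consistency_lip _ (grid a b) eta0 eta1 t2) _.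
  have h1 := jg a.
  have h2 : 6 * `|t - grid a b| / eta ^+ 3 <= e' / 2.
    apply: le_trans hb.
    have -> : 24 / eta ^+ 3 * b.+1%:R^-1 = 6 * (4 / b.+1%:R) / eta ^+ 3.
      by ring.
    rewrite ler_wpM2r ?invr_ge0 ?exprn_ge0 ?(ltW eta0) //.
    by rewrite ler_wpM2l.
  lra.
have Im0 : 0 <= complex.Im (stieltjes (lam j) (cplx t eta)).
  rewrite Im_stieltjes // mulr_ge0 ?invr_ge0 //.
  by apply: sumr_ge0 => x _; exact: poisson_ge0.
have e'1 : e' <= 1 by rewrite ge_min lexx.
have := Im_near_half_circle eta0 eta1 t2 e'1 Im0 sc.
have e'2 : e' <= kp ^+ 2 / 2 by rewrite ge_min lexx orbT.
move=> h; rewrite -(@ler_pXn2r _ 2) ?nnegrE ?(ltW kp0) //.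
rewrite real_normK ?num_real //; lra.
Unshelve. all: by end_near. Qed.

End weak_convergence.

(** * Discretization of the entries *)

Section rounding.
Variables (R : realType) (n : nat).

Definition rtype := (bool * 'I_(n ^ 3).+1)%type.

(* [inord] sends out-of-range arguments to [0], so that [rnd] truncates at
   level [n ^ 2] besides rounding towards [0] on the grid of step [1 / n]. *)
Definition rnd (x : R) : rtype := (x < 0, inord (Num.truncn (n%:R * `|x|))).

Definition rval (v : rtype) : R := (-1) ^+ v.1 * (v.2%:R / n%:R).

(** The reason for rounding towards 0: the original variable dominates its roundings, which yields
    variance at most 1 and dominated convergence. *)
Lemma rval_rnd_le x : `|rval (rnd x)| <= `|x|.
Proof.
rewrite /rval normrM normrX normrN1 expr1n mul1r /=.
rewrite ger0_norm ?divr_ge0 ?ler0n //.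
have [n0|n0] := posnP n.
  by rewrite (_ : n%:R^-1 = 0) ?mulr0 // n0 invr0.
rewrite ler_pdivrMr ?ltr0n // [leRHS]mulrC.
have y0 : 0 <= n%:R * `|x| by rewrite mulr_ge0 ?ler0n.
have [h|h] := ltnP (Num.truncn (n%:R * `|x|)) (n ^ 3).+1.
  rewrite inordK //; by have /andP[] := truncn_itv y0.
by rewrite /inord val_insubd ltnNge h.
Qed.

Lemma rval_rnd_close x : (0 < n)%N -> `|x| < n%:R ^+ 2 ->
  `|x - rval (rnd x)| <= n%:R^-1.
Proof.
move=> n0 xn; have n0' : 0 < n%:R :> R by rewrite ltr0n.
have y0 : 0 <= n%:R * `|x| by rewrite mulr_ge0 ?ler0n.
have /andP[h1 h2] := truncn_itv y0.
have h : (Num.truncn (n%:R * `|x|) < (n ^ 3).+1)%N.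
  rewrite ltnS -(ler_nat R); apply: le_trans h1 _.
  by rewrite natrX [leRHS]exprS ler_wpM2l ?ler0n // ltW.
rewrite /rval /= inordK //; set k := Num.truncn _ in h1 h2 h *.
have -> : x - (-1) ^+ (x < 0)%R * (k%:R / n%:R) =
    (-1) ^+ (x < 0)%R * (`|x| - k%:R / n%:R).
  rewrite mulrBr; congr (_ - _); case: ltP => x0.
    by rewrite expr1 mulN1r ltr0_norm ?opprK.
  by rewrite expr0 mul1r ger0_norm.
rewrite normrM normrX normrN1 expr1n mul1r.
have -> : `|x| - k%:R / n%:R = (n%:R * `|x| - k%:R) / n%:R by field; rewrite gt_eqF.
rewrite normrM [X in _ * X]ger0_norm ?invr_ge0 ?ler0n // ler_piMl ?invr_ge0 ?ler0n //.
rewrite ger0_norm ?subr_ge0 // lerBlDr addrC natr1; exact: ltW.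
Qed.

Lemma measurable_rnd (v : rtype) : measurable (rnd @^-1` [set v]).
Proof.
pose y (x : R) := n%:R * `|x|.
have my : measurable_fun setT y.
  by apply: measurable_funM => //; exact: measurable_cst.
have mk (Q : pred nat) : measurable [set x : R | Q (Num.truncn (y x))].
  have -> : [set x : R | Q (Num.truncn (y x))] =
      \bigcup_(k in [set k | Q k]) (y @^-1` `[k%:R, k.+1%:R[).
    have y0 x : 0 <= y x by rewrite mulr_ge0 ?ler0n.
    apply/seteqP; split => [x /= Qx|x [k /= Qk]].
      exists (Num.truncn (y x)) => //=.
      by rewrite in_itv /= truncn_itv.
    by rewrite in_itv /= => /truncn_def ->.
  apply: bigcup_measurable => k _.
  by rewrite -[X in measurable X]setTI; exact: my.
have -> : rnd @^-1` [set v] = [set x | (x < 0) = v.1] `&`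
    [set x : R | (fun k => inord k == v.2) (Num.truncn (y x))].
  apply/seteqP; split => [x /= <-|x /= [h1 /eqP h2]] //=.
  by rewrite /rnd -/(y x) h1 h2; case: (v).
apply: measurableI; last exact: (mk (fun k => inord k == v.2)).
have [v1|v1] := boolP v.1.
  have -> : [set x : R | (x < 0) = true] = `]-oo, 0[%classic.
    by apply/seteqP; split => x /=; rewrite in_itv.
  exact: measurable_itv.
have -> : [set x : R | (x < 0) = false] = `[0, +oo[%classic.
  apply/seteqP; split => x /=; rewrite in_itv /= andbT leNgt.
    by move->.
  by move/negbTE.
exact: measurable_itv.
Qed.

Definition ctype := (rtype * rtype)%type.

Definition cnd (z : R * R) : ctype := (rnd z.1, rnd z.2).

Definition cval (v : ctype) : R[i] := Complex (rval v.1) (rval v.2).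

Definition cval0 : ctype := ((false, ord0), (false, ord0)).

Lemma cval_cval0 : cval cval0 = 0.
Proof. by rewrite /cval /rval /= !mul0r mulr0. Qed.

Lemma measurable_cnd (v : ctype) : measurable (cnd @^-1` [set v]).
Proof.
have -> : cnd @^-1` [set v] = fst @^-1` (rnd @^-1` [set v.1]) `&`
    snd @^-1` (rnd @^-1` [set v.2]).
  apply/seteqP; split => [z /= <-|z /= [h1 h2]] //.
  by rewrite /cnd h1 h2; case: (v).
apply: measurableI.
  rewrite -[X in measurable X]setTI.
  by apply: measurable_fst => //; exact: measurable_rnd.
rewrite -[X in measurable X]setTI.
by apply: measurable_snd => //; exact: measurable_rnd.
Qed.

Lemma normc2_cval_le (z : R * R) :
  normc (cval (cnd z)) ^+ 2 <= z.1 ^+ 2 + z.2 ^+ 2.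
Proof.
have sqr_le (x : R) : rval (rnd x) ^+ 2 <= x ^+ 2.
  rewrite -[leLHS]real_normK ?num_real // -[leRHS]real_normK ?num_real //.
  by rewrite lerXn2r ?nnegrE ?rval_rnd_le.
by rewrite normcE2 lerD // sqr_le.
Qed.

Lemma normc_cval_close (z : R * R) : (0 < n)%N ->
  z.1 ^+ 2 + z.2 ^+ 2 < n%:R ^+ 4 ->
  normc (Complex z.1 z.2 - cval (cnd z)) <= 2 / n%:R.
Proof.
move=> n0 zn; apply: le_trans (normc_le_ReIm _) _ => /=.
have lt2 (x y : R) : x ^+ 2 + y ^+ 2 < n%:R ^+ 4 -> `|x| < n%:R ^+ 2.
  move=> h; rewrite -(@ltr_pXn2r _ 2) ?nnegrE ?exprn_ge0 ?ler0n //.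
  rewrite -exprM real_normK ?num_real //; apply: le_lt_trans h.
  by rewrite lerDl sqr_ge0.
have -> : 2 / n%:R = n%:R^-1 + n%:R^-1 :> R by ring.
apply: lerD; apply: rval_rnd_close => //; first exact: lt2 zn.
by apply: (@lt2 z.2 z.1); rewrite addrC.
Qed.

End rounding.

Section finite_valued.
Context (R : realType) (d : measure_display) (T : measurableType d).
Variables (P : probability T R) (V : finType) (Y : T -> V).
Hypothesis mY : forall v, measurable (Y @^-1` [set v]).

Definition fin_law (v : V) : R := fine (P (Y @^-1` [set v])).

Lemma fin_lawE v : P (Y @^-1` [set v]) = (fin_law v)%:E.
Proof. by rewrite /fin_law fineK // fin_num_measure. Qed.

Lemma fin_law_ge0 v : 0 <= fin_law v.
Proof. by rewrite fine_ge0. Qed.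

Lemma fin_valuedE (g : V -> R) w :
  g (Y w) = \sum_v g v * \1_(Y @^-1` [set v]) w.
Proof.
rewrite (bigD1 (Y w)) //= indicE mem_set // mulr1 big1 ?addr0 // => v vw.
by rewrite indicE memNset ?mulr0 //=; apply/eqP; rewrite eq_sym.
Qed.

Lemma measurable_fin_valued (g : V -> R) : measurable_fun setT (g \o Y).
Proof.
have -> : g \o Y = fun w => \sum_v g v * \1_(Y @^-1` [set v]) w.
  by apply/funext => w; exact: fin_valuedE.
by apply: measurable_sum => v; apply: measurable_funM.
Qed.

Lemma integral_fin_valued (g : V -> R) :
  (\int[P]_w (g (Y w))%:E)%E = (\sum_v fin_law v * g v)%:E.
Proof.
under eq_integral do rewrite fin_valuedE -sumEFin.
have iv v := integrable_indic P (mY v).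
rewrite integral_sum //; last by move=> v; under eq_fun do rewrite EFinM; exact: integrableZl.
rewrite -sumEFin; apply: eq_bigr => v _.
under eq_integral do rewrite EFinM.
rewrite integralZl // integral_indic // setIT.
by rewrite [X in (_ * X)%E]fin_lawE -EFinM mulrC.
Qed.

Lemma fin_law_sum1 : \sum_v fin_law v = 1.
Proof.
have := integral_fin_valued (fun=> 1).
rewrite integral_cst //= probability_setT mule1 => -[].
by under eq_bigr do rewrite mulr1.
Qed.

End finite_valued.

(** * Limits of the moments of a rounded standardized entry *)

Section standardized_entry.
Context (R : realType) (d : measure_display) (T : measurableType d).
Variable P : probability T R.

(** The type of values changes with [n], so the sums are pulled back to integrals over the common
    space [T], where dominated convergence applies. *)
Lemma fin_law_cvg (V : nat -> finType) (Y : forall n, T -> V n)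
    (g : forall n, V n -> R) (h b : T -> R) :
  (forall n v, measurable (Y n @^-1` [set v])) ->
  P.-integrable setT (EFin \o b) ->
  (forall n w, `|g n (Y n w)| <= b w) ->
  (forall w, (fun n => g n (Y n w)) @ \oo --> h w) ->
  (fun n => \sum_v fin_law P (Y n) v * g n v) @ \oo --> \int[P]_w h w.
Proof.
move=> mY ib gb gh.
have mg n : measurable_fun setT (fun w => g n (Y n w)).
  exact: (@measurable_fin_valued _ _ _ _ (Y n) (mY n)).
have mh : measurable_fun setT h.
  by apply: (measurable_fun_cvg (h := fun n w => g n (Y n w))).
have [||||ih _ H] := @dominated_convergence _ _ _ P setT measurableT
  (fun n w => (g n (Y n w))%:E) (EFin \o h) (EFin \o b) _ _ _ ib _.
- by move=> n; exact/measurable_EFinP.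
- exact/measurable_EFinP.
- by apply/aeW => w _; apply: cvg_EFin; [exact: nearW|exact: gh].
- by apply/aeW => w n _; rewrite /= lee_fin.
have hfin : (\int[P]_w (h w)%:E)%E = (\int[P]_w h w)%:E.
  by rewrite /Rintegral fineK // (integrable_fin_num measurableT ih).
have {}H : (fun n => (\sum_v fin_law P (Y n) v * g n v)%:E) @ \oo -->
    (\int[P]_w h w)%:E.
  rewrite -hfin; apply: cvg_trans H; apply: near_eq_cvg; apply: nearW => n.
  exact: (integral_fin_valued P (mY n) (g n)).
by have /fine_cvgP[] := H.
Qed.

Lemma rval_rnd_cvg (x : R) : (fun n => rval R (rnd n x)) @ \oo --> x.
Proof.
apply/cvgrPdist_le => e e0.
near=> n.
have n1 : `|x| < n%:R by near: n; exact: nbhs_infty_gtr.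
have n2 : e^-1 <= n%:R by near: n; exact: nbhs_infty_ger.
have n0 : (0 < n)%N by near: n; exact: nbhs_infty_gt.
apply: (le_trans (@rval_rnd_close R n x n0 _)).
  apply: lt_le_trans n1 _; rewrite -natrX ler_nat.
  by rewrite -[leqLHS]expn1 leq_pexp2l.
by rewrite -[leRHS]invrK lef_pV2 ?posrE ?invr_gt0 ?ltr0n.
Unshelve. all: by end_near. Qed.

Variable X : T -> R * R.
Hypotheses (mX : measurable_fun setT X) (sX : standardized P X).
Let x1 w := (X w).1.
Let x2 w := (X w).2.
Let b w := x1 w ^+ 2 + x2 w ^+ 2.

Let mx1 : measurable_fun setT x1.
Proof. exact: (measurableT_comp measurable_fst mX). Qed.

Let mx2 : measurable_fun setT x2.
Proof. exact: (measurableT_comp measurable_snd mX). Qed.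

Let mb : measurable_fun setT b.
Proof. by apply: measurable_funD; exact: measurable_funX. Qed.

Lemma standardized_sqr : (\int[P]_w (b w)%:E)%E = 1%E.
Proof.
have [E1 E2 <-] := sX; rewrite /variance covariance.unlock E1 E2 /= expectation.unlock.
have sqrE (y : T -> R) : (\int[P]_w (((y \- cst 0) * (y \- cst 0))%R w)%:E)%E =
    (\int[P]_w (y w ^+ 2)%:E)%E.
  by apply: eq_integral => w _; rewrite -[LHS]/(((y w - 0) * (y w - 0))%:E) subr0 expr2.
rewrite !sqrE.
rewrite -ge0_integralD //; last 4 first.
- by move=> w _; rewrite lee_fin sqr_ge0.
- by apply/measurable_EFinP; apply: measurable_funX.
- by move=> w _; rewrite lee_fin sqr_ge0.
- by apply/measurable_EFinP; apply: measurable_funX.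
Qed.

Lemma standardized_integrable : P.-integrable setT (EFin \o b).
Proof.
apply/integrableP; split; first exact/measurable_EFinP.
under eq_integral do rewrite gee0_abs ?lee_fin ?addr_ge0 ?sqr_ge0 //.
by rewrite standardized_sqr ltry.
Qed.

Definition law n (v : ctype n) : R := fin_law P (@cnd R n \o X) v.

Lemma measurable_cnd_entry n v : measurable ((@cnd R n \o X) @^-1` [set v]).
Proof.
by rewrite comp_preimage -[X in measurable X]setTI; apply: mX => //; exact: measurable_cnd.
Qed.

Lemma law_var_le1 n : \sum_(v : ctype n) law v * normc (cval R v) ^+ 2 <= 1.
Proof.
rewrite -lee_fin -(integral_fin_valued P (@measurable_cnd_entry n)).
rewrite -[leRHS]standardized_sqr; apply: ge0_le_integral => //.
- by move=> w _; rewrite lee_fin sqr_ge0.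
- apply/measurable_EFinP.
  exact: (measurable_fin_valued (@measurable_cnd_entry n) (fun v => normc (cval R v) ^+ 2)).
- exact/measurable_EFinP.
- by move=> w _; rewrite lee_fin; exact: normc2_cval_le.
Qed.

(** Chebyshev at level [n^2], chosen so that a union over [n^2] positions still has probability at
    most [n^-2]. *)
Lemma law_tail n : (0 < n)%N ->
  (P [set w | (n%:R ^+ 4 <= b w)%R] <= ((n%:R ^+ 4)^-1)%:E)%E.
Proof.
move=> n0; have n4 : 0 < n%:R ^+ 4 :> R by rewrite exprn_gt0 ?ltr0n.
set A := [set w | _].
have mA : measurable A.
  rewrite (_ : A = b @^-1` `[n%:R ^+ 4, +oo[).
    by rewrite -[X in measurable X]setTI; apply: mb => //; exact: measurable_itv.
  by apply/seteqP; split => w; rewrite /A /= in_itv /= andbT.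
have : (\int[P]_w (n%:R ^+ 4 * \1_A w)%:E <= 1)%E.
  rewrite -standardized_sqr; apply: ge0_le_integral => //.
  - by apply/measurable_EFinP; apply: measurable_funM => //; exact: measurable_indic.
  - exact/measurable_EFinP.
  move=> w _; rewrite lee_fin indicE; case: (boolP (w \in A)) => [|_].
    by rewrite inE mulr1.
  by rewrite mulr0 addr_ge0 ?sqr_ge0.
under eq_integral do rewrite EFinM.
rewrite ge0_integralZl ?lee_fin ?(ltW n4) //; last first.
  by apply/measurable_EFinP; exact: measurable_indic.
rewrite integral_indic // setIT.
have PA : P A = (fine (P A))%:E by rewrite fineK // fin_num_measure.
rewrite [X in (_ * X <= _)%E]PA [X in _ -> (X <= _)%E]PA.
by rewrite -EFinM !lee_fin -ler_pdivlMl // mulr1.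
Qed.

Let b_ge0 w : 0 <= b w. Proof. by rewrite addr_ge0 ?sqr_ge0. Qed.

Let b1_integrable : P.-integrable setT (EFin \o (fun w => 1 + b w)).
Proof.
have -> : EFin \o (fun w => 1 + b w) = (cst 1%E \+ (EFin \o b))%E.
  by apply/funext => w; rewrite /= EFinD.
apply: integrableD => //; last exact: standardized_integrable.
exact: finite_measure_integrable_cst.
Qed.

Let abs_le (y z : R) : `|y| <= `|z| -> `|y| <= 1 + z ^+ 2.
Proof.
move=> yz; apply: le_trans yz _.
by have := sqr_ge0 (1 - `|z|); rewrite sqrrB real_normK ?num_real //;
  have := normr_ge0 z; lra.
Qed.

Let law_cvg (g : forall n, ctype n -> R) (h bd : T -> R) :
  P.-integrable setT (EFin \o bd) ->
  (forall n w, `|g n (cnd n (X w))| <= bd w) ->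
  (forall w, (fun n => g n (cnd n (X w))) @ \oo --> h w) ->
  (fun n => \sum_(v : ctype n) law v * g n v) @ \oo --> \int[P]_w h w.
Proof.
exact: (@fin_law_cvg (fun n => ctype n : finType) (fun n => @cnd R n \o X) g h bd
  measurable_cnd_entry).
Qed.

Let law_mean1 : (fun n => \sum_(v : ctype n) law v * rval R v.1) @ \oo --> (0 : R).
Proof.
rewrite [X in _ --> X](_ : _ = \int[P]_w x1 w); last first.
  by have [E1 _ _] := sX; rewrite expectation.unlock in E1; rewrite /Rintegral E1.
apply: (law_cvg (g := fun n (v : ctype n) => rval R v.1) b1_integrable).
- move=> n w /=; rewrite /b addrA.
  apply: (le_trans (abs_le (rval_rnd_le n (x1 w)))).
  by rewrite lerDl sqr_ge0.
- by move=> w; exact: rval_rnd_cvg.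
Qed.

Let law_mean2 : (fun n => \sum_(v : ctype n) law v * rval R v.2) @ \oo --> (0 : R).
Proof.
rewrite [X in _ --> X](_ : _ = \int[P]_w x2 w); last first.
  by have [_ E1 _] := sX; rewrite expectation.unlock in E1; rewrite /Rintegral E1.
apply: (law_cvg (g := fun n (v : ctype n) => rval R v.2) b1_integrable).
- move=> n w /=; rewrite /b [_ + x2 w ^+ 2]addrC addrA.
  apply: (le_trans (abs_le (rval_rnd_le n (x2 w)))).
  by rewrite lerDl sqr_ge0.
- by move=> w; exact: rval_rnd_cvg.
Qed.

Let law_var : (fun n => \sum_(v : ctype n) law v * normc (cval R v) ^+ 2) @ \oo -->
  (1 : R).
Proof.
rewrite [X in _ --> X](_ : _ = \int[P]_w b w); last by rewrite /Rintegral standardized_sqr.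
apply: (law_cvg (g := fun n (v : ctype n) => normc (cval R v) ^+ 2)
  standardized_integrable).
- by move=> n w; rewrite ger0_norm ?sqr_ge0 //; exact: normc2_cval_le.
- move=> w; under eq_fun do rewrite normcE2.
  by apply: cvgD; rewrite [X in _ --> X]expr2; under eq_fun do rewrite expr2;
    apply: cvgM; exact: rval_rnd_cvg.
Qed.

(** At each sample point the minimum tends to 0 while the product stays below the integrable [b]; a
    finite second moment is thus enough. *)
Let law_lindeberg : (fun n => \sum_(v : ctype n) law v * (normc (cval R v) ^+ 2 *
    Num.min 1 ((Num.sqrt n%:R)^-1 * normc (cval R v)))) @ \oo --> (0 : R).
Proof.
rewrite [X in _ --> X](_ : _ = \int[P]_w 0); last by rewrite Rintegral_cst // mul0r.
have min_ge0 n (y : R) : 0 <= y -> 0 <= Num.min 1 ((Num.sqrt n%:R)^-1 * y).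
  by move=> y0; rewrite le_min ler01 mulr_ge0 ?invr_ge0 ?sqrtr_ge0.
apply: (law_cvg (g := fun n (v : ctype n) => normc (cval R v) ^+ 2 *
    Num.min 1 ((Num.sqrt n%:R)^-1 * normc (cval R v))) standardized_integrable).
- move=> n w; rewrite ger0_norm ?mulr_ge0 ?sqr_ge0 ?min_ge0 ?normc_ge0 //.
  apply: le_trans (normc2_cval_le n (X w)).
  by rewrite ler_piMr ?sqr_ge0 // ge_min lexx.
- move=> w; apply/cvgrPdist_le => e e0; near=> n.
  rewrite sub0r normrN ger0_norm ?mulr_ge0 ?sqr_ge0 ?min_ge0 ?normc_ge0 //.
  have n0 : 0 < n%:R :> R by near: n; exact: nbhs_infty_gtr.
  have hn : (b w * Num.sqrt (b w) / e) ^+ 2 <= n%:R.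
    by near: n; exact: nbhs_infty_ger.
  have vb := normc2_cval_le n (X w).
  set y := normc _ in vb *; have y0 : 0 <= y by exact: normc_ge0.
  have yb : y <= Num.sqrt (b w) by rewrite -[y]ger0_norm // -sqrtr_sqr ler_wsqrtr.
  apply: (@le_trans _ _ (b w * ((Num.sqrt n%:R)^-1 * Num.sqrt (b w)))).
    apply: ler_pM; rewrite ?sqr_ge0 ?min_ge0 //.
    rewrite ge_min; apply/orP; right.
    by rewrite ler_wpM2l ?invr_ge0 ?sqrtr_ge0.
  have sn : 0 < Num.sqrt n%:R :> R by rewrite sqrtr_gt0.
  rewrite mulrCA [leLHS]mulrC ler_pdivrMr // [leRHS]mulrC -ler_pdivrMr //.
  rewrite -(@ler_pXn2r _ 2) ?nnegrE ?sqrtr_ge0 ?mulr_ge0 ?invr_ge0 ?(ltW e0) //.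
  by rewrite sqr_sqrtr ?(ltW n0) //; exact: ltW.
Unshelve. all: by end_near. Qed.

Lemma law_limits (e : R) : 0 < e -> exists n0, forall n, (n0 <= n)%N ->
  [/\ normc (\sum_(v : ctype n) (law v)%:C%C * cval R v) <= e,
      1 - e <= \sum_(v : ctype n) law v * normc (cval R v) ^+ 2 &
      \sum_(v : ctype n) law v * (normc (cval R v) ^+ 2 *
         Num.min 1 ((Num.sqrt n%:R)^-1 * normc (cval R v))) <= e].
Proof.
move=> e0; have e2 : 0 < e / 2 by rewrite divr_gt0.
have [n1 _ h1] := (cvgrPdist_le _ _).1 law_mean1 _ e2.
have [n2 _ h2] := (cvgrPdist_le _ _).1 law_mean2 _ e2.
have [n3 _ h3] := (cvgrPdist_le _ _).1 law_var _ e0.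
have [n4 _ h4] := (cvgrPdist_le _ _).1 law_lindeberg _ e0.
exists (maxn (maxn n1 n2) (maxn n3 n4)) => n.
rewrite !geq_max => /andP[/andP[/h1 {}h1 /h2 {}h2] /andP[/h3 {}h3 /h4 {}h4]].
rewrite /= !sub0r !normrN in h1 h2 h4.
have law0 (v : ctype n) : 0 <= law v by exact: fin_law_ge0.
split.
- have lawE (v : ctype n) : (law v)%:C%C * cval R v =
      Complex (law v * rval R v.1) (law v * rval R v.2).
    by apply/eqP; rewrite eq_complex /= !mul0r subr0 addr0 !eqxx.
  apply: le_trans (normc_le_ReIm _) _; rewrite Re_sum Im_sum.
  under eq_bigr do rewrite lawE; under [X in _ + `|X|]eq_bigr do rewrite lawE.
  rewrite /=; lra.
- by move: h3; rewrite ler_norml /= => /andP[_]; lra.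
- by apply: le_trans (ler_norm _) h4.
Qed.

End standardized_entry.

(** * Unfolding Hermitian tensors *)

Section unfolding.
Variables (R : realType) (N : nat) (I : tshape N).
Local Notation C := R[i].
Local Notation n := #|midx I|.
Implicit Types A B : tensor R I.

Lemma card_midx : #|midx I| = vol I.
Proof.
rewrite /vol /midx card_dep_ffun /=.
rewrite /image_mem -big_enum /= enumT.
by elim: (Finite.enum _) => [|k s IH] /=; rewrite ?big_nil ?big_cons ?card_ord ?IH.
Qed.

Definition unfold A : 'M[C]_n := \matrix_(i, j) A (enum_val i) (enum_val j).

Lemma sum_enum_val (F : midx I -> C) : \sum_i F i = \sum_(k < n) F (enum_val k).
Proof. by rewrite (reindex (@enum_val (midx I) predT)) //=; exact/onW_bij/enum_val_bij. Qed.

Lemma unfold_einstein A B : unfold (einstein A B) = unfold A *m unfold B.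
Proof.
apply/matrixP => i j; rewrite !mxE /einstein sum_enum_val.
by apply: eq_bigr => k _; rewrite !mxE.
Qed.

Lemma unfold_hconj A : unfold (hconj A) = (unfold A)^t*.
Proof. by apply/matrixP => i j; rewrite !mxE. Qed.

Lemma unfold_id : unfold (@tensor_id R N I) = 1%:M.
Proof.
by apply/matrixP => i j; rewrite !mxE /tensor_id (inj_eq enum_val_inj).
Qed.

Lemma unfold_hermitian A : hermitian_tensor A -> (unfold A)^t* = unfold A.
Proof. by move=> hA; rewrite -unfold_hconj -hA. Qed.

Lemma size_tensor_eigenvalues A : size (tensor_eigenvalues A) = n.
Proof. by rewrite size_map -cardE. Qed.

(** The chosen decomposition is genuine by [hermitian_spectral], so the default value of [xget]
    never occurs. The right-hand side does not mention the choice. *)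
Lemma stieltjes_tensor_eigenvalues A (z : C) : hermitian_tensor A ->
  0 < complex.Im z ->
  stieltjes (tensor_eigenvalues A) z = n%:R^-1 * \tr (resolvent (unfold A) z).
Proof.
move=> hA z0; rewrite /stieltjes size_tensor_eigenvalues; congr (_ * _).
have [U [[UU' U'U] [Dd Dr] AE]] : exists U,
    spectral_decomposition A U (spectral_part A).
  have [U [D h]] := hermitian_spectral hA.
  by apply: (@xgetPex _ (fun _ _ => 0)
    [set D | exists U, spectral_decomposition A U D]); exists D, U.
set D := spectral_part A in Dd Dr AE *.
pose lam : 'rV[C]_n := \row_k (complex.Re (D (enum_val k) (enum_val k)))%:C%C.
have DE : unfold D = diag_mx lam.
  apply/matrixP => i j; rewrite !mxE; have [<-|ij] := eqVneq i j.
    rewrite mulr1n; move: (Dr (enum_val i)).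
    by case: (D _ _) => a b /= ->.
  by rewrite mulr0n Dd // (inj_eq enum_val_inj).
pose Q := (unfold U)^t*.
have Q' : Q^t* = unfold U by rewrite /Q trmxCK.
have [|||k|_ ->] := @resolvent_diag _ _ (unfold A) Q lam z.
- by rewrite Q' /Q -unfold_hconj -unfold_einstein U'U unfold_id.
- by rewrite Q' /Q -unfold_hconj -unfold_einstein UU' unfold_id.
- by rewrite Q' /Q -unfold_hconj -DE -!unfold_einstein -AE.
- by rewrite mxE; apply: subr_neq0 z0 erefl _.
rewrite -mulmxA mxtrace_mulC -mulmxA Q' /Q -unfold_hconj -unfold_einstein U'U.
rewrite unfold_id mulmx1 mxtrace_diag big_map big_enum /= sum_enum_val.
by apply: eq_bigr => k _; rewrite !mxE.
Qed.

End unfolding.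

Section discretized_family.
Context (R : realType) (d : measure_display) (T : measurableType d).
Variables (P : probability T R) (n : nat).
Variables (J : finType) (S : {set J}) (X : J -> T -> R * R).
Hypothesis mX : forall q, measurable_fun setT (X q).

(** Positions outside [S] are frozen at the value 0 and carry a Dirac law, so the weight can be a
    product over all positions although independence is assumed within [S]. *)
Definition discretized (w : T) : {ffun J -> ctype n} :=
  [ffun q => if q \in S then cnd n (X q w) else cval0 n].

Definition discretized_law (q : J) (v : ctype n) : R :=
  if q \in S then law P (X q) v else (v == cval0 n)%:R.

Lemma discretized_law_ge0 q v : 0 <= discretized_law q v.
Proof. by rewrite /discretized_law; case: ifP => _; rewrite ?fin_law_ge0. Qed.

Lemma discretized_law_sum1 q : \sum_v discretized_law q v = 1.
Proof.
rewrite /discretized_law; case: (q \in S).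
  by apply: fin_law_sum1 => v; exact: measurable_cnd_entry.
rewrite (bigD1 (cval0 n)) // eqxx big1 => [|v /negbTE -> //]; exact: addr0.
Qed.

Lemma measurable_discretized y : measurable (discretized @^-1` [set y]).
Proof.
have -> : discretized @^-1` [set y] =
    \bigcap_(q in [set: J]) [set w | discretized w q = y q].
  apply/seteqP; split => [w /= <- //|w h].
  by apply/ffunP => q; exact: (h q I).
apply: fin_bigcap_measurable => [|q _]; first exact: finite_finset.
case qS: (q \in S); last first.
  have [yq|yq] := eqVneq (y q) (cval0 n).
    rewrite (_ : mkset _ = setT) //; apply/seteqP; split => // w _ /=.
    by rewrite ffunE qS yq.
  rewrite (_ : mkset _ = set0) //; apply/seteqP; split => // w /=.
  by rewrite ffunE qS => /esym/eqP; rewrite (negbTE yq).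
rewrite (_ : mkset _ = (@cnd R n \o X q) @^-1` [set y q]).
  exact: measurable_cnd_entry.
by apply/seteqP; split => w /=; rewrite ffunE qS.
Qed.

(** Both sides vanish if [y] is nonzero somewhere outside [S]. Otherwise the fibre over [y] is an
    intersection over [S], to which the product rule applies. *)
Lemma fin_law_discretized y : mutually_independent P S X ->
  fin_law P discretized y = pweight discretized_law y.
Proof.
move=> indep; rewrite /fin_law /pweight.
have [yS|] := boolP [forall q, (q \notin S) ==> (y q == cval0 n)]; last first.
  move=> /forallPn[q]; rewrite negb_imply => /andP[qS yq].
  rewrite (bigD1 q) //= {1}/discretized_law (negbTE qS) (negbTE yq) mul0r.
  rewrite (_ : _ @^-1` _ = set0) ?measure0 //; apply/seteqP; split => // w /= wy.
  by move: yq; rewrite -wy ffunE (negbTE qS) eqxx.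
have {}yS q : q \notin S -> y q = cval0 n.
  by move=> qS; apply/eqP; have /forallP/(_ q) := yS; rewrite qS.
have -> : discretized @^-1` [set y] =
    \bigcap_(q in [set` S]) (X q @^-1` (@cnd R n @^-1` [set y q])).
  apply/seteqP; split => [w /= <- q /= qS|w h]; first by rewrite ffunE qS.
  apply/ffunP => q; rewrite ffunE; case: ifPn => [qS|/yS -> //].
  exact: h.
rewrite indep //=; last by move=> q; exact: measurable_cnd.
rewrite [RHS](bigID (mem S)) /= [X in _ * X]big1 ?mulr1 => [|q qS].
  by apply: eq_bigr => q qS; rewrite /discretized_law qS.
by rewrite /discretized_law (negbTE qS) (yS _ qS) eqxx.
Qed.

Lemma discretized_event (Q : pred {ffun J -> ctype n}) :
  mutually_independent P S X ->
  measurable [set w | Q (discretized w)] /\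
  P [set w | Q (discretized w)] = (\sum_(y | Q y) pweight discretized_law y)%:E.
Proof.
move=> indep.
have mQ : measurable [set w | Q (discretized w)].
  rewrite (_ : mkset _ = \bigcup_(y in [set` Q]) (discretized @^-1` [set y])).
    apply: fin_bigcup_measurable => [|y _]; first exact: finite_finset.
    exact: measurable_discretized.
  by apply/seteqP; split => [w Qw|w [y /= Qy wy]]; [exists (discretized w)|rewrite /= wy].
split=> //; have := integral_fin_valued P measurable_discretized (fun y => (Q y)%:R).
rewrite (eq_integral (fun w => (\1_[set w | Q (discretized w)] w)%:E)) => [|w _].
  rewrite integral_indic // setIT => ->; congr EFin; rewrite [RHS]big_mkcond.
  apply: eq_bigr => y _; rewrite fin_law_discretized //.
  by case: (Q y); rewrite ?mulr1 ?mulr0.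
by rewrite indicE mem_setE.
Qed.

End discretized_family.

Section families.
Context (R : realType) (d : measure_display) (T : measurableType d).
Variable P : probability T R.

Lemma mutually_independent_bij (J J' : finType) (S : {set J}) (S' : {set J'})
    (X : J -> T -> R * R) (f : J' -> J) :
  bijective f -> (forall q, (f q \in S) = (q \in S')) ->
  mutually_independent P S X -> mutually_independent P S' (X \o f).
Proof.
move=> [g fK gK] fS indep K B KS mB.
have finj := can_inj fK.
have -> : \prod_(q in K) fine (P ((X \o f) q @^-1` B q)) =
    \prod_(p in (f @: K)%SET) fine (P (X p @^-1` (B \o g) p)).
  rewrite big_imset /=; last by move=> q q' _ _; exact: finj.
  by apply: eq_bigr => q _; rewrite fK.
rewrite -indep => [||p]; last exact: mB; last first.
  by apply/fintype.subsetP => _ /imsetP[q qK ->]; rewrite fS (fintype.subsetP KS).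
congr (P _); apply/seteqP; split => w h q /=.
  by move=> /imsetP[q' /(h q') hq ->]; rewrite fK.
by move=> qK; have := h (f q); rewrite /= fK; apply; exact: imset_f.
Qed.

Lemma finite_subadditivity (J : eqType) (r : seq J) (B : J -> set T) :
  (forall j, measurable (B j)) ->
  measurable [set w | exists2 j, j \in r & B j w] /\
  (P [set w | exists2 j, j \in r & B j w] <= \sum_(j <- r) P (B j))%E.
Proof.
move=> mB; elim: r => [|j r [IHm IH]].
  rewrite big_nil (_ : mkset _ = set0) ?measure0 //.
  by apply/seteqP; split => // w [].
rewrite big_cons (_ : mkset _ = B j `|` [set w | exists2 j, j \in r & B j w]).
  split; first exact: measurableU.
  by apply: (le_trans (measureU2 _ _ _)) => //; exact: leeD2l.
apply/seteqP; split => w /=.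
  by move=> [k]; rewrite inE => /predU1P[->|kr Bk]; [left|right; exists k].
move=> [Bj|[k kr Bk]]; first by exists j; rewrite ?inE ?eqxx.
by exists k; rewrite // inE kr orbT.
Qed.

Lemma eq_law (X Y : T -> R * R) (n : nat) : identically_distributed P X Y ->
  @law _ _ _ P X n =1 @law _ _ _ P Y n.
Proof.
by move=> XY v; exact: (congr1 fine (XY _ (measurable_cnd v))).
Qed.

End families.

Section fixed_shape.
Context (R : realType) (N : nat) (d : measure_display) (T : measurableType d).
Variable P : probability T R.
Variables (A : forall I : tshape N, T -> tensor R I).
Variables (S : forall I : tshape N, {set midx I * midx I}).
Hypothesis hA : iid_hermitian_tensors P A S.

(** The threshold is uniform in the shape: it is computed at one off-diagonal position of some shape
    and carried to all others by equality of laws. If there is no such position, the claim is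
    vacuous. *)
Lemma offdiag_law_limits (e : R) : 0 < e -> exists n0, forall n, (n0 <= n)%N ->
  forall I (q : midx I * midx I), q \in S I -> q.1 != q.2 ->
  let law := @law _ _ _ P (entry (@A I) q.1 q.2) n in
  [/\ normc (\sum_v (law v)%:C%C * cval R v) <= e,
      1 - e <= \sum_v law v * normc (cval R v) ^+ 2 &
      \sum_v law v * (normc (cval R v) ^+ 2 *
         Num.min 1 (rn R n * normc (cval R v))) <= e].
Proof.
move=> e0.
have [[I0 [q0 [q0S q0d]]]|noq] := pselect (exists I0 (q0 : midx I0 * midx I0),
    q0 \in S I0 /\ q0.1 != q0.2); last first.
  by exists 0%N => n _ I q qS qd; case: noq; exists I, q.
have [n0 h] := law_limits (entry_measurable hA q0.1 q0.2)
  (entry_standardized hA q0.1 q0.2) e0.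
exists n0 => n nn0 I q qS qd L.
have LE : L = @law _ _ _ P (entry (@A I0) q0.1 q0.2) n.
  apply/funext; apply: eq_law.
  exact: (entry_offdiag_law hA).
by rewrite LE; exact: h.
Qed.

Section shape.
Variable I : tshape N.
Local Notation n := #|midx I|.
Local Notation J := ('I_n * 'I_n)%type.

Definition hset : {set J} := [set q | (enum_val q.1, enum_val q.2) \in S I].

Definition hentry (q : J) : T -> R * R := entry (@A I) (enum_val q.1) (enum_val q.2).

Lemma hset_diag i : (i, i) \in hset.
Proof. by rewrite inE (half_S hA I).1. Qed.

Lemma hset_off i j : i != j -> ((i, j) \in hset) != ((j, i) \in hset).
Proof. by move=> ij; rewrite !inE (half_S hA I).2 // (inj_eq enum_val_inj). Qed.

Lemma hentry_independent : mutually_independent P hset hentry.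
Proof.
pose f (q : J) := (enum_val q.1, enum_val q.2) : midx I * midx I.
have bf : bijective f.
  exists (fun p => (enum_rank p.1, enum_rank p.2)) => [[i j]|[i j]].
    by rewrite /f /= !enum_valK.
  by rewrite /f /= !enum_rankK.
have fS q : (f q \in S I) = (q \in hset) by rewrite !inE.
exact: (mutually_independent_bij bf fS (@entry_independent _ _ _ _ _ _ _ hA I)).
Qed.

Lemma unfold_hentry w i j : unfold (@A I w) i j =
  cnv hset i j (Complex (hentry (pos hset i j) w).1 (hentry (pos hset i j) w).2).
Proof.
have hE (k l : 'I_n) : Complex (hentry (k, l) w).1 (hentry (k, l) w).2 =
    unfold (@A I w) k l.
  by rewrite mxE /hentry /entry /complex_pair /=; case: (@A I w _ _).
have hJ k l : unfold (@A I w) k l = Num.conj (unfold (@A I w) l k).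
  by have /matrixP/(_ k l) <- := unfold_hermitian (tensor_hermitian hA I w); rewrite !mxE.
rewrite /cnv /pos; have [<-|ij] := eqVneq i j.
  rewrite hset_diag hE; have := hJ i i.
  by case: (unfold _ i i) => a b [] /esym; rewrite /= => b0; congr Complex; lra.
by case: ((i, j) \in hset); rewrite hE /=; last exact: hJ.
Qed.

(* Off this event, [cnd] moves no entry by more than [2 / n]. *)
Definition tail_event : set T :=
  [set w | exists q : J, n%:R ^+ 4 <= (hentry q w).1 ^+ 2 + (hentry q w).2 ^+ 2].

Let mhentry q : measurable_fun setT (hentry q).
Proof. exact: (entry_measurable hA (enum_val q.1) (enum_val q.2)). Qed.

Let shentry q : standardized P (hentry q).
Proof. exact: (entry_standardized hA (enum_val q.1) (enum_val q.2)). Qed.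

Hypothesis n_gt0 : (0 < n)%N.

Lemma tail_event_probability :
  measurable tail_event /\ (P tail_event <= ((n%:R ^+ 2)^-1)%:E)%E.
Proof.
pose B q := [set w | n%:R ^+ 4 <= (hentry q w).1 ^+ 2 + (hentry q w).2 ^+ 2].
have mB q : measurable (B q).
  have mb : measurable_fun setT (fun w => (hentry q w).1 ^+ 2 + (hentry q w).2 ^+ 2).
    by apply: measurable_funD; apply: measurable_funX;
      apply: measurableT_comp (mhentry q); [exact: measurable_fst|exact: measurable_snd].
  rewrite (_ : B q = (fun w => (hentry q w).1 ^+ 2 + (hentry q w).2 ^+ 2) @^-1`
      `[n%:R ^+ 4, +oo[).
    by rewrite -[X in measurable X]setTI; apply: mb => //; exact: measurable_itv.
  by apply/seteqP; split => w; rewrite /B /= in_itv /= andbT.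
have [mt Pt] := finite_subadditivity P (enum {: J}) mB.
rewrite (_ : tail_event = [set w | exists2 q, q \in enum {: J} & B q w]); last first.
  by apply/seteqP; split => w [q]; exists q; rewrite ?mem_enum.
split=> //; apply: le_trans Pt _.
apply: (@le_trans _ _ (\sum_(q <- enum {: J}) ((n%:R ^+ 4)^-1)%:E)%E).
  apply: lee_sum => q _; apply: law_tail n_gt0; first exact: mhentry.
  exact: shentry.
rewrite big_enum /= sumEFin lee_fin sumr_const card_prod card_ord -[leLHS]mulr_natl natrM.
rewrite le_eqVlt; apply/orP; left; apply/eqP.
by field; rewrite pnatr_eq0 -lt0n.
Qed.

Local Notation Y := (discretized n hset hentry).
Local Notation H w := (unfold (tscale (Num.sqrt (vol I)%:R)^-1 (@A I w))).
Local Notation H' w := (hmat (@cval R n) hset (Y w)).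

Lemma scaled_hermitian w : hermitian_tensor (tscale (Num.sqrt (vol I)%:R)^-1 (@A I w)).
Proof.
apply/funext => i; apply/funext => j; rewrite /hconj /tscale rmorphM /=.
by rewrite conj_real_complex {1}(tensor_hermitian hA I w).
Qed.

Lemma normc_unfold_hmat w i j : ~ tail_event w ->
  normc (H w i j - H' w i j) <= rn R n * (2 / n%:R).
Proof.
move=> tw; rewrite !mxE /tscale -card_midx -/(rn R n).
have -> : @A I w (enum_val i) (enum_val j) = unfold (@A I w) i j by rewrite mxE.
rewrite unfold_hentry /uval ffunE (pos_in hset_diag hset_off).
rewrite -[real_complex _ _]/((rn R n)%:C%C) -mulrBr -cnvB.
rewrite normcM normc_real ger0_norm ?rn_ge0 //.
apply: ler_wpM2l; first exact: rn_ge0.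
apply: le_trans (normc_cnv_le _ _ _ _) _; apply: normc_cval_close => //.
by rewrite ltNge; apply/negP => h; apply: tw; exists (pos hset i j).
Qed.

Variables (z : R[i]) (eta : R).
Hypotheses (eta_gt0 : 0 < eta) (Imz : complex.Im z = eta).
Local Notation s w := (stieltjes (tensor_eigenvalues
  (tscale (Num.sqrt (vol I)%:R)^-1 (@A I w))) z).
Local Notation s' w := (stj (@cval R n) hset z (Y w)).

(** The [n^2] entries move by at most [rn * 2 / n] each, [2 n rn] in total; the normalized trace
    divides this by [n]. *)
Lemma stieltjes_stj w : ~ tail_event w ->
  normc (s w - s' w) <= 2 * rn R n / eta ^+ 2.
Proof.
move=> tw; rewrite stieltjes_tensor_eigenvalues ?Imz //; last exact: scaled_hermitian.
rewrite /stj -mulrBr normcM normc_natV ler_pdivrMl ?ltr0n //.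
apply: le_trans (mxtrace_resolvent_lip eta_gt0 Imz _ _) _.
- exact: hmat_hermitian hset_off _.
- exact: unfold_hermitian (scaled_hermitian w).
rewrite [leRHS]mulrA ler_wpM2r ?invr_ge0 ?exprn_ge0 ?(ltW eta_gt0) //.
apply: (@le_trans _ _ (\sum_(i < n) \sum_(j < n) (rn R n * (2 / n%:R)))).
  apply: ler_sum => i _; apply: ler_sum => j _.
  by rewrite -normcN opprB; exact: normc_unfold_hmat.
rewrite !sumr_const card_ord -[leLHS]mulr_natr -[X in X * _]mulr_natr.
rewrite le_eqVlt; apply/orP; left; apply/eqP.
by field; rewrite pnatr_eq0 -lt0n.
Qed.

Local Notation sc w := (self_consistency (tensor_eigenvalues
  (tscale (Num.sqrt (vol I)%:R)^-1 (@A I w))) z).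
Local Notation sc' w := (sc_defect (@cval R n) hset z (Y w)).

Lemma self_consistency_sc_defect w : ~ tail_event w ->
  normc (sc w - sc' w) <=
  2 * rn R n / eta ^+ 2 * (normc z + 2 * (1 + eta^-1)).
Proof.
move=> tw; have e1 : 0 <= eta^-1 by rewrite invr_ge0 ltW.
have -> : sc w - sc' w = (s w - s' w) * (z + s w + s' w).
  by rewrite /self_consistency /sc_defect; ring.
rewrite normcM; apply: ler_pM; rewrite ?normc_ge0 ?stieltjes_stj //.
apply: le_trans (le_normcD _ _) _; apply: le_trans (lerD (le_normcD _ _) (lexx _)) _.
have h1 : normc (s w) <= eta^-1.
  by move: Imz; case: (z) => a b /= ->; exact: normc_stieltjes.
have h2 : normc (s' w) <= 1 + eta^-1.
  by apply: normc_stj eta_gt0 Imz _ => //; exact: hset_off.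
by have := lerD h1 h2; lra.
Qed.

Definition bad_event (e : R) : set T :=
  tail_event `|` [set w | e < normc (sc' w)].

Lemma bad_event_probability (e' e dl : R) : 0 < e -> 0 < dl ->
  e' = e / (2 * (normc z + 2 * (1 + eta^-1))) ->
  20 * (1 + eta^-1) ^+ 4 * (dl + dl + dl + rn R n) +
    32 * (1 + eta^-1) ^+ 2 / n%:R <= e / 2 ->
  (forall q : midx I * midx I, q \in S I -> q.1 != q.2 ->
    let law := @law _ _ _ P (entry (@A I) q.1 q.2) n in
    [/\ normc (\sum_v (law v)%:C%C * cval R v) <= dl,
        1 - dl <= \sum_v law v * normc (cval R v) ^+ 2 &
        \sum_v law v * (normc (cval R v) ^+ 2 *
           Num.min 1 (rn R n * normc (cval R v))) <= dl]) ->
  measurable (bad_event e) /\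
  (P (bad_event e) <=
    ((1 + 2 ^+ 16 * (1 + eta^-1) ^+ 4 / e' ^+ 4) / n%:R ^+ 2)%:E)%E.
Proof.
move=> e0 dl0 e'E he hlaw.
have [mt Pt] := tail_event_probability.
have [mD PD] := discretized_event mhentry
  (fun y => e < normc (sc_defect (@cval R n) hset z y)) hentry_independent.
split; first exact: measurableU.
apply: (le_trans (measureU2 _ _ _)) => //.
rewrite mulrDl mul1r EFinD; apply: leeD => //.
rewrite [leLHS]PD lee_fin; set p := @discretized_law _ _ _ P n _ hset hentry.
have pE q : q \in hset -> p q = @law _ _ _ P (hentry q) n.
  by move=> qS; apply/funext => v; rewrite /p /discretized_law qS.
have hl q : q \in hset -> q.1 != q.2 ->
    [/\ normc (\sum_v (p q v)%:C%C * cval R v) <= dl,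
        1 - dl <= \sum_v p q v * normc (cval R v) ^+ 2 &
        \sum_v p q v * (normc (cval R v) ^+ 2 *
           Num.min 1 (rn R n * normc (cval R v))) <= dl].
  move=> qS qd; rewrite pE //; apply: (hlaw (enum_val q.1, enum_val q.2)).
    by move: qS; rewrite inE.
  by rewrite /= (inj_eq enum_val_inj).
have dl0' := ltW dl0.
apply: (@defect_probability _ _ _ p _ (cval0 n) hset n_gt0 _ _ _ hset_diag
  hset_off _ _ eta_gt0 Imz dl dl dl dl0' dl0' dl0' _ _ _ _ e e' e0 e'E he).
- exact: discretized_law_ge0.
- by move=> q; exact: discretized_law_sum1.
- exact: cval_cval0.
- by move=> q qS qd; have [] := hl q qS qd.
- by move=> q qS; rewrite pE //; exact: law_var_le1.
- by move=> q qS qd; have [] := hl q qS qd.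
- by move=> q qS qd; have [] := hl q qS qd.
Qed.

End shape.

End fixed_shape.

(** * Almost sure convergence along all shapes *)

Section shape_sums.
Variables (R : realType) (N : nat).

(** The exponent 3/2 is multiplicative in the dimensions, above 1 for convergence, and below 2 so
    that a factor [vol^(-1/2)] is left to make tails vanish. *)
Definition pow32 (k : nat) : R := (k%:R * Num.sqrt k%:R)^-1.

Lemma pow32_ge0 k : 0 <= pow32 k.
Proof. by rewrite invr_ge0 mulr_ge0 ?sqrtr_ge0. Qed.

(** Comparison with the integral of [x^(-3/2)]: consecutive values of [2 / sqrt] differ by at least
    the next term, since [(b - a) (a + b) = 1]. *)
Lemma sum_pow32 B : \sum_(i < B.+1) pow32 i.+1 <= 3 - 2 / Num.sqrt B.+1%:R.
Proof.
elim: B => [|B IH].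
  by rewrite big_ord_recl big_ord0 /pow32 /= sqrtr1; lra.
rewrite big_ord_recr /=; apply: le_trans (lerD IH (lexx _)) _.
set a := Num.sqrt B.+1%:R; set b := Num.sqrt B.+2%:R.
have a0 : 0 < a by rewrite sqrtr_gt0.
have b0 : 0 < b by rewrite sqrtr_gt0.
have ab : a <= b by rewrite ler_wsqrtr // ler_nat.
have a2 : a ^+ 2 = B.+1%:R by rewrite sqr_sqrtr.
have b2 : b ^+ 2 = a ^+ 2 + 1 by rewrite a2 sqr_sqrtr // natr1.
rewrite /pow32 -/b (_ : B.+2%:R = b ^+ 2); last by rewrite sqr_sqrtr.
suff : (b ^+ 2 * b)^-1 <= 2 / a - 2 / b by lra.
have -> : 2 / a - 2 / b = 2 / (a * b * (a + b)).
  have e : (b - a) * (a + b) = 1 by rewrite -[RHS](addrK (a ^+ 2)) [1 + _]addrC -b2; ring.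
  rewrite -[X in X / (a * b * _)]mulr1 -e; field.
  by rewrite !gt_eqF // addr_gt0.
rewrite -[leLHS]mul1r ler_pdivrMr ?mulr_gt0 ?exprn_gt0 //.
rewrite mulrAC ler_pdivlMr ?mulr_gt0 ?addr_gt0 // mul1r.
have h1 : a * b <= b * b by rewrite ler_wpM2r ?(ltW b0).
have h2 : a * b * (a + b) <= b * b * (b + b).
  by apply: ler_pM => //; rewrite ?mulr_ge0 ?addr_ge0 ?lerD ?(ltW a0) ?(ltW b0).
by apply: le_trans h2 _; rewrite expr2; lra.
Qed.

Lemma pow32_vol (I : tshape N) : pow32 (vol I) = \prod_(k < N) pow32 (I k).
Proof.
rewrite /vol; apply/esym; apply: (big_ind2 (fun (x : R) (k : nat) => x = pow32 k)) => //.
  by rewrite /pow32 sqrtr1 mulr1 invr1.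
move=> _ k _ l -> ->; rewrite /pow32 natrM sqrtrM //.
by rewrite -invfM; congr (_^-1); ring.
Qed.

(** The successor excludes zero dimensions, which would make the volume 0. *)
Definition box B (f : {ffun 'I_N -> 'I_B.+1}) : tshape N := [ffun k => (f k).+1].

Lemma sum_box_pow32 B : \sum_(f : {ffun 'I_N -> 'I_B.+1}) pow32 (vol (box f)) <= 3 ^+ N.
Proof.
have -> : \sum_(f : {ffun 'I_N -> 'I_B.+1}) pow32 (vol (box f)) =
    \sum_(f : {ffun 'I_N -> 'I_B.+1}) \prod_(k < N) pow32 (f k).+1.
  apply: eq_bigr => f _; rewrite pow32_vol; apply: eq_bigr => k _.
  by rewrite ffunE.
rewrite -(bigA_distr_bigA (fun (k : 'I_N) (i : 'I_B.+1) => pow32 i.+1)) /=.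
rewrite prodr_const card_ord; apply: lerXn2r; rewrite ?nnegrE //.
  by apply: sumr_ge0 => i _; exact: pow32_ge0.
apply: le_trans (sum_pow32 B) _.
by rewrite gerBl divr_ge0 ?sqrtr_ge0.
Qed.

End shape_sums.

Section borel_cantelli.
Context (R : realType) (N : nat) (d : measure_display) (T : measurableType d).
Variable P : probability T R.
Variables (Bad : tshape N -> set T) (M0 : nat) (K : R).
Hypothesis K_ge0 : 0 <= K.
Hypothesis Bad_le : forall I, (M0 <= vol I)%N ->
  measurable (Bad I) /\ (P (Bad I) <= (K / (vol I)%:R ^+ 2)%:E)%E.

Let U M B := [set w | exists I : tshape N,
  [/\ forall k, (0 < I k <= B.+1)%N, (M <= vol I)%N & Bad I w]].

(* [vol I ^- 2 <= M ^- 1/2 * vol I ^- 3/2] when [M <= vol I], and the sum of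
   [vol I ^- 3/2] over a box is a product of partial sums of a convergent series. *)
Let boxed_union M B : (M0 <= M)%N -> (0 < M)%N ->
  measurable (U M B) /\ (P (U M B) <= (K * 3 ^+ N / Num.sqrt M%:R)%:E)%E.
Proof.
move=> M0M M_gt0.
pose D (f : {ffun 'I_N -> 'I_B.+1}) := if (M <= vol (box f))%N then Bad (box f) else set0.
have mD f : measurable (D f).
  by rewrite /D; case: ifP => // h; have [] := Bad_le (leq_trans M0M h).
have [mU PU] := finite_subadditivity P (enum {: {ffun 'I_N -> 'I_B.+1}}) mD.
rewrite (_ : U M B = [set w | exists2 f, f \in enum {: {ffun 'I_N -> 'I_B.+1}} & D f w]);
  last first.
  apply/seteqP; split => w /= [].
    move=> I [hI MI BI]; exists [ffun k => inord (I k).-1]; rewrite ?mem_enum // /D.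
    rewrite (_ : box _ = I) ?MI //; apply/ffunP => k; rewrite !ffunE.
    by have /andP[h1 h2] := hI k; rewrite inordK ?prednK // -ltnS prednK.
  move=> f _; rewrite /D; case: ifP => // Mf Bf; exists (box f); split=> // k.
  by rewrite ffunE /= ltn_ord.
split=> //; apply: le_trans PU _.
apply: (@le_trans _ _ (\sum_(f <- enum {: {ffun 'I_N -> 'I_B.+1}})
    (K / Num.sqrt M%:R * pow32 R (vol (box f)))%:E)%E).
  apply: lee_sum => f _; rewrite /D; case: ifP => [Mf|_]; last first.
    by rewrite measure0 lee_fin mulr_ge0 ?pow32_ge0 // divr_ge0 ?sqrtr_ge0.
  have [_ h] := Bad_le (leq_trans M0M Mf).
  apply: le_trans h _; rewrite lee_fin -mulrA ler_wpM2l //.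
  set v := vol _ in Mf *; have v0 : 0 < v%:R :> R by rewrite ltr0n (leq_trans M_gt0).
  have -> : (v%:R ^+ 2)^-1 = (Num.sqrt v%:R)^-1 * pow32 R v.
    rewrite /pow32 -invfM; congr (_^-1).
    by rewrite mulrCA -[_ * Num.sqrt _]expr2 sqr_sqrtr ?expr2 // ltW.
  rewrite ler_wpM2r ?pow32_ge0 // lef_pV2 ?posrE ?sqrtr_gt0 ?ltr0n //.
    by rewrite ler_wsqrtr // ler_nat.
  exact: leq_trans Mf.
rewrite big_enum /= sumEFin lee_fin -mulr_sumr [leRHS]mulrAC.
by rewrite ler_wpM2l ?sum_box_pow32 // divr_ge0 ?sqrtr_ge0.
Qed.

(** The boxes increase with [B] and exhaust the shapes of positive volume. The bound does not depend
    on [B], so it passes to the union by continuity from below. *)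
Let tail_union M : (M0 <= M)%N -> (0 < M)%N ->
  measurable [set w | exists2 I : tshape N, (M <= vol I)%N & Bad I w] /\
  (P [set w | exists2 I : tshape N, (M <= vol I)%N & Bad I w] <=
    (K * 3 ^+ N / Num.sqrt M%:R)%:E)%E.
Proof.
move=> M0M M_gt0.
have mU B := (boxed_union B M0M M_gt0).1.
rewrite (_ : mkset _ = \bigcup_B U M B); last first.
  apply/seteqP; split => w /=.
    move=> [I MI BI]; exists (\max_(k < N) I k)%N => //; exists I; split => // k.
    apply/andP; split; last by rewrite leqW // (leq_bigmax k).
    rewrite lt0n; apply/eqP => Ik0; move: (leq_trans M_gt0 MI).
    by rewrite /vol (bigD1 k) //= Ik0.
  by move=> [B _ [I [_ MI BI]]]; exists I.
have mUU : measurable (\bigcup_B U M B) by exact: bigcupT_measurable.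
split=> //.
apply: cvge_le (nondecreasing_cvg_mu mU mUU _).
  by apply: nearW => B; have [] := boxed_union B M0M M_gt0.
apply/nondecreasing_seqP => B; apply/subsetPset => w [I [hI MI BI]].
exists I; split => // k; have /andP[-> h] := hI k; exact: leqW.
Qed.

(** The exceptional set lies in every [W M], whose measure tends to 0 like the inverse square root
    of the volume threshold. Nothing relates the events of different shapes, as only subadditivity
    enters. *)
Lemma borel_cantelli_shapes : {ae P, forall w, \forall I \near @vol_infty N, ~ Bad I w}.
Proof.
pose W M := [set w | exists2 I : tshape N, ((M0 + M).+1 <= vol I)%N & Bad I w].
have hW M : measurable (W M) /\ (P (W M) <= (K * 3 ^+ N / Num.sqrt (M0 + M).+1%:R)%:E)%E.
  by apply: tail_union => //; rewrite leqW // leq_addr.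
exists (\bigcap_M W M); split.
- by apply: bigcapT_measurable => M; have [] := hW M.
- apply/eqP; rewrite eq_le measure_ge0 andbT; apply/lee_addgt0Pr => e e0.
  rewrite add0e; have C0 : 0 <= K * 3 ^+ N by rewrite mulr_ge0 // exprn_ge0.
  pose M := Num.truncn ((K * 3 ^+ N / e) ^+ 2).
  have [mW PW] := hW M.
  apply: (@le_trans _ _ (P (W M))).
    apply: le_measure; rewrite ?inE //; last exact: bigcap_inf.
    by apply: bigcapT_measurable => M'; have [] := hW M'.
  apply: le_trans PW _; rewrite lee_fin ler_pdivrMr ?sqrtr_gt0 //.
  rewrite [leRHS]mulrC -ler_pdivrMr //.
  rewrite -(@ler_pXn2r _ 2) ?nnegrE ?sqrtr_ge0 ?divr_ge0 ?(ltW e0) //.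
  rewrite sqr_sqrtr //; apply: le_trans (ltW (truncnS_gt _)) _.
  by rewrite ler_nat ltnS leq_addl.
- move=> w /= nw M _ /=; apply: contrapT => nWM; apply: nw.
  exists (M0 + M).+1 => // I /= MI BI; apply: nWM; exists I => //.
Qed.

End borel_cantelli.

Lemma rn_small (R : realType) (e : R) : 0 < e -> exists M, forall n, (M <= n)%N -> rn R n <= e.
Proof.
move=> e0; exists (Num.truncn (e^-1 ^+ 2)).+1 => n Mn.
have n0 : 0 < n%:R :> R by rewrite ltr0n (leq_trans _ Mn).
rewrite /rn -[leRHS]invrK lef_pV2 ?posrE ?sqrtr_gt0 ?invr_gt0 //.
rewrite -(@ler_pXn2r _ 2) ?nnegrE ?sqrtr_ge0 ?invr_ge0 ?(ltW e0) //.
rewrite sqr_sqrtr ?(ltW n0) //; apply: le_trans (ltW (truncnS_gt _)) _.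
by rewrite ler_nat.
Qed.

Section wigner_tensors.
Context (R : realType) (N : nat) (d : measure_display) (T : measurableType d).
Variables (P : probability T R) (A : forall I : tshape N, T -> tensor R I).
Variables (S : forall I : tshape N, {set midx I * midx I}).
Hypothesis hA : iid_hermitian_tensors P A S.

Local Notation eigenvalues I w := (tensor_eigenvalues
  (tscale (Num.sqrt (vol I)%:R)^-1 (@A I w))).

Lemma self_consistency_ae (z : R[i]) (eta e : R) : 0 < eta -> complex.Im z = eta ->
  0 < e ->
  {ae P, forall w, \forall I \near @vol_infty N,
    normc (self_consistency (eigenvalues I w) z) <= e}.
Proof.
move=> eta0 Imz e0; set k := 1 + eta^-1.
have k0 : 0 < k by rewrite addr_gt0 ?invr_gt0.
have z0 := normc_ge0 z.
(* Budget: [e / 2] for the defect of the rounded matrix and [e / 2] for rounding, the latter fixed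
   by [d2]. Within the first, the deterministic part must be at most [e / 4]: [dl] makes its three
   defects total [e / 8], and [d1] leaves [e / 8] for the terms in [rn] and [1 / n]. *)
pose dl := e / (24 * (20 * k ^+ 4)).
pose d1 := e / (8 * (20 * k ^+ 4 + 32 * k ^+ 2)).
pose d2 := e * eta ^+ 2 / (4 * (normc z + 2 * k)).
have k4 : 0 < k ^+ 4 by rewrite exprn_gt0.
have k2 : 0 < k ^+ 2 by rewrite exprn_gt0.
have zk : 0 < normc z + 2 * k by lra.
have dl0 : 0 < dl by rewrite divr_gt0 ?mulr_gt0.
have d10 : 0 < d1 by rewrite divr_gt0 ?mulr_gt0 ?addr_gt0 ?mulr_gt0.
have d20 : 0 < d2 by rewrite divr_gt0 ?mulr_gt0 ?exprn_gt0.
have [n0 hn0] := offdiag_law_limits hA dl0.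
have [n1 hn1] := rn_small d10; have [n2 hn2] := rn_small d20.
pose M0 := maxn (maxn 1 n0) (maxn n1 n2).
pose K := 1 + 2 ^+ 16 * k ^+ 4 / (e / 2 / (2 * (normc z + 2 * k))) ^+ 4.
have K0 : 0 <= K.
  apply: addr_ge0 => //; apply: divr_ge0; last by rewrite exprn_even_ge0.
  by apply: mulr_ge0; [exact: exprn_ge0|exact: ltW].
have BadP I : (M0 <= vol I)%N -> measurable (bad_event A S I z (e / 2)) /\
    (P (bad_event A S I z (e / 2)) <= (K / (vol I)%:R ^+ 2)%:E)%E.
  rewrite !geq_max -card_midx => /andP[/andP[n_gt0 /hn0 hl] /andP[/hn1 h1 _]].
  apply: (bad_event_probability hA n_gt0 eta0 Imz (divr_gt0 e0 _) dl0 erefl _ (hl I)) => //.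
  rewrite -/k; set n := #|_| in n_gt0 h1 *.
  have nr := invn_le_rn R n_gt0.
  have hd : 20 * k ^+ 4 * (dl + dl + dl) = e / 8.
    by rewrite /dl; field; rewrite gt_eqF.
  have h2 : 32 * k ^+ 2 / n%:R <= 32 * k ^+ 2 * rn R n.
    by rewrite ler_wpM2l // mulr_ge0 // ltW.
  have h3 : (20 * k ^+ 4 + 32 * k ^+ 2) * rn R n <= e / 8.
    apply: le_trans (ler_wpM2l _ h1) _; first by rewrite addr_ge0 // mulr_ge0 // ltW.
    rewrite le_eqVlt; apply/orP; left; apply/eqP; rewrite /d1; field.
    by rewrite gt_eqF // addr_gt0 // mulr_gt0.
  by rewrite [X in X + _]mulrDr hd; move: h2 h3; rewrite mulrDl; lra.
apply: filterS (borel_cantelli_shapes K0 BadP) => w [M _ hM].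
exists (maxn M M0) => // I /=; rewrite geq_max => /andP[/hM nbad].
rewrite !geq_max => /andP[/andP[n_gt0 _] /andP[_ /hn2 h2]].
rewrite -card_midx in n_gt0 h2.
have ntail : ~ tail_event A I w by move=> h; apply: nbad; left.
have ndef : normc (sc_defect (@cval R _) (hset S I) z
    (discretized #|midx I| (hset S I) (hentry A (I := I)) w)) <= e / 2.
  by rewrite leNgt; apply/negP => h; apply: nbad; right.
have := self_consistency_sc_defect hA n_gt0 eta0 Imz ntail.
set s := self_consistency _ _; move: ndef; set s' := sc_defect _ _ _ _ => ndef dist.
rewrite -[s](subrK s'); apply: le_trans (le_normcD _ _) _.
rewrite [leRHS]splitr.
apply: lerD ndef; apply: le_trans dist _; rewrite -/k.
apply: (@le_trans _ _ (2 * d2 / eta ^+ 2 * (normc z + 2 * k))).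
  rewrite ler_wpM2r ?(ltW zk) // ler_wpM2r ?invr_ge0 ?exprn_ge0 ?(ltW eta0) //.
  by rewrite ler_wpM2l.
rewrite le_eqVlt; apply/orP; left; apply/eqP; rewrite /d2; field.
by rewrite !gt_eqF.
Qed.

End wigner_tensors.

Theorem theorem1 (R : realType) (N : nat)
    (d : measure_display) (T : measurableType d) (P : probability T R)
    (A : forall I : tshape N, T -> tensor R I)
    (S : forall I : tshape N, {set midx I * midx I})
    (hA : iid_hermitian_tensors P A S) :
  {ae P, forall w : T,
    weak_cvg (@vol_infty N)
      (fun I : tshape N => empirical_distribution
         (tensor_eigenvalues
            (tscale (Num.sqrt (vol I)%:R)^-1 (A I w))))
      (@semicircle R)}.
Proof.
(* Countably many points and precisions [1 / (l + 1)], so that the exceptional null sets can be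
   united; each of them already accounts for all shapes at once. *)
have H : {ae P, forall w, forall a b k l, \forall I \near @vol_infty N,
    normc (self_consistency (tensor_eigenvalues
      (tscale (Num.sqrt (vol I)%:R)^-1 (A I w)))
      (cplx (grid R a b) k.+1%:R^-1)) <= l.+1%:R^-1}.
  apply: ae_foralln => a; apply: ae_foralln => b.
  apply: ae_foralln => k; apply: ae_foralln => l.
  by apply: (self_consistency_ae hA) (erefl _) _; rewrite ?invr_gt0 ?ltr0n.
apply: filterS H => w H; apply: weak_cvg_self_consistency.
  by exists 1%N => // I /=; rewrite size_tensor_eigenvalues card_midx.
move=> a b k e e0; apply: filterS (H a b k (Num.truncn e^-1)) => I h.
apply: le_trans h _.
by rewrite -[leRHS]invrK lef_pV2 ?posrE ?invr_gt0 ?ltr0n // ltW // truncnS_gt.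
Qed.
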